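(* Let $d=1$, let $W$ be an admissible interaction potential that is confining, and let $\mu^0\in\mathscr{P}$ have compact support. Let $\mu$ be the gradient flow solution of the interaction system with initial datum $\mu^0$. Then there exists a constant $K=K(\mu^0)>0$ independent of $t$ such that for all $t\ge0$ and all $i\in\{1,\ldots,n\}$: $$\operatorname{supp}\mu_i(t)\subset[-K,K].$$
   Context: Spatial dimension $d=1$. Let $n\in\mathbb{N}$, $m_1,\ldots,m_n>0$, $p_1,\ldots,p_n>0$, $E\in\mathbb{R}$ be fixed. Admissible interaction potential: a map $W:\mathbb{R}\to\mathbb{R}^{n\times n}$ such that $W(z)$ is a symmetric matrix for each $z$; $W_{ij}\in C^1(\mathbb{R};\mathbb{R})$ for all $i,j$; $W(z)=W(-z)$ for all $z$; there is a matrix $\overline W\in\mathbb{R}^{n\times n}$ with $|W_{ij}(z)|\le\overline W_{ij}(1+|z|^2)$ for all $z,i,j$; and there is a symmetric matrix $\kappa\in\mathbb{R}^{n\times n}$ such that $z\mapsto W_{ij}(z)-\frac12\kappa_{ij}|z|^2$ is convex for all $i,j$. Confining: an admissible $W$ is confining if there exists $R>0$ such that (i) the system is irreducible at large distance, i.e. the graph with nodes $\{1,\ldots,n\}$ and edges $\{(i,j):W_{ij}'\not\equiv0\text{ on }(R,\infty)\}$ is connected; and (ii) there exists a matrix $C\in\mathbb{R}^{n\times n}$ such that for all $i,j$ the map $z\mapsto W_{ij}(z)-\frac12C_{ij}z^2$ is convex on $(R,\infty)$, and: if $n=1$, then $C>0$; if $n>1$, then with $\tilde\eta_i:=\min_{j\neq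 i}C_{ij}m_j$, $$\tilde\lambda_0:=\min_{i\in\{1,\ldots,n\}}\left[p_i\min(0,m_iC_{ii}-\tilde\eta_i)+\frac12\sum_{j=1}^np_j\left(\tilde\eta_j+\tilde\eta_i\frac{m_i}{m_j}\right)\right]>0.$$ Interaction system: $\partial_t\mu_i=\partial_x\big[m_i\mu_i\,\partial_x\big(\sum_{j=1}^nW_{ij}*\mu_j\big)\big]$, $i=1,\ldots,n$; it holds in the sense of distributions if for all $i$ and all $\varphi\in C_c^\infty((0,\infty)\times\mathbb{R})$: $\int_0^\infty\int_{\mathbb{R}}\big(\partial_t\varphi(t,x)-m_i\partial_x\varphi(t,x)\sum_{j=1}^n\int W_{ij}'(x-y)\,\mathrm{d}\mu_j(t,y)\big)\mathrm{d}\mu_i(t,x)\,\mathrm{d}t=0$. $\mathscr{P}$ is the set of $n$-tuples $\mu=(\mu_1,\ldots,\mu_n)$ of nonnegative Borel measures on $\mathbb{R}$ with $\mu_j(\mathbb{R})=p_j$, finite second moments, and $\sum_{j=1}^n\frac1{m_j}\int_{\mathbb{R}}x\,\mathrm{d}\mu_j(x)=E$, with the distance $$\mathbf{W}_{\mathscr{P}}(\mu^0,\mu^1)=\Big[\sum_{j=1}^n\frac1{m_j}\inf\Big\{\int|x-y|^2\,\mathrm{d}\gamma_j(x,y):\gamma_j\in\Gamma(\mu^0_j,\mu^1_j)\Big\}\Big]^{1/2},$$ where $\Gamma(\mu^0_j,\mu^1_j)$ is the set of finite Borel measures on $\mathbb{R}\times\mathbb{R}$ with marginals $\mu_j^0,\mu_j^1$.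 ''$\mu^0$ has compact support'' means every component has compact support. $AC^2_{\mathrm{loc}}([0,\infty);(X,\mathbf{d}))$ is the set of curves $\mu:[0,\infty)\to X$ such that for each $T>0$ there is $\varphi\in L^2([0,T])$ with $\mathbf{d}(\mu(s),\mu(t))\le\int_s^t\varphi(r)\,\mathrm{d}r$ for $0\le s\le t\le T$. The gradient flow solution with initial datum $\mu^0\in\mathscr{P}$ is the (existing and unique) curve in $AC^2_{\mathrm{loc}}([0,\infty);(\mathscr{P},\mathbf{W}_{\mathscr{P}}))$ with $\mu(0)=\mu^0$ for which the interaction system holds in the sense of distributions. *)

(* Defs.v *)
From HB Require Import structures.
From mathcomp Require Import all_boot all_order all_algebra.
From mathcomp Require Import all_classical all_reals all_analysis.

Set Implicit Arguments.
Unset Strict Implicit.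
Unset Printing Implicit Defensive.

Import Order.TTheory GRing.Theory Num.Theory.
Import numFieldNormedType.Exports.

Local Open Scope classical_set_scope.
Local Open Scope ring_scope.

(* Minimum of a finite family of reals. The value [+oo] of an empty minimum is
   sent to 0 by [fine]; below the index set is always nonempty. *)
Definition minR (R : realType) (n : nat) (P : pred 'I_n) (F : 'I_n -> R) : R :=
  fine (\big[Order.min/+oo%E]_(i < n | P i) (F i)%:E).

Section Potential.
Variables (R : realType) (n : nat).
Implicit Types (W : R -> 'M[R]_n) (C : 'M[R]_n) (m p : 'I_n -> R).

Definition C1 (f : R -> R) : Prop :=
  (forall z, derivable f z 1) /\ continuous (derive1 f).

Record admissible W : Prop := Admissible {
  admissible_sym : forall z, (W z)^T = W z;
  admissible_C1 : forall i j, C1 (fun z => W z i j);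
  admissible_even : forall z, W z = W (- z);
  admissible_growth : exists Wbar : 'M[R]_n,
    forall z i j, `|W z i j| <= Wbar i j * (1 + `|z| ^+ 2);
  admissible_convex : exists kappa : 'M[R]_n, kappa^T = kappa /\
    forall i j, convex_function (setT : set R)
      (fun z => W z i j - 2^-1 * kappa i j * `|z| ^+ 2) }.

Definition interaction_graph W (r : R) : rel 'I_n :=
  fun i j => `[< exists2 z, r < z & derive1 (fun x => W x i j) z != 0 >].

Definition irreducible_at_large_distance W (r : R) : Prop :=
  forall i j, connect (interaction_graph W r) i j.

Definition eta_tilde m C (i : 'I_n) : R :=
  minR (fun j => j != i) (fun j => C i j * m j).

Definition lambda0_tilde m p C : R :=
  minR predT (fun i =>
    p i * Num.min 0 (m i * C i i - eta_tilde m C i)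
    + 2^-1 * \sum_(j < n)
        p j * (eta_tilde m C j + eta_tilde m C i * (m i / m j))).

Definition confining m p W : Prop :=
  exists r : R, [/\ 0 < r, irreducible_at_large_distance W r &
    exists C : 'M[R]_n,
      [/\ forall i j, convex_function (`]r, +oo[%classic : set R)
            (fun z => W z i j - 2^-1 * C i j * z ^+ 2),
          n = 1%N -> forall i, 0 < C i i &
          (1 < n)%N -> 0 < lambda0_tilde m p C]].

End Potential.

Section Measures.
Variable R : realType.
Implicit Types mu nu : {finite_measure set R -> \bar R}.

Definition measure_supp mu : set R :=
  [set x | forall U : set R, open U -> U x -> (0 < mu U)%E].

Definition coupling mu nu : set {finite_measure set (R * R)%type -> \bar R} :=
  [set g | forall A : set R, measurable A ->
    pushforward g fst A = mu A /\ pushforward g snd A = nu A].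

Definition transport_cost mu nu : \bar R :=
  ereal_inf [set (\int[g]_z (`|z.1 - z.2| ^+ 2)%:E)%E | g in coupling mu nu].

End Measures.

Section StateSpace.
Variables (R : realType) (n : nat).
Implicit Types (m p : 'I_n -> R) (E : R)
  (mu nu : 'I_n -> {finite_measure set R -> \bar R}).

Record scrP m p E mu : Prop := ScrP {
  scrP_mass : forall j, mu j setT = (p j)%:E;
  scrP_moment2 : forall j, (\int[mu j]_x (x ^+ 2)%:E < +oo)%E;
  scrP_center : \sum_(j < n) (m j)^-1 * \int[mu j]_x x = E }.

(* On [scrP m p E] every transport cost is finite (the components have equal
   mass and finite second moments), so [fine] loses nothing. *)
Definition distP m mu nu : R :=
  Num.sqrt (\sum_(j < n) (m j)^-1 * fine (transport_cost (mu j) (nu j))).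

(* A curve [0, +oo) -> scrP is a function on R of which only the values at
   nonnegative times matter. *)
Definition AC2loc m p E
    (mu : R -> 'I_n -> {finite_measure set R -> \bar R}) : Prop :=
  (forall t, 0 <= t -> scrP m p E (mu t)) /\
  forall T : R, 0 < T -> exists phi : R -> R,
    [/\ measurable_fun (`[0, T] : set R) phi,
        (\int[lebesgue_measure]_(r in `[0%R, T]) (`|phi r| ^+ 2)%:E < +oo)%E &
        forall s t, 0 <= s -> s <= t -> t <= T ->
          distP m (mu s) (mu t) <= \int[lebesgue_measure]_(r in `[s, t]) phi r].

End StateSpace.

Section TestFunctions.
Variable R : realType.
Implicit Type f : R * R -> R.

Definition partial_t f : R * R -> R := 'D_((1, 0) : R * R) f.
Definition partial_x f : R * R -> R := 'D_((0, 1) : R * R) f.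

Fixpoint Ck (k : nat) f : Prop :=
  if k is k'.+1 then
    [/\ continuous f,
        forall z, derivable f z ((1, 0) : R * R) /\
                  derivable f z ((0, 1) : R * R),
        Ck k' (partial_t f) & Ck k' (partial_x f)]
  else continuous f.

(* C_c^oo((0,+oo) x R), each function being extended by 0 to the plane. *)
Definition test_function f : Prop :=
  [/\ forall k, Ck k f, compact (closure [set z | f z != 0]) &
      closure [set z | f z != 0] `<=` [set z | 0 < z.1]].

End TestFunctions.

Section GradientFlow.
Variables (R : realType) (n : nat).
Implicit Types (m p : 'I_n -> R) (E : R) (W : R -> 'M[R]_n)
  (mu : R -> 'I_n -> {finite_measure set R -> \bar R}).

Definition distributional_solution m W mu : Prop :=
  forall (i : 'I_n) (phi : R * R -> R), test_function phi ->
    \int[lebesgue_measure]_(t in `]0, +oo[)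
      \int[mu t i]_x
        (partial_t phi (t, x) - m i * partial_x phi (t, x) *
          \sum_(j < n) \int[mu t j]_y derive1 (fun z => W z i j) (x - y)) = 0.

(* The measures in [mu 0] and [mu0] are compared on measurable sets only,
   where a measure is determined. *)
Definition gradient_flow_solution m p E W
    (mu0 : 'I_n -> {finite_measure set R -> \bar R}) mu : Prop :=
  [/\ AC2loc m p E mu,
      forall i A, measurable A -> mu 0 i A = mu0 i A &
      distributional_solution m W mu].

End GradientFlow.

(* Main.v *)
(* Two Lyapunov functionals of the form sum_i (1/m_i) int psi dmu_i. Confinement
   yields W_ij'(z) >= s_ij z - D - L max(0, -z) with sum_j p_j s_ij >= lam/m_i and,
   at fixed weighted center E, a quadratic form sum_ij s_ij a_i a_j of the first
   moments a_i bounded by E times a linear form in them.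
   For psi = x^2 the rate of change is at most C - lam * (the functional), so the
   second moments, hence the first moments, stay bounded by some A uniformly in
   time. For psi a smooth version of (|x| - B)_+, a particle at |x| > B is pushed
   inwards by the linear part of the force as soon as B is large in terms of A,
   and only particles lying further out on the same side, whose first moment is
   controlled by the functional itself, can push it outwards; thus the functional
   F satisfies F' <= C F. It vanishes initially if [-B, B] contains the initial
   supports, hence it vanishes forever.
   The time derivatives are legitimate because an AC^2 curve is continuous in time
   when tested with quadratically growing functions, so that the distributional
   formulation, first used with compactly supported tensor products, integrates in
   time and extends by cut-off to psi. *)
Require Import Defs.
From HB Require Import structures.
From mathcomp Require Import all_boot all_order all_algebra.
From mathcomp Require Import all_classical all_reals all_analysis.
From mathcomp Require Import measurable_realfun ring lra.
Import Order.TTheory GRing.Theory Num.Theory.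
Import numFieldNormedType.Exports.
Set Implicit Arguments.
Unset Strict Implicit.
Unset Printing Implicit Defensive.
Local Open Scope classical_set_scope.
Local Open Scope ring_scope.

(** * Smooth functions *)

(** The weights [1/m_i] cancel the mobilities, so the rate of change of each functional is a double
    sum over pairs of particles which can be symmetrised in [(i, x)] and [(j, y)]. Confinement
    enters through [C_ij >= eta_i / m_j + delta_i [i = j]] with [delta_i <= 0]: the rank-one part
    matches the weights of the center, which is how [E] appears, and the diagonal part has the
    favourable sign. At negative [z] the force is known only up to linear growth. This is harmless
    for [x^2], because [z W_ij'(z)] is even, but outside a ball such a push must be paid by the
    functional itself. This dictates a convex [psi] with [psi'(x) (y - x) <= psi(y)], realised by
    [x exp(-1/x)]. As [K] is chosen before the curve, every constant in it must come from [mu0]; the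
    bounds drawn from the AC^2 property depend on the curve and on the time interval, and serve only
    to justify integrations and to start the Gronwall argument. The functionals are known only as
    integrals of bounded measurable rates, so both comparison arguments work with increments instead
    of derivatives. *)

Section Smooth.
Variable R : realType.
Implicit Types (f g u : R -> R) (x : R).

(** The derivative is existentially quantified, so that closure under products and compositions goes
    by induction on [k] with the explicit derivative as witness. *)
Fixpoint smooth_upto (k : nat) f : Prop :=
  if k is k'.+1 then
    exists2 f' : R -> R, (forall x : R, is_derive x 1 f (f' x)) & smooth_upto k' f'
  else continuous f.

Definition smooth f := forall k, smooth_upto k f.

Lemma is_derive_val f x a b : is_derive x 1 f a -> a = b -> is_derive x 1 f b.
Proof. by move=> ? <-. Qed.

Lemma is_derive_continuous f f' :
  (forall x : R, is_derive x 1 f (f' x)) -> continuous f.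
Proof.
move=> df x; apply: differentiable_continuous.
by apply/derivable1_diffP; have [] := df x.
Qed.

Lemma smooth_upto_continuous k f : smooth_upto k f -> continuous f.
Proof. by case: k => //= k [f' /is_derive_continuous]. Qed.

Lemma smooth_continuous f : smooth f -> continuous f.
Proof. by move/(_ 0%N). Qed.

Lemma smooth_uptoW k f : smooth_upto k.+1 f -> smooth_upto k f.
Proof.
elim: k f => [|k IH] f; first exact: smooth_upto_continuous.
by move=> [f' df sf']; exists f' => //; apply: IH.
Qed.

Lemma smooth_derive1 f : smooth f -> smooth (derive1 f).
Proof.
move=> sf k; have [f' df sf'] := sf k.+1.
suff -> : derive1 f = f' by [].
by apply/funext => x; rewrite derive1E; case: (df x).
Qed.

Lemma smooth_derivable f x : smooth f -> derivable f x 1.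
Proof. by move=> /(_ 1%N)[f' df _]; case: (df x). Qed.

Lemma smooth_is_derive f x : smooth f -> is_derive x 1 f (derive1 f x).
Proof. by move=> sf; rewrite derive1E; apply/derivableP/smooth_derivable. Qed.

Lemma smooth_ext f g : f =1 g -> smooth f -> smooth g.
Proof. by move=> /funext ->. Qed.

Lemma smooth_upto_cst k c : smooth_upto k (fun=> c).
Proof.
elim: k c => [|k IH] c /=; first by move=> x; exact: cst_continuous.
by exists (fun=> 0) => // x; exact: is_derive_cst.
Qed.

Lemma smooth_cst c : smooth (fun=> c).
Proof. by move=> k; exact: smooth_upto_cst. Qed.

Lemma smooth_id : smooth id.
Proof.
move=> [|k] /=; first by move=> x; exact: cvg_id.
by exists (fun=> 1) => [x|]; [exact: is_derive_id|exact: smooth_upto_cst].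
Qed.

Lemma smooth_uptoD k f g :
  smooth_upto k f -> smooth_upto k g -> smooth_upto k (fun x => f x + g x).
Proof.
elim: k f g => [|k IH] f g /=.
  by move=> cf cg x; apply: continuousD; [exact: cf|exact: cg].
move=> [f' df sf] [g' dg sg]; exists (fun x => f' x + g' x); last exact: IH.
by move=> x; apply: is_deriveD.
Qed.

Lemma smoothD f g : smooth f -> smooth g -> smooth (fun x => f x + g x).
Proof. by move=> sf sg k; exact: smooth_uptoD. Qed.

Lemma smooth_uptoM k f g :
  smooth_upto k f -> smooth_upto k g -> smooth_upto k (fun x => f x * g x).
Proof.
elim: k f g => [|k IH] f g.
  by move=> cf cg x; apply: continuousM; [exact: cf|exact: cg].
(* The derivative of the product contains [f] and [g] undifferentiated, so their smoothness of order
   [k] is kept for the induction hypothesis. *)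
move=> sf sg; have sf0 := smooth_uptoW sf; have sg0 := smooth_uptoW sg.
case: sf sg => [f' df sf] [g' dg sg].
exists (fun x => f x * g' x + g x * f' x); last by apply: smooth_uptoD; exact: IH.
by move=> x; apply: is_deriveM.
Qed.

Lemma smoothM f g : smooth f -> smooth g -> smooth (fun x => f x * g x).
Proof. by move=> sf sg k; exact: smooth_uptoM. Qed.

Lemma smooth_upto_comp k f g :
  smooth_upto k f -> smooth_upto k g -> smooth_upto k (fun x => f (g x)).
Proof.
elim: k f g => [|k IH] f g.
  by move=> cf cg x; apply: continuous_comp; [exact: cg|exact: cf].
move=> sf sg; have sf0 := smooth_uptoW sf; have sg0 := smooth_uptoW sg.
case: sf sg => [f' df sf] [g' dg sg].
exists (fun x => f' (g x) * g' x); last by apply: smooth_uptoM => //; exact: IH.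
by move=> x; apply: is_derive1_comp.
Qed.

Lemma smooth_comp f g : smooth f -> smooth g -> smooth (fun x => f (g x)).
Proof. by move=> sf sg k; exact: smooth_upto_comp. Qed.

Lemma smoothV u : (forall x, u x != 0) -> smooth u -> smooth (fun x => (u x)^-1).
Proof.
move=> u0 su; suff: forall k, smooth_upto k u -> smooth_upto k (fun x => (u x)^-1).
  by move=> h k; exact: h.
elim=> [|k IH].
  by move=> cu x; apply: cvgV => //; exact: cu.
move=> su1; have su0 := smooth_uptoW su1; case: su1 => u' du su'.
exists (fun x => -1 * (u' x * ((u x)^-1 * (u x)^-1))); last first.
  apply: smooth_uptoM; first exact: smooth_upto_cst.
  by apply: smooth_uptoM => //; apply: smooth_uptoM; exact: IH.
move=> x; apply: (is_derive_val (is_deriveV (u0 x) (du x))).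
by rewrite /GRing.scale /= expr2 invfM mulN1r mulNr; congr (- _); rewrite mulrC.
Qed.

Lemma smooth_affine (a b : R) : smooth (fun x => a * x + b).
Proof.
by apply: smoothD; [apply: smoothM; [exact: smooth_cst|exact: smooth_id]|exact: smooth_cst].
Qed.

End Smooth.

(** * Flat functions, ramp and step *)

Section Flat.
Variable R : realType.
Implicit Types (x y h : R) (a : nat).

(** Indexing by the power [a] makes the family closed under differentiation up to linear
    combinations, so that one induction proves all members smooth. *)
Definition flat a x : R := if 0 < x then x^-1 ^+ a * expR (- x^-1) else 0.

Lemma flat_le0 a x : x <= 0 -> flat a x = 0.
Proof. by rewrite /flat ltNge => ->. Qed.

Lemma flat_ge0 a x : 0 <= flat a x.
Proof.
rewrite /flat; case: ifP => // x0.
by rewrite mulr_ge0 ?expR_ge0// exprn_ge0// invr_ge0 ltW.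
Qed.

Lemma flat_gt0 a x : 0 < x -> 0 < flat a x.
Proof. by move=> x0; rewrite /flat x0 mulr_gt0 ?expR_gt0// exprn_gt0// invr_gt0. Qed.

Lemma flatS a x : flat a.+1 x = x^-1 * flat a x.
Proof. by rewrite /flat; case: ifP => _; rewrite ?mulr0// exprS mulrA. Qed.

(** With [u = 1/x], the exponential series gives [exp u >= u^(a+1) / (a+1)!], hence
    [u^a exp(-u) <= (a+1)! / u]. *)
Lemma flat_le a x : 0 < x -> flat a x <= a.+1`!%:R * x.
Proof.
move=> x0; rewrite /flat x0; set u := x^-1.
have u0 : 0 < u by rewrite invr_gt0.
have := expR_ge1Dxn a (ltW u0).
have fp : 0 < a.+1`!%:R :> R by rewrite ltr0n fact_gt0.
rewrite expRN => h.
have h2 : u ^+ a.+1 / a.+1`!%:R <= expR u by apply: le_trans h; rewrite lerDr.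
rewrite ler_pdivrMr ?expR_gt0//.
have -> : x = u^-1 by rewrite invrK.
rewrite -mulrA [u^-1 * _]mulrC mulrA ler_pdivlMr//.
by rewrite -exprSr mulrC -ler_pdivrMr.
Qed.

Lemma is_derive_flat a x :
  is_derive x 1 (flat a) (flat a.+2 x - a%:R * flat a.+1 x).
Proof.
have [x0|x0|->] := ltgtP x 0.
- rewrite !flat_le0 1?ltW// mulr0 subr0.
  apply: (@near_eq_is_derive _ _ _ (cst 0)).
  near=> y; rewrite flat_le0//= ltW//; near: y.
  exact: lt_nbhsl.
- apply: (@near_eq_is_derive _ _ _ (fun y => y^-1 ^+ a * expR (- y^-1))).
    near=> y; rewrite /flat ifT//; near: y.
    exact: lt_nbhsr.
  have xn0 : x != 0 by rewrite gt_eqF.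
  have dV : is_derive x 1 (fun y : R => y^-1) (- (x ^- 2)).
    apply: (is_derive_val (is_deriveV (f := id) xn0 (is_derive_id _ _))).
    by rewrite /GRing.scale /= mulr1.
  have dVa : is_derive x 1 (fun y : R => y^-1 ^+ a) (a%:R * x^-1 ^+ a.-1 * - (x ^- 2)).
    have := is_deriveX a dV; rewrite exprfctE => /is_derive_val; apply.
    by rewrite /GRing.scale /= mulr_natl.
  have dE : is_derive x 1 (fun y : R => expR (- y^-1)) (expR (- x^-1) * (x ^- 2)).
    apply: (is_derive_val (is_derive1_comp (is_derive_expR _) (is_deriveN dV))).
    by rewrite opprK.
  apply: (is_derive_val (is_deriveM dVa dE)).
  rewrite /flat x0 /GRing.scale /= -!exprVn; set u := x^-1; set e := expR _.
  case: a {dVa} => [|a] /=; rewrite ?exprS ?expr0; first by ring.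
  by rewrite -natr1; ring.
rewrite !flat_le0// mulr0 subr0.
(* At [0] the difference quotient [flat a h / h] is [flat a.+1 h], which [flat_le] sends to [0]. *)
have key : (fun h => h^-1 *: (flat a (h *: 1 + 0) - flat a 0)) @ 0^' --> (0 : R).
  apply/cvgr0Pnorm_lt => e e0.
  have fp : 0 < a.+2`!%:R :> R by rewrite ltr0n fact_gt0.
  near=> h.
  rewrite [flat a 0]flat_le0// subr0 addr0 /GRing.scale /= mulr1 -flatS.
  have [h0|h0] := leP h 0; first by rewrite flat_le0// normr0.
  rewrite ger0_norm ?flat_ge0//; apply: le_lt_trans (flat_le _ h0) _.
  rewrite mulrC -ltr_pdivlMr//; apply: le_lt_trans (ler_norm _) _.
  near: h; apply: dnbhs0_lt; exact: divr_gt0.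
apply: DeriveDef; first by apply/cvg_ex; exists 0.
exact: cvg_lim key.
Unshelve. all: by end_near. Qed.

Lemma smooth_flat a : smooth (flat a).
Proof.
move=> k; elim: k a => [|k IH] a.
  exact: is_derive_continuous (is_derive_flat a).
exists (fun x => flat a.+2 x + (- a%:R) * flat a.+1 x).
  by move=> x; rewrite mulNr; exact: is_derive_flat.
by apply: smooth_uptoD => //; apply: smooth_uptoM => //; exact: smooth_upto_cst.
Qed.

(** A smooth convex substitute for the positive part: zero to the left of [0], positive to the
    right, with slope between [0] and [1]. *)
Definition ramp x := x * flat 0 x.
Definition dramp x := flat 0 x + flat 1 x.

Lemma is_derive_ramp x : is_derive x 1 ramp (dramp x).
Proof.
apply: (is_derive_val (is_deriveM (is_derive_id _ _) (is_derive_flat 0 x))).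
rewrite mul0r subr0 /GRing.scale /= mulr1 /dramp addrC; congr (_ + _).
rewrite !flatS; have [x0|x0] := leP x 0; first by rewrite flat_le0// !mulr0.
by rewrite mulVKf// gt_eqF.
Qed.

Lemma smooth_ramp : smooth ramp.
Proof. by apply: smoothM; [exact: smooth_id|exact: smooth_flat]. Qed.

Lemma ramp_le0 x : x <= 0 -> ramp x = 0.
Proof. by move=> x0; rewrite /ramp flat_le0 ?mulr0. Qed.

Lemma dramp_le0 x : x <= 0 -> dramp x = 0.
Proof. by move=> x0; rewrite /dramp !flat_le0 ?addr0. Qed.

Lemma ramp_ge0 x : 0 <= ramp x.
Proof.
have [x0|x0] := leP x 0; first by rewrite ramp_le0.
by rewrite mulr_ge0 ?flat_ge0 ?ltW.
Qed.

Lemma ramp_gt0 x : 0 < x -> 0 < ramp x.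
Proof. by move=> x0; rewrite mulr_gt0 ?flat_gt0. Qed.

Lemma flat0_le1 x : flat 0 x <= 1.
Proof.
rewrite /flat; case: ifP => // x0.
by rewrite expr0 mul1r expR_le1 oppr_le0 invr_ge0 ltW.
Qed.

Lemma ramp_le x : ramp x <= `|x|.
Proof.
have [x0|x0] := leP x 0; first by rewrite ramp_le0.
by rewrite gtr0_norm// /ramp ler_piMr ?flat0_le1 ?ltW.
Qed.

Lemma dramp_ge0 x : 0 <= dramp x.
Proof. by rewrite addr_ge0 ?flat_ge0. Qed.

(** With [u = 1/x] the slope is [(1 + u) exp(-u)], and [1 + u <= exp u]. *)
Lemma dramp_le1 x : dramp x <= 1.
Proof.
have [x0|x0] := leP x 0; first by rewrite dramp_le0.
rewrite /dramp /flat x0 expr0 expr1 -mulrDl expRN ler_pdivrMr ?expR_gt0// mul1r.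
exact: expR_ge1Dx.
Qed.

(* With u = 1/x, w = 1/y and d = u - w, the claim reads (1 + 1/u) d <= e^d,
   which holds because d <= u. *)
Lemma dramp_ramp x y : dramp x * (y - x) <= ramp y.
Proof.
have [x0|x0] := leP x 0; first by rewrite dramp_le0// mul0r ramp_ge0.
have [yx|xy] := leP y x.
  by apply: le_trans (ramp_ge0 y); rewrite mulr_ge0_le0 ?dramp_ge0// subr_le0.
have y0 := lt_trans x0 xy.
rewrite /dramp /ramp /flat x0 y0 expr0 expr1 -mulrDl mul1r.
set u := x^-1; set w := y^-1.
have u0 : 0 < u by rewrite invr_gt0.
have w0 : 0 < w by rewrite invr_gt0.
have -> : x = u^-1 by rewrite invrK.
have -> : y = w^-1 by rewrite invrK.
have wu : w < u by rewrite ltf_pV2 ?posrE.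
have -> : w^-1 - u^-1 = (u - w) / (u * w) by field; rewrite !gt_eqF.
have -> : expR (- w) = expR (- u) * expR (u - w) by rewrite -expRD; congr expR; ring.
have -> : (1 + u) * expR (- u) * ((u - w) / (u * w)) =
   w^-1 * expR (- u) * ((1 + u) * (u - w) / u) by field; rewrite !gt_eqF.
rewrite [leRHS]mulrA ler_wpM2l//; first by rewrite mulr_ge0 ?expR_ge0// invr_ge0 ltW.
apply: le_trans (expR_ge1Dx _).
rewrite ler_pdivrMr//; nra.
Qed.

(** The usual smooth transition from [0] to [1] across the unit interval, the profile of the
    cut-offs in time and in space. The denominator is positive because [x] or [1 - x] is. *)
Definition step x := flat 0 x / (flat 0 x + flat 0 (1 - x)).

Let den_gt0 x : 0 < flat 0 x + flat 0 (1 - x).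
Proof.
have [x0|x0] := leP x 0; last by rewrite ltr_wpDr ?flat_ge0 ?flat_gt0.
by rewrite ltr_wpDl ?flat_ge0 ?flat_gt0//; lra.
Qed.

Lemma smooth_step : smooth step.
Proof.
apply: smoothM; first exact: smooth_flat.
apply: smoothV; first by move=> x; rewrite gt_eqF.
apply: smoothD; first exact: smooth_flat.
apply: (@smooth_comp _ (flat 0) (fun x => 1 - x)); first exact: smooth_flat.
by apply: smooth_ext (smooth_affine (-1) 1) => x; rewrite mulN1r addrC.
Qed.

Lemma step_le0 x : x <= 0 -> step x = 0.
Proof. by move=> x0; rewrite /step flat_le0 ?mul0r. Qed.

Lemma step_ge1 x : 1 <= x -> step x = 1.
Proof.
move=> x1; rewrite /step [flat 0 (1 - x)]flat_le0 ?subr_le0// addr0 mulfV//.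
by rewrite gt_eqF// flat_gt0//; lra.
Qed.

Lemma step_ge0 x : 0 <= step x.
Proof. by rewrite divr_ge0 ?flat_ge0 ?ltW. Qed.

Lemma step_le1 x : step x <= 1.
Proof. by rewrite ler_pdivrMr// mul1r lerDl flat_ge0. Qed.

Lemma dstep_le0 x : x < 0 -> derive1 step x = 0.
Proof.
move=> x0; rewrite derive1E (@near_eq_derive _ _ _ _ (cst 0)) ?derive_cst//.
near=> y; rewrite step_le0//= ltW//; near: y; exact: lt_nbhsl.
Unshelve. all: by end_near. Qed.

Lemma dstep_ge1 x : 1 < x -> derive1 step x = 0.
Proof.
move=> x0; rewrite derive1E (@near_eq_derive _ _ _ _ (cst (1 : R))) ?derive_cst//.
near=> y; rewrite step_ge1//= ltW//; near: y; exact: lt_nbhsr.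
Unshelve. all: by end_near. Qed.

(** The derivative vanishes off the unit interval and is continuous on it. One is added to the
    maximum to make the bound positive, since it later serves as a divisor. *)
Lemma dstep_bounded : exists2 c, 0 < c & forall x, `|derive1 step x| <= c.
Proof.
have cd : {within `[0, 1], continuous (fun x : R => `|derive1 step x|)}.
  apply: continuous_subspaceT => x; apply: cvg_norm.
  by apply: smooth_continuous; apply: smooth_derive1; exact: smooth_step.
have [c c01 hc] := EVT_max ler01 cd.
exists (`|derive1 step c| + 1) => [|x]; first by rewrite ltr_wpDl.
have [x0|x0] := ltP x 0; first by rewrite dstep_le0// normr0 addr_ge0.
have [x1|x1] := ltP 1 x; first by rewrite dstep_ge1// normr0 addr_ge0.
by rewrite (le_trans (hc x _)) ?in_itv /= ?x0 ?x1// lerDl.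
Qed.

End Flat.

(** * Tensor products as test functions *)

Section TestFunctions.
Variable R : realType.
Implicit Types (f g u : R -> R) (z : R * R).

Definition tensor f g : R * R -> R := fun z => f z.1 * g z.2.

Lemma is_derive_tensor1 f g z : smooth f ->
  is_derive z ((1, 0) : R * R) (tensor f g) (derive1 f z.1 * g z.2).
Proof.
move=> sf; have [df dfE] := smooth_is_derive z.1 sf.
have key : (fun h : R => h^-1 *: ((tensor f g \o shift z) (h *: ((1, 0) : R * R))
    - tensor f g z)) @ 0^' --> derive1 f z.1 * g z.2.
  rewrite (_ : (fun h : R => _) = (fun h : R =>
      h^-1 *: ((f \o shift z.1) (h *: 1) - f z.1) * g z.2)).
    by apply: cvgM; [rewrite -dfE; exact: df|exact: cvg_cst].
  apply/funext => h; rewrite /tensor /GRing.scale /= !scaler0 !add0r /GRing.scale /=.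
  by rewrite -mulrBl mulrA.
by apply: DeriveDef; [apply/cvg_ex; eexists; exact: key|exact: cvg_lim key].
Qed.

Lemma is_derive_tensor2 f g z : smooth g ->
  is_derive z ((0, 1) : R * R) (tensor f g) (f z.1 * derive1 g z.2).
Proof.
move=> sg; have [dg dgE] := smooth_is_derive z.2 sg.
have key : (fun h : R => h^-1 *: ((tensor f g \o shift z) (h *: ((0, 1) : R * R))
    - tensor f g z)) @ 0^' --> f z.1 * derive1 g z.2.
  rewrite (_ : (fun h : R => _) = (fun h : R =>
      f z.1 * (h^-1 *: ((g \o shift z.2) (h *: 1) - g z.2)))).
    by apply: cvgM; [exact: cvg_cst|rewrite -dgE; exact: dg].
  apply/funext => h; rewrite /tensor /GRing.scale /= !scaler0 !add0r /GRing.scale /=.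
  by rewrite -mulrBr mulrCA.
by apply: DeriveDef; [apply/cvg_ex; eexists; exact: key|exact: cvg_lim key].
Qed.

Lemma partial_t_tensor f g : smooth f ->
  partial_t (tensor f g) = tensor (derive1 f) g.
Proof. by move=> sf; apply/funext => z; case: (is_derive_tensor1 g z sf). Qed.

Lemma partial_x_tensor f g : smooth g ->
  partial_x (tensor f g) = tensor f (derive1 g).
Proof. by move=> sg; apply/funext => z; case: (is_derive_tensor2 f z sg). Qed.

Lemma Ck_tensor k f g : smooth f -> smooth g -> Ck k (tensor f g).
Proof.
have ct f' g' : smooth f' -> smooth g' -> continuous (tensor f' g').
  move=> sf sg z; apply: cvgM.
    by apply: continuous_comp; [exact: cvg_fst|exact: smooth_continuous].
  by apply: continuous_comp; [exact: cvg_snd|exact: smooth_continuous].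
elim: k f g => [|k IH] f g sf sg /=; first exact: ct.
split; first exact: ct.
- by move=> z; split; [case: (is_derive_tensor1 g z sf)|case: (is_derive_tensor2 f z sg)].
- by rewrite partial_t_tensor//; apply: IH => //; exact: smooth_derive1.
- by rewrite partial_x_tensor//; apply: IH => //; exact: smooth_derive1.
Qed.

(** The support lies in a compact rectangle, and [0 < a] keeps this rectangle at positive times. *)
Lemma test_function_tensor f g a b c d : smooth f -> smooth g -> 0 < a ->
  (forall t, f t != 0 -> a <= t <= b) -> (forall x, g x != 0 -> c <= x <= d) ->
  test_function (tensor f g).
Proof.
move=> sf sg a0 fab gcd.
have sub : closure [set z | tensor f g z != 0] `<=` `[a, b] `*` `[c, d].
  have cl : closed (`[a, b] `*` `[c, d] : set (R * R)).
    by apply: compact_closed; [exact: norm_hausdorff|apply: compact_setX; exact: segment_compact].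
  rewrite [X in _ `<=` X](closure_id _).1//; apply: closure_subset => z /=.
  rewrite mulf_eq0 negb_or => /andP[/fab fz /gcd gz].
  by rewrite !in_itv /= fz gz.
split.
- by move=> k; exact: Ck_tensor.
- apply: (subclosed_compact _ _ sub); first exact: closed_closure.
  by apply: compact_setX; exact: segment_compact.
- move=> z /sub[/= + _]; rewrite in_itv /= => /andP[+ _].
  exact: lt_le_trans.
Qed.

End TestFunctions.

(** * Lower bounds of the force *)

Section Convexity.
Variable R : realType.
Implicit Types (f : R -> R) (D : set R) (c k r s L x y z : R).

(** By convexity the quotients [(f (x + (y - x) h) - f x) / h] with [0 < h <= 1] are at most
    [f y - f x]; they tend to the left-hand side as [h] decreases to [0]. *)
Lemma convex_tangent f D x y : convex_function D f -> D x -> D y ->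
  derivable f x 1 -> derive1 f x * (y - x) <= f y - f x.
Proof.
move=> cf Dx Dy dfx; rewrite leNgt; apply/negP => lt.
have dx : is_derive (x + (y - x) * 0) 1 f (derive1 f x).
  by rewrite mulr0 addr0 derive1E; exact/derivableP.
have da : is_derive (0 : R) 1 (fun h : R => x + (y - x) * h) (y - x).
  have h := is_deriveD (is_derive_cst x (0 : R) 1)
    (is_deriveM (is_derive_cst (y - x) (0 : R) 1) (is_derive_id (0 : R) (1 : R))).
  by apply: (is_derive_val h); rewrite scaler0 addr0 add0r /GRing.scale /= mulr1.
have [dg dgE] := is_derive1_comp (g := fun h : R => x + (y - x) * h) dx da.
have /cvg_dnbhs_at_right : (fun h : R => h^-1 *: (f (x + (y - x) * h) - f x)) @ 0^' -->
    derive1 f x * (y - x).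
  rewrite -dgE; apply: cvg_trans dg; apply: near_eq_cvg; near=> h.
  by rewrite /= mulr0 !addr0 /GRing.scale /= mulr1.
move=> /cvgr_gt /(_ _ lt) near_gt.
near (0 : R)^'+ => h.
have h0 : 0 < h by near: h; exact: nbhs_right_gt.
have h1 : h <= 1 by near: h; exact: nbhs_right_le.
have : f y - f x < h^-1 * (f (x + (y - x) * h) - f x) by near: h.
rewrite mulrC ltr_pdivlMr//; apply/negP; rewrite -leNgt.
pose t : {i01 R} := Itv01 (ltW h0) h1.
have := cf t y x (mem_set Dy) (mem_set Dx).
rewrite [leRHS](_ : _ = h * f y + (1 - h) * f x)//.
rewrite [X in f X](_ : _ = h * y + (1 - h) * x)//.
rewrite (_ : h * y + (1 - h) * x = x + (y - x) * h); last by ring.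
lra.
Unshelve. all: by end_near. Qed.

(** Add the tangent inequalities at [x] and at [y]. *)
Lemma convex_derive1_homo f D x y : convex_function D f -> D x -> D y ->
  derivable f x 1 -> derivable f y 1 -> x <= y -> derive1 f x <= derive1 f y.
Proof.
move=> cf Dx Dy dx dy; rewrite le_eqVlt => /predU1P[->//|xy].
have h1 := convex_tangent cf Dx Dy dx.
have h2 := convex_tangent cf Dy Dx dy.
have : (derive1 f y - derive1 f x) * (y - x) >= 0 by lra.
by rewrite pmulr_lge0 ?subr_gt0// subr_ge0.
Qed.

Lemma derive1_addsq f k x : derivable f x 1 ->
  is_derive x 1 (fun z => f z - 2^-1 * k * z ^+ 2) (derive1 f x - k * x).
Proof.
move=> df; have h := is_deriveX 2 (is_derive_id x (1 : R)).
rewrite exprfctE in h.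
have h1 : is_derive x 1 f (derive1 f x) by rewrite derive1E; exact/derivableP.
apply: (is_derive_val (is_deriveB h1 (is_deriveM (is_derive_cst (2^-1 * k) x (1 : R)) h))).
rewrite scaler0 addr0 /GRing.scale /= mulr1 expr1.
by field.
Qed.

(* The tangent inequality for [f - k/2 z^2] is used at the distance [1 + |z|]. *)
Lemma derive1_linear_growth f c k : (forall z, derivable f z 1) ->
  (forall z, `|f z| <= c * (1 + `|z| ^+ 2)) ->
  convex_function (setT : set R) (fun z => f z - 2^-1 * k * `|z| ^+ 2) ->
  exists L, forall z, `|derive1 f z| <= L * (1 + `|z|).
Proof.
move=> df fc; under eq_fun do rewrite real_normK ?num_real//.
pose U : R -> R := fun z => f z - 2^-1 * k * z ^+ 2.
rewrite -/U => cU.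
have dU (z : R) : is_derive z 1 U (derive1 f z - k * z) by exact: derive1_addsq.
have U'E z : derive1 U z = derive1 f z - k * z by rewrite derive1E; case: (dU z).
have UB z : `|U z| <= (c + `|k|) * (1 + z ^+ 2).
  apply: le_trans (ler_normB _ _) _.
  have := fc z; rewrite real_normK ?num_real// 2!normrM (ger0_norm (sqr_ge0 z)).
  rewrite (@ger0_norm _ 2^-1) ?invr_ge0//.
  have := sqr_ge0 z; have := normr_ge0 k; nra.
have c'0 : 0 <= c + `|k|.
  have := le_trans (normr_ge0 _) (UB 0); rewrite expr0n /= addr0 mulr1; lra.
have tangent z y : (derive1 f z - k * z) * (y - z) <=
    (c + `|k|) * (1 + z ^+ 2) + (c + `|k|) * (1 + y ^+ 2).
  have dUz : derivable U z 1 by case: (dU z).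
  have := convex_tangent cU (I : [set: R] z) (I : [set: R] y) dUz; rewrite U'E => t.
  have := UB z; have := UB y; rewrite !ler_norml => /andP[_ h1] /andP[h2 _]; lra.
exists (7 * (c + `|k|) + `|k|) => z.
set h := 1 + `|z|.
have h1 : 1 <= h by rewrite lerDl.
have zh : `|z| <= h by rewrite lerDr.
have sq : `|z| ^+ 2 = z ^+ 2 by rewrite real_normK ?num_real.
have t1 := tangent z (z + h); have t2 := tangent z (z - h).
have a0 := normr_ge0 z.
have B1 : 1 + z ^+ 2 + (1 + (z + h) ^+ 2) <= 7 * h ^+ 2.
  have zh1 : z * h <= `|z| * h by rewrite ler_wpM2r ?ler_norm//; lra.
  have -> : (z + h) ^+ 2 = z ^+ 2 + 2 * (z * h) + h ^+ 2 by ring.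
  by have := sqr_ge0 `|z|; move: zh1; rewrite -sq /h; lra.
have B2 : 1 + z ^+ 2 + (1 + (z - h) ^+ 2) <= 7 * h ^+ 2.
  have nz : - z <= `|z| by rewrite -normrN ler_norm.
  have zh1 : - z * h <= `|z| * h by rewrite ler_wpM2r//; lra.
  have -> : (z - h) ^+ 2 = z ^+ 2 + 2 * (- z * h) + h ^+ 2 by ring.
  by have := sqr_ge0 `|z|; move: zh1; rewrite -sq /h; lra.
have u1 : derive1 f z - k * z <= 7 * (c + `|k|) * h.
  rewrite -(@ler_pM2r _ h); last lra.
  apply: (@le_trans _ _ ((c + `|k|) * (1 + z ^+ 2) + (c + `|k|) * (1 + (z + h) ^+ 2))).
    by apply: le_trans t1; rewrite [z + h]addrC addrK.
  by rewrite -mulrDr -!mulrA -expr2 mulrCA ler_wpM2l.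
have u2 : - (7 * (c + `|k|) * h) <= derive1 f z - k * z.
  rewrite lerNl -(@ler_pM2r _ h); last lra.
  apply: (@le_trans _ _ ((c + `|k|) * (1 + z ^+ 2) + (c + `|k|) * (1 + (z - h) ^+ 2))).
    by apply: le_trans t2; rewrite addrAC subrr add0r mulrN mulNr.
  by rewrite -mulrDr -!mulrA -expr2 mulrCA ler_wpM2l.
have kz : `|k * z| <= `|k| * h by rewrite normrM ler_wpM2l.
move: kz; rewrite !ler_norml => /andP[k1 k2]; lra.
Qed.

Lemma derive1_odd f z : (forall x, derivable f x 1) -> (forall x, f x = f (- x)) ->
  derive1 f (- z) = - derive1 f z.
Proof.
move=> df ev; have dfz : is_derive (- z) 1 f (derive1 f (- z)).
  by rewrite derive1E; exact/derivableP.
have [_] := is_derive1_comp (g := -%R) dfz (is_deriveNid z (1 : R)).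
rewrite (_ : f \o -%R = f); last by apply/funext => x /=; rewrite -ev.
by rewrite -derive1E => ->; rewrite mulrN1 opprK.
Qed.

(** Three ranges around a point [z0 > r]: beyond [z0] convexity makes [f' - k z] nondecreasing; on
    [[0, z0]] everything is bounded; for [z < 0] the crude linear growth is paid by the term in
    [max 0 (- z)]. *)
Lemma derive1_lower f r k s L : 0 < r -> s <= k -> 0 <= L -> (forall z, derivable f z 1) ->
  (forall z, `|derive1 f z| <= L * (1 + `|z|)) ->
  convex_function (`]r, +oo[%classic : set R) (fun z => f z - 2^-1 * k * z ^+ 2) ->
  exists2 D, 0 <= D &
    forall z, s * z - D - (L + `|s|) * Num.max 0 (- z) <= derive1 f z.
Proof.
move=> r0 sk L0 df fL.
pose U : R -> R := fun z => f z - 2^-1 * k * z ^+ 2.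
rewrite -/U => cU.
have dU (z : R) : is_derive z 1 U (derive1 f z - k * z) by exact: derive1_addsq.
have U'E z : derive1 U z = derive1 f z - k * z by rewrite derive1E; case: (dU z).
have [z0 rz0] : exists z0, r < z0 by exists (r + 1); rewrite ltrDl.
have z00 : 0 < z0 by exact: lt_trans rz0.
exists (`|derive1 f z0| + `|k| * z0 + L * (1 + z0) + `|s| * z0) => [|z].
  by rewrite !addr_ge0 ?mulr_ge0 ?addr_ge0// ltW.
have := fL z; rewrite ler_norml => /andP[fz _].
have kz0 : - (`|k| * z0) <= - (k * z0) by rewrite lerN2 ler_wpM2r ?ler_norm ?ltW.
have [z_lt0|z_ge0] := ltP z 0.
  rewrite max_r ?oppr_ge0 ?(ltW z_lt0)//; move: fz; rewrite ltr0_norm// => fz.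
  have : s * z <= `|s| * - z.
    have : 0 <= `|s| + s by have := ler_norm (- s); rewrite normrN; lra.
    nra.
  have := normr_ge0 (derive1 f z0); have : 0 <= `|k| * z0 by rewrite mulr_ge0// ltW.
  have : 0 <= `|s| * z0 by rewrite mulr_ge0// ltW.
  have : 0 <= L * z0 by rewrite mulr_ge0// ltW.
  lra.
rewrite max_l ?oppr_le0// mulr0 subr0; move: fz; rewrite ger0_norm// => fz.
have [zz0|z0z] := leP z z0.
  have : s * z <= `|s| * z0.
    by apply: le_trans (ler_norm _) _; rewrite normrM ler_wpM2l// ger0_norm.
  have := normr_ge0 (derive1 f z0); have : 0 <= `|k| * z0 by rewrite mulr_ge0// ltW.
  have : L * z <= L * z0 by rewrite ler_wpM2l.
  lra.
have : derive1 U z0 <= derive1 U z.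
  apply: (convex_derive1_homo cU).
  - by rewrite /= in_itv /= andbT.
  - by rewrite /= in_itv /= andbT (lt_trans _ z0z).
  - by case: (dU z0).
  - by case: (dU z).
  - exact: ltW.
rewrite !U'E; have := lerNnormlW (lexx `|derive1 f z0|).
have : s * z <= k * z by rewrite ler_wpM2r.
have : 0 <= L * (1 + z0) by rewrite mulr_ge0// addr_ge0// ltW.
have : 0 <= `|s| * z0 by rewrite mulr_ge0// ltW.
lra.
Qed.

End Convexity.

(** * Constants extracted from the confinement condition *)

Section ConfiningForce.
Variables (R : realType) (n : nat).
Implicit Types (W : R -> 'M[R]_n) (m p eta delta a : 'I_n -> R) (C : 'M[R]_n).

(** The extended minimum is below a finite number and never [-oo], so [fine] does not alter it. *)
Lemma minR_le (P : pred 'I_n) (F : 'I_n -> R) i : P i -> minR P F <= F i.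
Proof.
move=> Pi; rewrite /minR.
have le : (\big[Order.min/+oo]_(i < n | P i) (F i)%:E <= (F i)%:E)%E.
  exact: bigmin_le_cond.
have : (\big[Order.min/+oo]_(i < n | P i) (F i)%:E)%E != -oo%E.
  elim/big_ind: _ => // x y xN yN; by rewrite minElt; case: ifP.
by move: le; case: (\big[_/_]_(_ < _ | _) _)%E => [x| |].
Qed.

(** The matrix [C] is bounded below by the rank-one matrix [eta i / m j] plus a nonpositive
    diagonal. Off the diagonal this is the minimum defining [eta_tilde]; on it [delta i] takes up
    the possible deficit of [C i i]. The last conjunct is then the definition of [lambda0_tilde]. *)
Lemma confining_constants m p W : (0 < n)%N ->
  (forall i, 0 < m i) -> (forall i, 0 < p i) -> confining m p W ->
  exists r C eta delta lam, [/\ 0 < r, 0 < lam,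
    forall i j, convex_function (`]r, +oo[%classic : set R)
            (fun z => W z i j - 2^-1 * C i j * z ^+ 2),
    forall i j, eta i / m j + (i == j)%:R * delta i <= C i j &
    (forall i, delta i <= 0) /\
    forall i, lam <= p i * (m i * delta i)
      + 2^-1 * \sum_(j < n) p j * (eta j + eta i * (m i / m j))].
Proof.
move=> n0 m0 p0 [r [r0 _ [C [cC C1 Clam]]]].
(* For [n = 1] the minimum in [eta_tilde] is empty; instead [eta = C m] and [delta = 0], and
   positivity comes from [0 < C i i]. *)
have [n1|n_gt1] := eqVneq n 1%N.
  have all_eq (i j : 'I_n) : i = j.
    by move: i j; rewrite n1 => i j; rewrite !ord1.
  pose i0 := Ordinal n0.
  exists r, C, (fun i => C i i * m i), (fun=> 0), (p i0 * (C i0 i0 * m i0)).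
  split => //; first by rewrite !mulr_gt0 ?C1.
    by move=> i j; rewrite (all_eq i j) mulr0 addr0 mulfK ?gt_eqF.
  split=> // i; rewrite !mulr0 add0r (all_eq i i0).
  rewrite (bigD1 i0)//= big1 => [|j]; last by rewrite (all_eq j i0) eqxx.
  by rewrite addr0 divff ?gt_eqF// mulr1; lra.
have {}n_gt1 : (1 < n)%N by rewrite ltn_neqAle eq_sym n_gt1.
pose eta := eta_tilde m C.
pose delta i := Num.min 0 (m i * C i i - eta i) / m i.
exists r, C, eta, delta, (lambda0_tilde m p C); split => //; first exact: Clam.
- move=> i j; have [<-|ij] := eqVneq i j.
    rewrite mul1r -mulrDl ler_pdivrMr// [C i i * _]mulrC -lerBrDl.
    by rewrite ge_min lexx orbT.
  by rewrite mul0r addr0 ler_pdivrMr//; apply: minR_le; rewrite eq_sym.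
- split=> i; first by rewrite pmulr_lle0 ?invr_gt0// ge_min lexx.
  rewrite /delta (mulrC (m i)) divfK ?gt_eqF//.
  exact: (@minR_le predT).
Qed.

Definition force W i j : R -> R := derive1 (fun z => W z i j).

Lemma force_continuous W i j : admissible W -> continuous (force W i j).
Proof. by case=> _ /(_ i j)[]. Qed.

Lemma force_odd W i j z : admissible W -> force W i j (- z) = - force W i j z.
Proof.
by move=> [_ /(_ i j)[df _] ev _ _]; apply: derive1_odd => // x; rewrite ev.
Qed.

Lemma force_sym W i j : admissible W -> force W i j = force W j i.
Proof.
move=> aW; congr derive1; apply/funext => z.
by rewrite -[in RHS](admissible_sym aW) mxE.
Qed.

Lemma force_linear_growth W : admissible W ->
  exists2 L, 0 <= L & forall i j z, `|force W i j z| <= L * (1 + `|z|).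
Proof.
move=> aW; have [Wbar Wg] := admissible_growth aW.
have [kappa [_ Wc]] := admissible_convex aW.
have /boolp.choice[L hL] : forall ij : 'I_n * 'I_n,
    exists L, forall z, `|force W ij.1 ij.2 z| <= L * (1 + `|z|).
  move=> [i j]; apply: (@derive1_linear_growth _ _ (Wbar i j) (kappa i j)) => //=.
  by have [] := admissible_C1 aW i j.
exists (\sum_ij `|L ij|); first exact: sumr_ge0.
move=> i j z; apply: le_trans (hL (i, j) z) _; rewrite ler_wpM2r ?addr_ge0//.
by rewrite (bigD1 (i, j))//= (le_trans (ler_norm _))// lerDl sumr_ge0.
Qed.

(* [s i j] is the symmetrisation of [eta i / m j + delta i * (i == j)]: by the
   symmetry of [W] both orders of indices give a lower bound of the force. *)
Lemma force_confining m p W : (0 < n)%N ->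
  (forall i, 0 < m i) -> (forall i, 0 < p i) -> admissible W -> confining m p W ->
  exists (s : 'I_n -> 'I_n -> R) eta lam D L, [/\ 0 < lam, 0 <= D, 0 <= L,
    forall i j z, s i j * z - D - L * Num.max 0 (- z) <= force W i j z &
    [/\ forall i j, s i j = s j i,
      forall i, lam <= m i * \sum_(j < n) p j * s i j &
      forall a, \sum_(i < n) \sum_(j < n) s i j * (a i * a j) <=
        (\sum_(j < n) (m j)^-1 * a j) * \sum_(i < n) eta i * a i]].
Proof.
move=> n0 m0 p0 aW cW.
have [r [C [eta [delta [lam [r0 lam0 cC sC [delta0 hlam]]]]]]] :=
  confining_constants n0 m0 p0 cW.
have [L0 L00 hL0] := force_linear_growth aW.
pose c i j := eta i / m j + (i == j)%:R * delta i.
have /boolp.choice[D hD] : forall ij : 'I_n * 'I_n, exists D, 0 <= D /\ forall z,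
    c ij.1 ij.2 * z - D - (L0 + `|c ij.1 ij.2|) * Num.max 0 (- z) <= force W ij.1 ij.2 z.
  move=> [i j] /=; have [dW _] := admissible_C1 aW i j.
  have [D D0 hD] := derive1_lower r0 (sC i j) L00 dW (hL0 i j) (cC i j).
  by exists D.
pose s i j := 2^-1 * (c i j + c j i).
pose Dm := \sum_ij D ij.
pose Lm := L0 + \sum_ij `|c ij.1 ij.2|.
have Dle i j : D (i, j) <= Dm.
  by rewrite /Dm (bigD1 (i, j))//= lerDl sumr_ge0// => ij _; case: (hD ij).
have Lle i j : L0 + `|c i j| <= Lm.
  by rewrite lerD2l (bigD1 (i, j))//= lerDl sumr_ge0.
have lower i j z : c i j * z - Dm - Lm * Num.max 0 (- z) <= force W i j z.
  apply: le_trans (proj2 (hD (i, j)) z) => /=.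
  have := Dle i j; have : (L0 + `|c i j|) * Num.max 0 (- z) <= Lm * Num.max 0 (- z).
    by rewrite ler_wpM2r// le_max lexx.
  lra.
exists s, eta, lam, Dm, Lm; split => //.
- by apply: sumr_ge0 => ij _; case: (hD ij).
- by rewrite addr_ge0// sumr_ge0.
- move=> i j z; have := lower i j z; have := lower j i z.
  by rewrite (force_sym j i aW) /s; lra.
split=> [i j|i|a].
  by rewrite /s addrC.
  (* Both sides agree: multiplied by [m i], the symmetrised row sum is the expression in [hlam]. *)
  apply: le_trans (hlam i) _; rewrite le_eqVlt; apply/orP; left; apply/eqP.
  rewrite [in RHS]mulr_sumr mulr_sumr (bigD1 i)//= [in RHS](bigD1 i)//= addrA.
  congr (_ + _); rewrite /s /c.
    by rewrite eqxx mul1r; field; rewrite gt_eqF.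
  apply: eq_bigr => j ji; rewrite (negbTE ji) eq_sym (negbTE ji) !mul0r !addr0.
  by field; rewrite !gt_eqF.
(* Symmetrising [c] changes nothing against the symmetric matrix [a i * a j]. *)
have -> : \sum_(i < n) \sum_(j < n) s i j * (a i * a j) =
    \sum_(i < n) \sum_(j < n) c i j * (a i * a j).
  under eq_bigr do under eq_bigr do rewrite /s -mulrA mulrDl mulrDr.
  under eq_bigr do rewrite big_split /=.
  rewrite big_split /= [X in _ + X]exchange_big /= -big_split /=.
  apply: eq_bigr => i _; rewrite -big_split /=; apply: eq_bigr => j _.
  by field.
(* The rank-one part of [c] yields the product on the right exactly; what remains is
   [delta i * a i ^+ 2], which is nonpositive. *)
rewrite mulrC mulr_suml; apply: ler_sum => i _; rewrite mulr_sumr.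
rewrite -subr_ge0 -sumrB (bigD1 i)//= big1 => [|j ji]; last first.
  by rewrite /c eq_sym (negbTE ji) mul0r addr0; ring.
rewrite /c eqxx mul1r addr0.
have -> : eta i * a i * ((m i)^-1 * a i) - (eta i / m i + delta i) * (a i * a i)
  = - delta i * a i ^+ 2 by ring.
by rewrite mulr_ge0 ?sqr_ge0// oppr_ge0.
Qed.

End ConfiningForce.

(** * Integrals of quadratically growing functions *)

Section RintegralTheory.
Context d (T : measurableType d) (R : realType).
Variables (mu : {measure set T -> \bar R}) (D : set T).
Hypothesis mD : measurable D.
Implicit Types (f g : T -> R).

Lemma RintegrableD f g : mu.-integrable D (EFin \o f) ->
  mu.-integrable D (EFin \o g) -> mu.-integrable D (EFin \o (fun x => f x + g x)).
Proof. by move=> h1 h2; have := integrableD mD h1 h2. Qed.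

Lemma RintegrableZ c f : mu.-integrable D (EFin \o f) ->
  mu.-integrable D (EFin \o (fun x => c * f x)).
Proof. by move=> h1; have := integrableZl mD c h1. Qed.

Lemma RintegrableB f g : mu.-integrable D (EFin \o f) ->
  mu.-integrable D (EFin \o g) -> mu.-integrable D (EFin \o (fun x => f x - g x)).
Proof. by move=> h1 h2; have := integrableB mD h1 h2. Qed.

Lemma Rintegrable_sum (I : Type) (s : seq I) (f : I -> T -> R) :
  (forall i, mu.-integrable D (EFin \o f i)) ->
  mu.-integrable D (EFin \o (fun x => \sum_(i <- s) f i x)).
Proof.
move=> fi; elim: s => [|i s IH].
  rewrite [X in _.-integrable _ X](_ : _ = cst 0%E); first exact: integrable0.
  by apply/funext => x /=; rewrite big_nil.
rewrite (_ : (fun x => _) = (fun x => f i x + \sum_(j <- s) f j x)).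
  exact: RintegrableD.
by apply/funext => x; rewrite big_cons.
Qed.

Lemma Rintegral_sum (I : Type) (s : seq I) (f : I -> T -> R) :
  (forall i, mu.-integrable D (EFin \o f i)) ->
  \int[mu]_(x in D) (\sum_(i <- s) f i x) = \sum_(i <- s) \int[mu]_(x in D) f i x.
Proof.
move=> fi; elim: s => [|i s IH].
  rewrite big_nil (_ : (fun x => _) = fun=> 0); last first.
    by apply/funext => x; rewrite big_nil.
  by rewrite Rintegral_cst// mul0r.
rewrite big_cons -IH -RintegralD//; last exact: Rintegrable_sum.
by apply: eq_Rintegral => x _; rewrite big_cons.
Qed.

Lemma Rle_integrable f g : measurable_fun D f ->
  mu.-integrable D (EFin \o g) -> (forall x, D x -> `|f x| <= g x) ->
  mu.-integrable D (EFin \o f).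
Proof.
move=> mf ig fg; apply: le_integrable ig => //; first exact/measurable_EFinP.
by move=> x Dx /=; rewrite lee_fin (le_trans (fg x Dx))// ler_norm.
Qed.

Lemma Rdominated_cvg (f_ : nat -> T -> R) f g :
  (forall n, measurable_fun D (f_ n)) -> (forall x, D x -> f_ ^~ x @ \oo --> f x) ->
  mu.-integrable D (EFin \o g) -> (forall n x, D x -> `|f_ n x| <= g x) ->
  (fun n => \int[mu]_(x in D) f_ n x) @ \oo --> \int[mu]_(x in D) f x.
Proof.
move=> mf_ f_f ig fg.
have cE x : D x -> (fun n => (f_ n x)%:E) @ \oo --> (f x)%:E.
  by move=> Dx; apply: cvg_EFin; [exact: nearW|exact: f_f].
have mf : measurable_fun D (EFin \o f).
  by apply: (emeasurable_fun_cvg (fun n => EFin \o f_ n)) => // n; exact/measurable_EFinP.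
have [intf _ cv] := @dominated_convergence _ _ _ mu D mD
  (fun n => EFin \o f_ n) (EFin \o f) (EFin \o g)
  (fun n => proj2 (measurable_EFinP _ _) (mf_ n)) mf (aeW mu (fun x => @cE x)) ig
  (aeW mu (fun x n Dx => fg n x Dx)).
apply: fine_cvg; rewrite fineK//; exact: integrable_fin_num.
Qed.

End RintegralTheory.

(** * Measurable dependence of integrals on a parameter *)

Section KernelMeasurability.
Context d1 d2 (X : measurableType d1) (Y : measurableType d2) (R : realType).
Variables (l : X -> {measure set Y -> \bar R}) (c : R).
Hypothesis ml : forall U, measurable U -> measurable_fun setT (fun x => l x U).
Hypothesis lc : forall x, (l x setT < c%:E)%E.

Let k : X -> {measure set Y -> \bar R} := l.

HB.instance Definition _ := @isKernel.Build _ _ X Y R k ml.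

Let k_uub : measure_fam_uub k. Proof. by exists c. Qed.

HB.instance Definition _ := @Kernel_isFinite.Build _ _ X Y R k k_uub.

(** The family is a finite kernel, for which integrals of nonnegative functions depend measurably on
    the parameter; [f] is split into its positive and negative parts. *)
Lemma measurable_Rintegral (f : X * Y -> R) : measurable_fun setT f ->
  measurable_fun setT (fun x => \int[l x]_y f (x, y)).
Proof.
move=> mf; apply: (@measurableT_comp _ _ _ _ _ _ fine) => //.
under eq_fun do rewrite integralE.
have mE : measurable_fun setT (EFin \o f) by exact/measurable_EFinP.
apply: emeasurable_funB.
  have := measurable_fun_integral_finite_kernel ((EFin \o f)^\+)%E k
    (@funepos_ge0 _ _ _) (measurable_funepos mE).
  congr measurable_fun; apply/funext => x; apply: eq_integral => y _.
  by rewrite !funeposE.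
have := measurable_fun_integral_finite_kernel ((EFin \o f)^\-)%E k
  (@funeneg_ge0 _ _ _) (measurable_funeneg mE).
congr measurable_fun; apply/funext => x; apply: eq_integral => y _.
by rewrite !funenegE.
Qed.

End KernelMeasurability.

(** * Integrands of quadratic growth *)

Section Quadratic.
Variable R : realType.
Local Notation fmeas := {finite_measure set R -> \bar R}.
Implicit Types (mu nu : fmeas) (f g : R -> R) (c x y : R).

Definition finite_moment2 mu := (\int[mu]_x (x ^+ 2)%:E < +oo)%E.

Lemma measurable_sqr : measurable_fun setT (fun x : R => x ^+ 2).
Proof. by apply: measurable_funX. Qed.

Lemma integrable_sqr mu : finite_moment2 mu ->
  mu.-integrable setT (EFin \o (fun x => x ^+ 2)).
Proof.
move=> h; apply/integrableP; split.
  by apply/measurable_EFinP; exact: measurable_sqr.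
by under eq_integral do rewrite /= ger0_norm ?sqr_ge0//.
Qed.

Lemma Rintegrable_cst mu c : mu.-integrable setT (EFin \o (fun=> c)).
Proof. exact: finite_measure_integrable_cst. Qed.

Lemma integrable_quad mu f c : finite_moment2 mu -> measurable_fun setT f ->
  (forall x, `|f x| <= c * (1 + x ^+ 2)) -> mu.-integrable setT (EFin \o f).
Proof.
move=> h mf fc; apply: (Rle_integrable _ mf _ (fun x _ => fc x)) => //.
apply: RintegrableZ => //; apply: RintegrableD => //; first exact: Rintegrable_cst.
exact: integrable_sqr.
Qed.

Lemma le_sqr1 x : `|x| <= 1 + x ^+ 2.
Proof.
have := sqr_ge0 (`|x| - 1); have : `|x| ^+ 2 = x ^+ 2 by rewrite real_normK ?num_real.
by have := normr_ge0 x; nra.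
Qed.

Lemma sqr1_ge1 x : 1 <= 1 + x ^+ 2.
Proof. by rewrite lerDl sqr_ge0. Qed.

(** This product weight is integrable for any two measures with finite second moments, and it
    dominates both [psi'(x) W_ij'(x - y)] for linearly growing factors and quadratic polynomials in
    [(x, y)]. *)
Definition bigO2 (F : R * R -> R) c :=
  forall x y, `|F (x, y)| <= c * ((1 + x ^+ 2) * (1 + y ^+ 2)).

Lemma integrable_slice nu (F : R * R -> R) c x : finite_moment2 nu ->
  measurable_fun setT F -> bigO2 F c ->
  nu.-integrable setT (EFin \o (fun y => F (x, y))).
Proof.
move=> h mF Fc; apply: (@integrable_quad _ _ (c * (1 + x ^+ 2))) => //.
  by apply: measurableT_comp => //; exact: measurable_pair1.
by move=> y; rewrite -mulrA.
Qed.

Lemma Rintegral_slice_le nu (F : R * R -> R) c x : finite_moment2 nu ->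
  measurable_fun setT F -> bigO2 F c ->
  `|\int[nu]_y F (x, y)| <= c * \int[nu]_y (1 + y ^+ 2) * (1 + x ^+ 2).
Proof.
move=> h mF Fc.
apply: (le_trans (le_normr_Rintegral _ _)) => //; first exact: integrable_slice.
have iS : nu.-integrable setT (EFin \o (fun y => 1 + y ^+ 2)).
  by apply: RintegrableD => //; [exact: Rintegrable_cst|exact: integrable_sqr].
rewrite mulrAC -RintegralZl//; apply: le_Rintegral => //.
- by apply: integrable_norm; exact: integrable_slice.
- exact: RintegrableZ.
- by move=> y _; rewrite -mulrA; exact: Fc.
Qed.

Lemma measurable_slice nu (F : R * R -> R) : measurable_fun setT F ->
  measurable_fun setT (fun x => \int[nu]_y F (x, y)).
Proof.
move=> mF; apply: (@measurable_Rintegral _ _ _ _ _ (fun=> nu) (fine (nu setT) + 1)) => //.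
move=> _; rewrite EFinD fineK ?lteDl ?lte01// fin_num_measure//.
Qed.

Lemma integrable_int_slice mu nu (F : R * R -> R) c :
  finite_moment2 mu -> finite_moment2 nu -> measurable_fun setT F -> bigO2 F c ->
  mu.-integrable setT (EFin \o (fun x => \int[nu]_y F (x, y))).
Proof.
move=> hm hn mF Fc.
apply: (@integrable_quad _ _ (c * \int[nu]_y (1 + y ^+ 2))) => //.
  exact: measurable_slice.
by move=> x; exact: Rintegral_slice_le.
Qed.

(** Integrability for the product measure is read off the iterated integral of the absolute value,
    whose slices again have quadratic growth. *)
Lemma Rfubini mu nu (F : R * R -> R) c :
  finite_moment2 mu -> finite_moment2 nu -> measurable_fun setT F -> bigO2 F c ->
  \int[mu]_x \int[nu]_y F (x, y) = \int[nu]_y \int[mu]_x F (x, y).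
Proof.
move=> hm hn mF Fc.
pose F' z := F (z.2, z.1).
have mF' : measurable_fun setT F' by apply: measurableT_comp => //; exact: measurable_swap.
have Fc' : bigO2 F' c by move=> x y; rewrite [X in c * X]mulrC; exact: Fc.
have mE : measurable_fun setT (EFin \o F) by exact/measurable_EFinP.
have E1 x : (\int[nu]_y (F (x, y))%:E = (\int[nu]_y F (x, y))%:E)%E.
  by rewrite /Rintegral fineK//; apply: integrable_fin_num => //; exact: (integrable_slice x hn mF Fc).
have E2 y : (\int[mu]_x (F (x, y))%:E = (\int[mu]_x F (x, y))%:E)%E.
  by rewrite /Rintegral fineK//; apply: integrable_fin_num => //; exact: (integrable_slice y hm mF' Fc').
have /Fubini : (mu \x nu)%E.-integrable setT (EFin \o F).
  apply/integrable12ltyP => //=.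
  have nF : measurable_fun setT (fun z => `|F z|) by apply: measurableT_comp.
  have nFc : bigO2 (fun z => `|F z|) c by move=> x y; rewrite normr_id; exact: Fc.
  have E3 x : (\int[nu]_y `|(F (x, y))%:E| = (\int[nu]_y `|F (x, y)|)%:E)%E.
    rewrite /Rintegral fineK//; apply: integrable_fin_num => //.
    exact: (integrable_slice x hn nF nFc).
  under eq_integral do rewrite E3.
  by apply: integrable_lty => //; exact: (integrable_int_slice hm hn nF nFc).
rewrite /=; under eq_integral do rewrite E1; under [X in _ = X -> _]eq_integral do rewrite E2.
by rewrite /Rintegral => ->.
Qed.

End Quadratic.

(** * Couplings and continuity in time *)

Section ProductCoupling.
Variables (R : realType) (mu nu : {finite_measure set R -> \bar R}) (p : R).
Hypotheses (p0 : 0 < p) (mup : mu setT = p%:E) (nup : nu setT = p%:E).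

Let pV0 : 0 <= p^-1. Proof. by rewrite invr_ge0 ltW. Qed.

(** Dividing by the common mass [p] gives the product the marginals [mu] and [nu]. This coupling
    shows that the transport cost is finite. *)
Definition normalized_product : set (R * R) -> \bar R :=
  mscale (NngNum pV0) (mu \x nu)%E.

Let normalized_productX A B : measurable A -> measurable B ->
  normalized_product (A `*` B) = (p^-1%:E * (mu A * nu B))%E.
Proof.
move=> mA mB.
rewrite -[LHS]/(p^-1%:E * (mu \x nu) (A `*` B))%E.
by rewrite product_measure1E.
Qed.

HB.instance Definition _ := Measure.on normalized_product.

Let normalized_product_fin : fin_num_fun normalized_product.
Proof.
apply: lty_fin_num_fun.
apply: (@le_lt_trans _ _ (p^-1%:E * (p%:E * p%:E))%E); last by rewrite -!EFinM ltry.
rewrite le_eqVlt; apply/orP; left; apply/eqP.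
have := normalized_productX measurableT measurableT.
by rewrite setXTT mup nup.
Qed.

HB.instance Definition _ :=
  @Measure_isFinite.Build _ _ R normalized_product normalized_product_fin.

Lemma coupling_normalized_product : coupling mu nu normalized_product.
Proof.
move=> A mA.
have E1 : fst @^-1` A = A `*` (setT : set R) by apply/seteqP; split => z //= [].
have E2 : snd @^-1` A = (setT : set R) `*` A by apply/seteqP; split => z //= [].
rewrite /pushforward; split.
  rewrite E1; apply: (etrans (normalized_productX mA measurableT)).
  by rewrite nup muleCA -EFinM mulVf ?mule1// gt_eqF.
rewrite E2; apply: (etrans (normalized_productX measurableT mA)).
by rewrite mup muleA -EFinM mulVf ?mul1e// gt_eqF.
Qed.

End ProductCoupling.

Section Coupling.
Variable R : realType.
Local Notation fmeas := {finite_measure set R -> \bar R}.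
Implicit Types (mu nu : fmeas) (g : {finite_measure set (R * R)%type -> \bar R}) (f : R -> R).

Lemma coupling_ge0_integral mu nu g (f : R -> \bar R) : coupling mu nu g ->
  measurable_fun setT f -> (forall x, (0 <= f x)%E) ->
  (\int[g]_z f z.1 = \int[mu]_x f x)%E /\ (\int[g]_z f z.2 = \int[nu]_x f x)%E.
Proof.
move=> cg mf f0; split.
  rewrite (eq_measure_integral (pushforward g (@fst R R))) => [|A mA _]; last first.
    by case: (cg A mA).
  by rewrite ge0_integral_pushforward.
rewrite (eq_measure_integral (pushforward g (@snd R R))) => [|A mA _]; last first.
  by case: (cg A mA).
by rewrite ge0_integral_pushforward.
Qed.

Lemma coupling_integrable mu nu g f : coupling mu nu g ->
  mu.-integrable setT (EFin \o f) -> nu.-integrable setT (EFin \o f) ->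
  g.-integrable setT (EFin \o (fun z : R * R => f z.1)) /\
  g.-integrable setT (EFin \o (fun z : R * R => f z.2)).
Proof.
move=> cg /integrableP[mf i1] /integrableP[_ i2].
have mnf : measurable_fun setT (fun x => `|(EFin \o f) x|)%E by exact: measurableT_comp.
have [E1 E2] := coupling_ge0_integral cg mnf (fun=> abse_ge0 _).
by split; apply/integrableP; split; rewrite ?E1 ?E2//;
  apply: (measurableT_comp mf); [exact: measurable_fst|exact: measurable_snd].
Qed.

Lemma coupling_Rintegral mu nu g f : coupling mu nu g ->
  mu.-integrable setT (EFin \o f) -> nu.-integrable setT (EFin \o f) ->
  \int[g]_z f z.1 = \int[mu]_x f x /\ \int[g]_z f z.2 = \int[nu]_x (f x : R).
Proof.
move=> cg i1 i2; have [h1 h2] := coupling_integrable cg i1 i2.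
have mf := measurable_int _ i1.
rewrite /Rintegral; split; congr fine; apply/esym.
  rewrite (eq_measure_integral (pushforward g (@fst R R))) => [|A mA _]; last first.
    by case: (cg A mA).
  by rewrite integral_pushforward.
rewrite (eq_measure_integral (pushforward g (@snd R R))) => [|A mA _]; last first.
  by case: (cg A mA).
by rewrite integral_pushforward.
Qed.

Let measurable_cost : measurable_fun setT (fun z : R * R => `|z.1 - z.2| ^+ 2).
Proof.
apply: measurable_funX; apply: measurableT_comp => //.
by apply: measurable_funB; [exact: measurable_fst|exact: measurable_snd].
Qed.

Lemma cost_integrable mu nu g : coupling mu nu g ->
  finite_moment2 mu -> finite_moment2 nu ->
  g.-integrable setT (EFin \o (fun z : R * R => `|z.1 - z.2| ^+ 2)).
Proof.
move=> cg h1 h2.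
have msq : measurable_fun setT (fun x : R => (x ^+ 2)%:E).
  by apply/measurable_EFinP; exact: measurable_sqr.
have [E1 E2] := coupling_ge0_integral cg msq
  (fun x => (sqr_ge0 x : (0 <= (x ^+ 2)%:E)%E)).
have i1 : g.-integrable setT (EFin \o (fun z : R * R => z.1 ^+ 2)).
  apply/integrableP; split.
    by apply/measurable_EFinP; apply: measurable_funX; exact: measurable_fst.
  by under eq_integral do rewrite /= ger0_norm ?sqr_ge0//; rewrite E1.
have i2 : g.-integrable setT (EFin \o (fun z : R * R => z.2 ^+ 2)).
  apply/integrableP; split.
    by apply/measurable_EFinP; apply: measurable_funX; exact: measurable_snd.
  by under eq_integral do rewrite /= ger0_norm ?sqr_ge0//; rewrite E2.
apply: (Rle_integrable measurableT measurable_cost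
  (RintegrableD measurableT (RintegrableZ measurableT 2 i1) (RintegrableZ measurableT 2 i2))).
move=> [x y] _ /=; rewrite ger0_norm ?sqr_ge0// real_normK ?num_real//.
have := sqr_ge0 (x + y); nra.
Qed.

(* AM-GM: [2 |x - y| <= e + |x - y|^2 / e]. *)
Lemma coupling_lipschitz mu nu g f p K Lam e : coupling mu nu g ->
  mu setT = p%:E -> finite_moment2 mu -> finite_moment2 nu ->
  mu.-integrable setT (EFin \o f) -> nu.-integrable setT (EFin \o f) ->
  (forall x y, `|f x - f y| <= Lam * `|x - y|) -> 0 <= Lam -> 0 < e ->
  \int[g]_z (`|z.1 - z.2| ^+ 2) <= K ->
  `|\int[mu]_x f x - \int[nu]_x f x| <= Lam * 2^-1 * (e * p + K / e).
Proof.
move=> cg mup h1 h2 i1 i2 lip Lam0 e0 gK.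
have [j1 j2] := coupling_integrable cg i1 i2.
have [<- <-] := coupling_Rintegral cg i1 i2.
rewrite -RintegralB//.
have ic := cost_integrable cg h1 h2.
apply: (le_trans (le_normr_Rintegral _ _)) => //; first exact: RintegrableB.
have ib : g.-integrable setT (EFin \o (fun z : R * R => Lam * 2^-1 * e + (Lam * 2^-1 / e) * `|z.1 - z.2| ^+ 2)).
  by apply: RintegrableD => //; [exact: finite_measure_integrable_cst|exact: RintegrableZ].
apply: (@le_trans _ _ (\int[g]_z (Lam * 2^-1 * e + (Lam * 2^-1 / e) * `|z.1 - z.2| ^+ 2))).
  apply: le_Rintegral => //; first by apply: integrable_norm; exact: RintegrableB.
  move=> [x y] _ /=; apply: le_trans (lip x y) _.
  rewrite [leRHS](_ : _ = Lam * (2^-1 * (e + `|x - y| ^+ 2 / e))); last by field; rewrite gt_eqF.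
  rewrite ler_wpM2l//.
  have -> : 2^-1 * (e + `|x - y| ^+ 2 / e) = (e ^+ 2 + `|x - y| ^+ 2) / (2 * e) by field; rewrite gt_eqF.
  rewrite ler_pdivlMr ?mulr_gt0//; have := sqr_ge0 (`|x - y| - e); nra.
rewrite RintegralD//; last 2 first.
- exact: finite_measure_integrable_cst.
- exact: RintegrableZ.
rewrite (Rintegral_cst _ measurableT) RintegralZl//.
have -> : fine (g setT) = p.
  by have [+ _] := cg setT measurableT; rewrite /pushforward preimage_setT mup => ->.
rewrite mulrDr !mulrA lerD2l -[leRHS]mulrA [K / e]mulrC [leRHS]mulrA ler_wpM2l//.
by rewrite mulr_ge0 ?mulr_ge0 ?invr_ge0// ltW.
Qed.

Lemma coupling_moment2 mu nu g K : coupling mu nu g ->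
  finite_moment2 mu -> finite_moment2 nu ->
  \int[g]_z (`|z.1 - z.2| ^+ 2) <= K ->
  \int[nu]_x (x ^+ 2) <= 2 * \int[mu]_x (x ^+ 2) + 2 * K.
Proof.
move=> cg h1 h2 gK.
have i1 := integrable_sqr h1; have i2 := integrable_sqr h2.
have [j1 j2] := coupling_integrable cg i1 i2.
have [<- <-] := coupling_Rintegral cg i1 i2.
have ic := cost_integrable cg h1 h2.
apply: (@le_trans _ _ (\int[g]_z (2 * z.1 ^+ 2 + 2 * `|z.1 - z.2| ^+ 2))).
  apply: le_Rintegral => //; first by apply: RintegrableD => //; exact: RintegrableZ.
  move=> [x y] _ /=; rewrite real_normK ?num_real//; have := sqr_ge0 (2 * x - y); lra.
rewrite RintegralD//; [|exact: RintegrableZ|exact: RintegrableZ].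
by rewrite !RintegralZl// lerD2l ler_wpM2l.
Qed.

Lemma transport_cost_fin_num mu nu p : 0 < p -> mu setT = p%:E -> nu setT = p%:E ->
  finite_moment2 mu -> finite_moment2 nu ->
  (transport_cost mu nu \is a fin_num) /\ (0 <= transport_cost mu nu)%E.
Proof.
move=> p0 mup nup h1 h2.
have tc0 : (0 <= transport_cost mu nu)%E.
  apply/ereal_infP => _ [g _ <-]; apply: integral_ge0 => z _.
  by rewrite lee_fin sqr_ge0.
split => //; rewrite ge0_fin_numE//.
have cg := coupling_normalized_product p0 mup nup.
apply: (@le_lt_trans _ _ (\int[normalized_product mu nu p0]_z (`|z.1 - z.2| ^+ 2)%:E)%E).
  by apply: ereal_inf_lbound; eexists; first exact: cg.
by apply: integrable_lty => //; exact: (cost_integrable cg h1 h2).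
Qed.

(** The strict inequality stands in for the existence of an optimal coupling. *)
Lemma coupling_near_cost mu nu p K : 0 < p -> mu setT = p%:E -> nu setT = p%:E ->
  finite_moment2 mu -> finite_moment2 nu -> fine (transport_cost mu nu) < K ->
  exists2 g, coupling mu nu g & \int[g]_z (`|z.1 - z.2| ^+ 2) <= K.
Proof.
move=> p0 mup nup h1 h2 tK.
have [tf t0] := transport_cost_fin_num p0 mup nup h1 h2.
have : (transport_cost mu nu < K%:E)%E by rewrite -(fineK tf) lte_fin.
move=> /ereal_inf_lt[_ [g cg <-]] gK; exists g => //.
rewrite -lee_fin /Rintegral fineK ?ltW//.
by apply: integrable_fin_num => //; exact: (cost_integrable cg h1 h2).
Qed.

End Coupling.

(** * Lipschitz test functions *)

Definition lipschitz_fun (R : realType) (Lam : R) (f : R -> R) :=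
  forall x y, `|f x - f y| <= Lam * `|x - y|.

Section LipschitzTests.
Variable R : realType.
Implicit Types (f : R -> R) (Lam a x y : R) (mu : {finite_measure set R -> \bar R}).

Lemma lipschitz_continuous Lam f : 0 <= Lam -> lipschitz_fun Lam f -> continuous f.
Proof.
move=> Lam0 lf x; apply/cvgrPdist_lt => e e0.
have L0 : 0 < Lam + 1 by rewrite ltr_wpDl.
near=> y; apply: le_lt_trans (lf x y) _.
apply: (@le_lt_trans _ _ ((Lam + 1) * `|x - y|)).
  by rewrite ler_wpM2r// lerDl.
rewrite mulrC -ltr_pdivlMr//; near: y.
by apply: cvgr_dist_lt; [exact: cvg_id|exact: divr_gt0].
Unshelve. all: by end_near. Qed.

Lemma lipschitz_measurable Lam f : 0 <= Lam -> lipschitz_fun Lam f ->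
  measurable_fun setT f.
Proof.
move=> L0 lf; apply: continuous_measurable_fun.
exact: lipschitz_continuous L0 lf.
Qed.

Lemma lipschitz_integrable Lam f mu : finite_moment2 mu -> 0 <= Lam ->
  lipschitz_fun Lam f -> mu.-integrable setT (EFin \o f).
Proof.
move=> hm L0 lf; apply: (@integrable_quad _ _ _ (`|f 0| + Lam)) => //.
  exact: lipschitz_measurable lf.
move=> x; have := lf x 0; rewrite subr0 => h.
have := ler_distD (f 0) (f x) 0; rewrite !subr0 => h1.
have := sqr1_ge1 x; have := le_sqr1 x; have := normr_ge0 (f 0).
set u := 1 + _ => a0 a1 a2; rewrite mulrDl.
have : Lam * `|x| <= Lam * u by rewrite ler_wpM2l.
have : `|f 0| <= `|f 0| * u by rewrite ler_peMr.
lra.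
Qed.

Lemma normr_max0B x y : `|Num.max 0 x - Num.max 0 y| <= `|x - y|.
Proof.
have := ler_norm (x - y); have := ler_norm (y - x); rewrite distrC => h1 h2.
by rewrite ler_norml; apply/andP; split; case: (leP 0 x) => ?; case: (leP 0 y) => ?; lra.
Qed.

Definition cutoff a (k : nat) x : R := Num.min 1 (k%:R * Num.max 0 (x - a)).

Lemma cutoff_lipschitz a k : lipschitz_fun k%:R (cutoff a k).
Proof.
move=> x y; rewrite /cutoff.
have k0 : 0 <= k%:R :> R by [].
set u := Num.max 0 (x - a); set v := Num.max 0 (y - a).
have uv : `|u - v| <= `|x - y|.
  by apply: le_trans (normr_max0B _ _) _; rewrite opprB addrA subrK.
have : `|k%:R * u - k%:R * v| <= k%:R * `|x - y|.
  by rewrite -mulrBr normrM ger0_norm// ler_wpM2l.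
set s := k%:R * u; set t := k%:R * v.
rewrite !ler_norml => /andP[h1 h2].
by apply/andP; split; case: (leP 1 s) => ?; case: (leP 1 t) => ?; lra.
Qed.

Lemma cutoff_bound a k x : 0 <= cutoff a k x <= 1.
Proof.
rewrite /cutoff; apply/andP; split; last by rewrite ge_min lexx.
by rewrite le_min ler01/= mulr_ge0// le_max lexx.
Qed.

Lemma cutoff_cvg a x : cutoff a ^~ x @ \oo --> (\1_`]a, +oo[ x : R).
Proof.
rewrite indicE; have [ax|xa] := ltP a x; last first.
  rewrite memNset /=; last by rewrite in_itv /= andbT ltNge xa.
  apply: cvg_near_cst; apply: nearW => k; apply/eqP.
  by rewrite /cutoff max_l ?subr_le0// mulr0 min_r.
rewrite mem_set /=; last by rewrite in_itv /= andbT.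
apply: cvg_near_cst; near=> k; rewrite /cutoff max_r ?subr_ge0 ?(ltW ax)//.
apply/eqP; rewrite min_l// -ler_pdivrMr ?subr_gt0// mul1r.
near: k; exact: nbhs_infty_ger.
Unshelve. all: by end_near. Qed.

(** The half-lines []a, +oo[] form a pi-system generating the Borel sets, and their masses are
    limits of the Lipschitz integrals of [cutoff]. The sets whose mass is measurable in [t] form a
    Dynkin system; complements are covered because the total mass is constant. *)
Lemma measurable_family d (X : measurableType d)
    (nu : X -> {finite_measure set R -> \bar R}) (p : R) :
  (forall t, nu t setT = p%:E) ->
  (forall f Lam, 0 <= Lam -> lipschitz_fun Lam f -> (forall x, 0 <= f x <= 1) ->
    measurable_fun setT (fun t => \int[nu t]_x f x)) ->
  forall A, measurable A -> measurable_fun setT (fun t => nu t A).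
Proof.
move=> nup mlip A; move: A.
suff h : forall A : set R, (@RGenOInfty.G R).-sigma.-measurable A ->
    measurable_fun setT (fun t => nu t A).
  by move=> A mA; apply: h; rewrite -RGenOInfty.measurableE.
apply: (@dynkin_induction _ (measurableTypeR R) (@RGenOInfty.G R)
  (fun A : set R => measurable_fun setT (fun t => nu t A))).
- by rewrite -[RHS]RGenOInfty.measurableE.
- move=> _ _ [x ->] [y ->]; exists (Num.max x y).
  by apply/seteqP; split => z /=; rewrite !in_itv /= !andbT gt_max => /andP.
- rewrite (_ : (fun t => nu t setT) = cst p%:E); first exact: measurable_cst.
  by apply/funext => t; rewrite nup.
- move=> _ [a ->].
  apply: (@emeasurable_fun_cvg _ _ _ _ (fun k t => (\int[nu t]_x cutoff a k x)%:E)).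
    by move=> k; apply/measurable_EFinP; apply: (mlip _ k%:R) => // [|x];
      [exact: cutoff_lipschitz|exact: cutoff_bound].
  move=> t _.
  have -> : nu t `]a, +oo[%classic = (\int[nu t]_x (\1_`]a, +oo[ x : R))%:E.
    rewrite /Rintegral integral_indic// setIT fineK//.
    exact: fin_num_measure.
  apply: cvg_EFin; first exact: nearW.
  apply: (@Rdominated_cvg _ _ _ _ _ _ _ _ (fun=> 1)) => //.
  + by move=> k; apply: lipschitz_measurable (@cutoff_lipschitz a k).
  + by move=> x _; exact: cutoff_cvg.
  + exact: Rintegrable_cst.
  + by move=> k x _; have /andP[? ?] := cutoff_bound a k x; rewrite ger0_norm.
- move=> S mS mnu.
  rewrite (_ : (fun t => _) = (fun t => p%:E - nu t S)%E).
    by apply: emeasurable_funB => //; exact: measurable_cst.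
  apply/funext => t; rewrite -(nup t) -setTD measureD//.
    by rewrite setTI.
  by rewrite -ge0_fin_numE// fin_num_measure.
- move=> F mF tF mnu.
  rewrite (_ : (fun t => _) = (fun t => \sum_(k <oo) nu t (F k))%E).
    exact: ge0_emeasurable_sum.
  apply/funext => t; apply: measure_semi_bigcup => //.
  exact: bigcupT_measurable.
Qed.

End LipschitzTests.

Section LebesgueIntervals.
Variable R : realType.
Implicit Types (s t c : R).

Lemma Rintegral_itv_cst s t c : s <= t ->
  \int[lebesgue_measure]_(r in `[s, t]) c = c * (t - s).
Proof.
move=> st.
have -> : \int[lebesgue_measure]_(r in `[s, t]) c =
    c * fine (lebesgue_measure (`[s, t]%classic : set R)).
  by apply: Rintegral_cst; exact: measurable_itv.
rewrite lebesgue_measure_itv /= lte_fin.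
by move: st; rewrite le_eqVlt => /predU1P[->|->]; rewrite ?ltxx ?subrr.
Qed.

Lemma integrable_itv_cst s t c :
  (@lebesgue_measure R).-integrable `[s, t] (EFin \o (fun=> c)).
Proof.
apply: continuous_compact_integrable; first exact: segment_compact.
by apply: continuous_subspaceT => x; exact: cst_continuous.
Qed.

End LebesgueIntervals.

(** * Regularity in time of an AC^2 curve *)

Section AC2.
Variables (R : realType) (n : nat) (m p : 'I_n -> R) (E : R).
Variable mu : R -> 'I_n -> {finite_measure set R -> \bar R}.
Hypotheses (m0 : forall i, 0 < m i) (p0 : forall i, 0 < p i).
Hypothesis acmu : AC2loc m p E mu.

Let mass t i : 0 <= t -> mu t i setT = (p i)%:E.
Proof. by move=> t0; have [/(_ _ t0)[]] := acmu. Qed.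

Let moment t i : 0 <= t -> finite_moment2 (mu t i).
Proof. by move=> t0; have [/(_ _ t0)[_ h _ _]] := acmu; exact: h. Qed.

(* AM-GM: [phi <= e phi^2 + 1 / (4 e)]. *)
Lemma distP_modulus T : 0 < T -> exists2 A, 0 <= A & forall s t e,
  0 <= s -> s <= t -> t <= T -> 0 < e ->
  distP m (mu s) (mu t) <= e * A + (t - s) / (4 * e).
Proof.
move=> T0; have [_ /(_ _ T0)[phi [mphi phi2 hd]]] := acmu.
have iphi2 : (@lebesgue_measure R).-integrable `[0, T] (EFin \o (fun r => `|phi r| ^+ 2)).
  apply/integrableP; split.
    by apply/measurable_EFinP; apply: measurable_funX; exact: measurableT_comp.
  by under eq_integral do rewrite /= ger0_norm ?sqr_ge0//.
exists (\int[lebesgue_measure]_(r in `[0, T]) (`|phi r| ^+ 2)).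
  by apply: Rintegral_ge0 => r _; rewrite sqr_ge0.
move=> s t e s0 st tT e0; apply: le_trans (hd _ _ s0 st tT) _.
have sub : `[s, t] `<=` `[0, T].
  by apply: subset_itv; rewrite bnd_simp.
have mst : measurable (`[s, t] : set (measurableTypeR R)) by exact: measurable_itv.
have iphi2' : (@lebesgue_measure R).-integrable `[s, t] (EFin \o (fun r => `|phi r| ^+ 2)).
  exact: integrableS iphi2.
have iphi : (@lebesgue_measure R).-integrable `[s, t] (EFin \o phi).
  have mphi' : measurable_fun (`[s, t] : set (measurableTypeR R)) phi by exact: measurable_funS mphi.
  apply: (Rle_integrable mst mphi' (RintegrableD mst (integrable_itv_cst s t 1) iphi2')) => r _.
  by have := sqr_ge0 (`|phi r| - 1); have := normr_ge0 (phi r); nra.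
apply: (@le_trans _ _ (\int[lebesgue_measure]_(r in `[s, t])
    (e * `|phi r| ^+ 2 + (4 * e)^-1))).
  apply: le_Rintegral => //.
    by apply: RintegrableD => //; [exact: RintegrableZ|exact: integrable_itv_cst].
  move=> r _; apply: le_trans (ler_norm _) _.
  have -> : e * `|phi r| ^+ 2 + (4 * e)^-1 =
      ((2 * e * `|phi r|) ^+ 2 + 1) / (4 * e) by field; rewrite gt_eqF.
  rewrite ler_pdivlMr ?mulr_gt0//; have := sqr_ge0 (2 * e * `|phi r| - 1); lra.
rewrite RintegralD//; [|exact: RintegrableZ|exact: integrable_itv_cst].
rewrite Rintegral_itv_cst// RintegralZl// [(4 * e)^-1 * _]mulrC lerD2r.
rewrite ler_wpM2l ?(ltW e0)//; apply: fine_le.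
- exact: integrable_fin_num.
- exact: integrable_fin_num.
- apply: ge0_subset_integral => //; exact: (measurable_int _ iphi2).
Qed.

Lemma transport_le_distP s t i : 0 <= s -> 0 <= t ->
  fine (transport_cost (mu s i) (mu t i)) <= m i * distP m (mu s) (mu t) ^+ 2.
Proof.
move=> s0 t0.
have tc0 j : 0 <= (m j)^-1 * fine (transport_cost (mu s j) (mu t j)).
  rewrite mulr_ge0 ?invr_ge0 ?(ltW (m0 _))// fine_ge0//.
  by have [] := transport_cost_fin_num (p0 j) (mass j s0) (mass j t0) (moment j s0) (moment j t0).
rewrite sqr_sqrtr; last by apply: sumr_ge0 => j _.
rewrite -ler_pdivrMl// (bigD1 i)//= lerDl; apply: sumr_ge0 => j _; exact: tc0.
Qed.

(** In [distP_modulus] the parameter [e] is fixed first to make [e * A] small, then [t - s] is taken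
    small relative to [e]. *)
Lemma curve_coupling T K : 0 < T -> 0 < K -> exists2 d, 0 < d &
  forall i s t, 0 <= s -> s <= t -> t <= T -> t - s < d ->
  exists2 g, coupling (mu s i) (mu t i) g & \int[g]_z (`|z.1 - z.2| ^+ 2) <= K.
Proof.
move=> T0 K0; have [A A0 hA] := distP_modulus T0.
pose M := 1 + \sum_i m i.
have M0 : 0 < M by rewrite ltr_wpDr// sumr_ge0// => i _; exact: ltW.
have mM i : m i <= M.
  rewrite /M (bigD1 i)//= addrCA lerDl addr_ge0// sumr_ge0// => j _; exact: ltW.
(* As [q <= 1], a distance at most [q] has square at most [q]; and [M * q <= K / 2 < K] provides the
   strict inequality asked for by [coupling_near_cost]. *)
pose q := Num.min 1 (K / (2 * M)).
have q0 : 0 < q by rewrite lt_min ltr01 divr_gt0// mulr_gt0.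
have [e e0 h1] : exists2 e, 0 < e & e * A <= q / 2.
  exists (q / (2 * (A + 1))); first by rewrite divr_gt0// mulr_gt0// ltr_wpDl.
  rewrite mulrAC ler_pdivrMr ?mulr_gt0 ?ltr_wpDl//.
  have : q * A <= q * (A + 1) by rewrite ler_wpM2l ?lerDl// ltW.
  lra.
exists (2 * e * q); first by apply: mulr_gt0 q0; apply: mulr_gt0 e0.
move=> i s t s0 st tT tsd.
have t0 := le_trans s0 st.
have dq : distP m (mu s) (mu t) <= q.
  apply: le_trans (hA s t e s0 st tT e0) _.
  have h2 : (t - s) / (4 * e) <= q / 2.
    rewrite ler_pdivrMr ?mulr_gt0//; lra.
  lra.
have d0 : 0 <= distP m (mu s) (mu t) by exact: sqrtr_ge0.
have q1 : q <= 1 by rewrite ge_min lexx.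
have qK : q <= K / (2 * M) by rewrite ge_min lexx orbT.
apply: (coupling_near_cost (p0 i) (mass i s0) (mass i t0) (moment i s0) (moment i t0)).
apply: le_lt_trans (transport_le_distP i s0 t0) _.
apply: (@le_lt_trans _ _ (M * q)).
  apply: ler_pM => //; [exact: ltW|exact: sqr_ge0|].
  have : distP m (mu s) (mu t) ^+ 2 <= q * 1 by rewrite expr2 ler_pM// (le_trans dq).
  by rewrite mulr1.
apply: (@le_lt_trans _ _ (M * (K / (2 * M)))); first by rewrite ler_wpM2l// ltW.
have -> : M * (K / (2 * M)) = K / 2 by field; rewrite gt_eqF.
lra.
Qed.

(** The modulus with [e = 1], applied from time [0], provides a coupling of bounded cost with the
    initial measure. The bound may grow with [T]; a uniform one comes only from dissipation. *)
Lemma moment2_bounded T : 0 < T -> exists2 X, 0 <= X &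
  forall t i, 0 <= t -> t <= T -> \int[mu t i]_x (x ^+ 2) <= X.
Proof.
move=> T0; have [A A0 hA] := distP_modulus T0.
pose q := A + T / 4.
have q0 : 0 <= q by rewrite addr_ge0// divr_ge0// ltW.
exists (\sum_i (2 * \int[mu 0 i]_x (x ^+ 2) + 2 * (m i * q ^+ 2 + 1))).
  apply: sumr_ge0 => i _; rewrite addr_ge0// mulr_ge0//.
    by apply: Rintegral_ge0 => x _; exact: sqr_ge0.
  by rewrite addr_ge0// mulr_ge0 ?sqr_ge0// ltW.
move=> t i t0 tT.
have dq : distP m (mu 0) (mu t) <= q.
  apply: le_trans (hA 0 t 1 (lexx _) t0 tT ltr01) _.
  by rewrite mul1r subr0 mulr1 lerD2l; lra.
have d0 : 0 <= distP m (mu 0) (mu t) by exact: sqrtr_ge0.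
have : fine (transport_cost (mu 0 i) (mu t i)) < m i * q ^+ 2 + 1.
  apply: le_lt_trans (transport_le_distP i (lexx 0) t0) _.
  apply: (@le_lt_trans _ _ (m i * q ^+ 2)); last by rewrite ltrDl.
  by rewrite ler_wpM2l ?(ltW (m0 _))// !expr2 ler_pM.
move=> /(coupling_near_cost (p0 i) (mass i (lexx 0)) (mass i t0)
  (moment i (lexx 0)) (moment i t0))[g cg gK].
apply: le_trans (coupling_moment2 cg (moment i (lexx 0)) (moment i t0) gK) _.
rewrite (bigD1 i)//= lerDl; apply: sumr_ge0 => j _; rewrite addr_ge0// mulr_ge0//.
  by apply: Rintegral_ge0 => x _; exact: sqr_ge0.
by rewrite addr_ge0// mulr_ge0 ?sqr_ge0// ltW.
Qed.

Lemma curve_lipschitz_near i f Lam T e : 0 <= Lam -> lipschitz_fun Lam f ->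
  0 < T -> 0 < e -> exists2 d, 0 < d & forall s t, 0 <= s <= T -> 0 <= t <= T ->
  `|s - t| < d -> `|\int[mu s i]_x f x - \int[mu t i]_x f x| <= e.
Proof.
move=> Lam0 lf T0 e0.
(* With transport cost at most [r ^+ 2] and AM-GM parameter [r], the bound of [coupling_lipschitz]
   becomes [Lam / 2 * (p i + 1) * r]. *)
pose r := e / ((Lam + 1) * (p i + 1)).
have pi1 : 0 < p i + 1 by rewrite ltr_wpDl// ltW.
have L1 : 0 < Lam + 1 by rewrite ltr_wpDl.
have r0 : 0 < r by rewrite divr_gt0// mulr_gt0.
have [d d0 hd] := curve_coupling T0 (exprn_gt0 2 r0).
exists d => //.
have main s t : 0 <= s -> s <= t -> t <= T -> t - s < d ->
    `|\int[mu s i]_x f x - \int[mu t i]_x f x| <= e.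
  move=> s0 st tT std; have t0 := le_trans s0 st.
  have [g cg gK] := hd i s t s0 st tT std.
  have := coupling_lipschitz cg (mass i s0) (moment i s0) (moment i t0)
    (lipschitz_integrable (moment i s0) Lam0 lf)
    (lipschitz_integrable (moment i t0) Lam0 lf) lf Lam0 r0 gK.
  move=> /le_trans; apply.
  have -> : r ^+ 2 / r = r by field; rewrite gt_eqF.
  have -> : Lam * 2^-1 * (r * p i + r) = 2^-1 * (Lam * (p i + 1)) * r by ring.
  apply: (@le_trans _ _ ((Lam + 1) * (p i + 1) * r)).
    rewrite ler_wpM2r ?(ltW r0)//.
    have : 0 <= Lam * (p i + 1) by rewrite mulr_ge0// ltW.
    have := ltW pi1; lra.
  by rewrite /r mulrC divfK// gt_eqF// mulr_gt0.
move=> s t /andP[s0 sT] /andP[t0 tT] std.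
have [st|ts] := leP s t.
  apply: main => //; apply: le_lt_trans std; rewrite distrC; exact: ler_norm.
rewrite distrC; apply: main => //; first exact: ltW.
by apply: le_lt_trans std; exact: ler_norm.
Qed.

(* The extension to negative times makes time-dependent integrals continuous and
   measurable on the whole line. *)
Definition ext t := mu (Num.max 0 t).

Lemma ext_continuous i f Lam : 0 <= Lam -> lipschitz_fun Lam f ->
  continuous (fun t => \int[ext t i]_x f x).
Proof.
move=> Lam0 lf t; apply/cvgrPdist_le => e e0.
pose T := `|t| + 1.
have T0 : 0 < T by rewrite ltr_wpDl.
have [d d0 hd] := curve_lipschitz_near i Lam0 lf T0 e0.
near=> s; apply: hd.
- rewrite le_max lexx /= ge_max (ltW T0) /=.
  by apply: le_trans (ler_norm _) _; rewrite lerDl.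
- rewrite le_max lexx /= ge_max (ltW T0) /=.
  have : `|t - s| < 1 by near: s; apply: cvgr_dist_lt => //; exact: cvg_id.
  rewrite distrC => st; have := ler_norm (s - t); have := ler_norm t; rewrite /T; lra.
- apply: le_lt_trans (normr_max0B _ _) _.
  by near: s; apply: cvgr_dist_lt => //; exact: cvg_id.
Unshelve. all: by end_near. Qed.

Lemma ext_measurable i A : measurable A -> measurable_fun setT (fun t => ext t i A).
Proof.
apply: (@measurable_family _ _ (measurableTypeR R) (ext ^~ i) (p i)).
  by move=> t; apply: mass; rewrite le_max lexx.
move=> f Lam Lam0 lf _; apply: continuous_measurable_fun.
exact: ext_continuous lf.
Qed.

Lemma ext_mass t i : ext t i setT = (p i)%:E.
Proof. by apply: mass; rewrite le_max lexx. Qed.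

Lemma ext_moment t i : finite_moment2 (ext t i).
Proof. by apply: moment; rewrite le_max lexx. Qed.

End AC2.

(** * From the weak formulation to an integral identity *)

Section TimeTests.
Variable R : realType.
Local Notation leb := (@lebesgue_measure R).
Implicit Types (f G H : R -> R) (a b c s t r x T B : R).

Lemma derive1_off f a b x : (forall y, f y != 0 -> a <= y <= b) ->
  ~~ (a <= x <= b) -> derive1 f x = 0.
Proof.
move=> fab nx; rewrite derive1E (@near_eq_derive _ _ _ _ (cst (0 : R))) ?derive_cst//.
have f0 y : ~~ (a <= y <= b) -> f y = 0.
  by move=> ny; apply/eqP; apply: contraNT ny => /fab.
move: nx; rewrite negb_and -!ltNge => /orP[xa|bx].
- near=> y; rewrite f0//= negb_and -!ltNge; apply/orP; left; near: y.
  exact: lt_nbhsl.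
- near=> y; rewrite f0//= negb_and -!ltNge; apply/orP; right; near: y.
  exact: lt_nbhsr.
Unshelve. all: by end_near. Qed.

Lemma smooth_lipschitz f a b : smooth f -> (forall y, f y != 0 -> a <= y <= b) ->
  exists2 c, 0 <= c & lipschitz_fun c f /\ forall x, `|derive1 f x| <= c.
Proof.
(* The interval [[a, b]] may be empty; the maximum keeps the segment nonempty for the extreme value
   theorem. *)
move=> sf fab; pose b' := Num.max a b.
have ab' : a <= b' by rewrite le_max lexx.
have cd : {within `[a, b'], continuous (fun x : R => `|derive1 f x|)}.
  apply: continuous_subspaceT => x; apply: cvg_norm.
  by apply: smooth_continuous; exact: smooth_derive1.
have [z zab hz] := EVT_max ab' cd.
have db x : `|derive1 f x| <= `|derive1 f z|.
  have [xab|nx] := boolP (a <= x <= b).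
    by apply: hz; rewrite in_itv /=; move/andP: xab => [-> xb]; rewrite le_max xb orbT.
  by rewrite (derive1_off fab nx) normr0.
exists `|derive1 f z| => //; split => // x y.
have main u v : u <= v -> `|f v - f u| <= `|derive1 f z| * `|v - u|.
  move=> uv; have [w _ ->] := MVT_segment (df := derive1 f) uv
    (fun w _ => smooth_is_derive w sf) (continuous_subspaceT (smooth_continuous sf)).
  by rewrite normrM ler_wpM2r.
have [xy|yx] := leP x y; first by rewrite distrC (distrC x); exact: main.
by apply: main; exact: ltW.
Qed.

Lemma bounded_integrable f a b B : measurable_fun setT f ->
  (forall r, a <= r <= b -> `|f r| <= B) -> leb.-integrable `[a, b] (EFin \o f).
Proof.
move=> mf fB.
have mab : measurable (`[a, b] : set (measurableTypeR R)) by exact: measurable_itv.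
have mf' : measurable_fun (`[a, b] : set (measurableTypeR R)) f by exact: measurable_funS mf.
apply: (Rle_integrable mab mf' (integrable_itv_cst a b B)) => r /=.
by rewrite in_itv /=; exact: fB.
Qed.

Lemma Rintegral_support f (A D : set R) : A `<=` D -> (forall r, ~ A r -> f r = 0) ->
  \int[leb]_(r in D) f r = \int[leb]_(r in A) f r.
Proof.
move=> AD f0; rewrite Rintegral_mkcond [RHS]Rintegral_mkcond.
congr (Rintegral _ _ _); apply/funext => r; rewrite !patchE.
have [rA|rA] := pselect (A r).
  by rewrite !mem_set//; exact: AD.
by rewrite (memNset rA) f0//; case: ifP.
Qed.

(** A smooth Heaviside function rising on [[a, a + 1/(k+1)]], hence to the right of [a]; differences
    of two of them approximate the indicator of []s, t]]. *)
Definition tstep a (k : nat) r : R := step (k.+1%:R * r + - (k.+1%:R * a)).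
Definition dtstep a (k : nat) r : R :=
  k.+1%:R * derive1 (@step R) (k.+1%:R * r + - (k.+1%:R * a)).

Lemma smooth_tstep a k : smooth (tstep a k).
Proof.
exact: (smooth_comp (@smooth_step R) (smooth_affine _ _)).
Qed.

Lemma derive1_tstep a k r : derive1 (tstep a k) r = dtstep a k r.
Proof.
have da : is_derive r 1 (fun r : R => k.+1%:R * r + - (k.+1%:R * a)) k.+1%:R.
  apply: (is_derive_val (is_deriveD (is_deriveM (is_derive_cst (k.+1%:R : R) r (1 : R))
    (is_derive_id r (1 : R))) (is_derive_cst (- (k.+1%:R * a) : R) r (1 : R)))).
  by rewrite scaler0 !addr0 /GRing.scale /= mulr1.
have [_] := is_derive1_comp (smooth_is_derive _ (@smooth_step R)) da.
by move=> h; rewrite derive1E; apply: (etrans h); rewrite /dtstep; exact: mulrC.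
Qed.

Lemma smooth_dtstep a k : smooth (dtstep a k).
Proof.
have <- : derive1 (tstep a k) = dtstep a k by apply/funext => r; exact: derive1_tstep.
exact/smooth_derive1/smooth_tstep.
Qed.

Lemma tstep_le0 a k r : r <= a -> tstep a k r = 0.
Proof. by move=> ra; rewrite /tstep step_le0// -mulrN -mulrDr mulr_ge0_le0// subr_le0. Qed.

Lemma tstep_ge1 a k r : a + k.+1%:R^-1 <= r -> tstep a k r = 1.
Proof.
move=> ar; rewrite /tstep step_ge1// -mulrN -mulrDr -ler_pdivrMl// mulr1.
by rewrite lerBrDl.
Qed.

Lemma dtstep_off a k r : ~~ (a <= r <= a + k.+1%:R^-1) -> dtstep a k r = 0.
Proof.
rewrite negb_and -!ltNge => /orP[ra|ar]; rewrite /dtstep.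
  by rewrite dstep_le0 ?mulr0// -mulrN -mulrDr pmulr_rlt0// subr_lt0.
by rewrite dstep_ge1 ?mulr0// -mulrN -mulrDr -ltr_pdivrMl// mulr1 ltrBrDl.
Qed.

Lemma Rintegral_dtstep a k s T : s <= a -> a + 1 <= T ->
  \int[leb]_(r in `[s, T]) dtstep a k r = 1.
Proof.
move=> sa aT; rewrite /Rintegral (@continuous_FTC2 _ _ (tstep a k)).
- rewrite /= (tstep_le0 k sa) (tstep_ge1 (r := T)) ?subr0//.
  by apply: le_trans aT; rewrite lerD2l invf_le1// ler1n.
- by apply: le_lt_trans sa _; apply: lt_le_trans aT; rewrite ltrDl.
- by apply: continuous_subspaceT; exact: smooth_continuous (smooth_dtstep a k).
- split => [x _||]; first exact: smooth_derivable (smooth_tstep a k).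
    apply: cvg_at_right_filter; exact: smooth_continuous (smooth_tstep a k) _.
  apply: cvg_at_left_filter; exact: smooth_continuous (smooth_tstep a k) _.
- by move=> r _; exact: derive1_tstep.
Qed.

(** The functions [dtstep a k] have integral [1], are bounded by [c (k+1)] and live on an interval
    of length [1/(k+1)] next to [a]. The error is therefore at most [c] times the oscillation of [G]
    there. *)
Lemma dtstep_approx G a s T : continuous G -> s <= a -> a + 1 <= T ->
  (fun k => \int[leb]_(r in `[s, T]) (dtstep a k r * G r)) @ \oo --> G a.
Proof.
move=> cG sa aT; apply/cvgrPdist_le => e e0.
have [c c0 hc] := dstep_bounded R.
have mJ : measurable (`[s, T] : set (measurableTypeR R)) by exact: measurable_itv.
have cint f : continuous f -> leb.-integrable `[s, T] (EFin \o f).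
  move=> cf; apply: continuous_compact_integrable; first exact: segment_compact.
  exact: continuous_subspaceT.
have ec0 : 0 < e / c by rewrite divr_gt0.
have /cvgrPdist_le /(_ _ ec0) := cG a.
move=> [d /= d0 hd].
near=> k.
have kd : k.+1%:R^-1 < d :> R by near: k; exact: near_infty_natSinv_lt (PosNum d0).
set K := k.+1%:R : R in kd *; have K0 : 0 < K by rewrite ltr0n.
have cdt : continuous (dtstep a k) := smooth_continuous (smooth_dtstep a k).
have cdG : continuous (fun r => dtstep a k r * (G a - G r)).
  move=> r; apply: cvgM; first exact: cdt.
  by apply: cvgB; [exact: cvg_cst|exact: cG].
have -> : G a - \int[leb]_(r in `[s, T]) (dtstep a k r * G r) =
    \int[leb]_(r in `[s, T]) (dtstep a k r * (G a - G r)).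
  under [RHS]eq_Rintegral do rewrite mulrBr.
  rewrite RintegralB//; last 2 first.
  - by apply: cint => r; apply: cvgM; [exact: cdt|exact: cvg_cst].
  - by apply: cint => r; apply: cvgM; [exact: cdt|exact: cG].
  by rewrite RintegralZr ?Rintegral_dtstep ?mul1r//; exact: cint.
apply: (le_trans (le_normr_Rintegral _ _)) => //; first exact: cint.
rewrite (@Rintegral_support _ `[a, a + K^-1]).
- apply: (@le_trans _ _ (\int[leb]_(r in `[a, a + K^-1]) (K * e))).
    apply: le_Rintegral => //.
    + apply: continuous_compact_integrable; first exact: segment_compact.
      by apply: continuous_subspaceT => r; apply: cvg_norm; exact: cdG.
    + exact: integrable_itv_cst.
    + move=> r; rewrite /= in_itv /= => /andP[ar ra].
      rewrite normrM.
      have h1 : `|dtstep a k r| <= K * c by rewrite normrM gtr0_norm// ler_wpM2l// ltW.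
      have h2 : `|G a - G r| <= e / c.
        by apply: hd => /=; rewrite ler0_norm ?subr_le0// opprB; apply: le_lt_trans kd; rewrite lerBlDl.
      apply: le_trans (ler_pM _ _ h1 h2) _ => //.
      by rewrite -mulrA [c * _]mulrC divfK// gt_eqF.
  rewrite Rintegral_itv_cst; last by rewrite lerDl invr_ge0 ltW.
  rewrite le_eqVlt; apply/orP; left; apply/eqP.
  by field; rewrite gt_eqF.
- move=> r; rewrite /= !in_itv /= => /andP[ar ra]; rewrite (le_trans sa ar)/=.
  by apply: le_trans ra _; apply: le_trans aT; rewrite lerD2l invf_le1// ler1n.
- by move=> r; rewrite /= in_itv /= => /negP nr; rewrite dtstep_off ?mul0r ?normr0.
Unshelve. all: by end_near. Qed.

Lemma cvg_seq_unique (u : nat -> R) a b : u @ \oo --> a -> u @ \oo --> b -> a = b.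
Proof. by move=> ua ub; exact: (norm_cvg_unique ua ub). Qed.

Lemma tstep_cvg a r : tstep a ^~ r @ \oo --> ((a < r)%R%:R : R).
Proof.
have [ar|ra] := ltP a r.
  have ra0 : 0 < r - a by rewrite subr_gt0.
  apply: cvg_near_cst; near=> k; apply/eqP; rewrite tstep_ge1//.
  rewrite -lerBrDl ltW//; near: k.
  exact: (near_infty_natSinv_lt (PosNum ra0)).
by apply: cvg_near_cst; apply: nearW => k; rewrite tstep_le0.
Unshelve. all: by end_near. Qed.

(* A distributional derivative which is bounded yields the integrated identity;
   the test functions approximate the indicator of [[s, t]]. *)
Lemma weak_derivative_integral G H :
  continuous G -> measurable_fun setT H ->
  (forall T, exists B, forall r, 0 <= r <= T -> `|H r| <= B) ->
  (forall f a b, smooth f -> 0 < a -> (forall r, f r != 0 -> a <= r <= b) ->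
    \int[leb]_(r in `]0, +oo[) (derive1 f r * G r + f r * H r) = 0) ->
  forall s t, 0 <= s -> s <= t -> G t - G s = \int[leb]_(r in `[s, t]) H r.
Proof.
move=> cG mH bH weak.
have intH s t : 0 <= s -> leb.-integrable `[s, t] (EFin \o H).
  move=> s0; have [B hB] := bH t; apply: (bounded_integrable (B := B)) => // r /andP[sr rt].
  by apply: hB; rewrite rt (le_trans s0).
(* Test functions live at positive times, so [s > 0] is treated first; [s = 0] is reached afterwards
   by continuity of [G] and boundedness of [H]. *)
have pos s t : 0 < s -> s < t -> G t - G s = \int[leb]_(r in `[s, t]) H r.
  (* The function [f k] below rises after [s] and falls after [t] within a length at most [1], so it
     vanishes off [[s, t + 1]]. *)
  move=> s0 st; pose T := t + 1; have [B hB] := bH T.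
  have B0 : 0 <= B by apply: le_trans (hB 0 _) => //; rewrite lexx /T; lra.
  have mJ : measurable (`[s, T] : set (measurableTypeR R)) by exact: measurable_itv.
  pose f k r := tstep s k r + -1 * tstep t k r.
  have sf k : smooth (f k).
    apply: smoothD; first exact: smooth_tstep.
    by apply: smoothM; [exact: smooth_cst|exact: smooth_tstep].
  have fE k r : f k r = tstep s k r - tstep t k r by rewrite /f mulN1r.
  have dfE k r : derive1 (f k) r = dtstep s k r - dtstep t k r.
    rewrite (_ : f k = (fun r => tstep s k r - tstep t k r)); last exact/funext.
    have [_] := is_deriveB (smooth_is_derive r (smooth_tstep s k))
      (smooth_is_derive r (smooth_tstep t k)).
    by rewrite -derive1E !derive1_tstep.
  have kinv k : k.+1%:R^-1 <= 1 :> R by rewrite invf_le1// ler1n.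
  have fsupp k r : f k r != 0 -> s <= r <= T.
    rewrite fE; have [rs|rs] := ltP r s.
      by rewrite !tstep_le0 ?subr0 ?eqxx// ltW// (lt_trans rs).
    have [rT|//] := ltP T r; rewrite !tstep_ge1 ?subrr ?eqxx//.
      by apply: le_trans (ltW rT); rewrite /T lerD2l.
    by apply: le_trans (ltW rT); rewrite /T lerD ?(ltW st).
  have cdt a k : continuous (dtstep a k) := smooth_continuous (smooth_dtstep a k).
  have cint g : continuous g -> leb.-integrable `[s, T] (EFin \o g).
    move=> cg; apply: continuous_compact_integrable; first exact: segment_compact.
    exact: continuous_subspaceT.
  have fb k r : `|f k r| <= 1.
    rewrite fE; have := @step_ge0 R (k.+1%:R * r + - (k.+1%:R * s)).
    have := @step_le1 R (k.+1%:R * r + - (k.+1%:R * s)).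
    have := @step_ge0 R (k.+1%:R * r + - (k.+1%:R * t)).
    have := @step_le1 R (k.+1%:R * r + - (k.+1%:R * t)).
    rewrite -/(tstep s k r) -/(tstep t k r) => h1 h2 h3 h4.
    by rewrite ler_norml; apply/andP; split; lra.
  have mfk k : measurable_fun setT (f k) by apply: continuous_measurable_fun; exact: smooth_continuous.
  have mfH k : measurable_fun setT (fun r => f k r * H r) by exact: measurable_funM.
  have fHB k r : s <= r <= T -> `|f k r * H r| <= B.
    move=> /andP[sr rT]; rewrite normrM -[B]mul1r ler_pM//.
    by apply: hB; rewrite rT (le_trans (ltW s0)).
  have intfH k : leb.-integrable `[s, T] (EFin \o (fun r => f k r * H r)).
    exact: (bounded_integrable (B := B) (mfH k) (@fHB k)).
  have key k : \int[leb]_(r in `[s, T]) (dtstep s k r * G r)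
      - \int[leb]_(r in `[s, T]) (dtstep t k r * G r)
      + \int[leb]_(r in `[s, T]) (f k r * H r) = 0.
    rewrite -(weak (f k) s T (sf k) s0 (@fsupp k)).
    rewrite (@Rintegral_support _ `[s, T] `]0, +oo[); last 2 first.
    - by move=> r; rewrite /= !in_itv /= andbT => /andP[+ _]; exact: lt_le_trans.
    - move=> r; rewrite /= in_itv /= => /negP nr.
      rewrite (derive1_off (@fsupp k) nr) mul0r add0r.
      by rewrite (_ : f k r = 0) ?mul0r//; apply/eqP; apply: contraNT nr => /fsupp.
    have i1 : leb.-integrable `[s, T] (EFin \o (fun r => dtstep s k r * G r)).
      by apply: cint => r; apply: cvgM; [exact: cdt|exact: cG].
    have i2 : leb.-integrable `[s, T] (EFin \o (fun r => dtstep t k r * G r)).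
      by apply: cint => r; apply: cvgM; [exact: cdt|exact: cG].
    rewrite -RintegralB// -RintegralD//; last exact: RintegrableB.
    by apply: eq_Rintegral => r _; rewrite dfE mulrBl.
  have lim1 : (fun k => \int[leb]_(r in `[s, T]) (dtstep s k r * G r)) @ \oo --> G s.
    by apply: dtstep_approx => //; rewrite /T lerD2r ltW.
  have lim2 : (fun k => \int[leb]_(r in `[s, T]) (dtstep t k r * G r)) @ \oo --> G t.
    by apply: dtstep_approx => //; rewrite ltW.
  have lim3 : (fun k => \int[leb]_(r in `[s, T]) (f k r * H r)) @ \oo -->
      \int[leb]_(r in `[s, T]) (((s < r)%R%:R - (t < r)%R%:R) * H r).
    apply: (@Rdominated_cvg _ _ _ leb _ mJ _ _ (fun=> B)).
    - by move=> k; exact: measurable_funS (mfH k).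
    - move=> r _; apply: cvgMl; under eq_fun do rewrite fE.
      by apply: cvgB; exact: tstep_cvg.
    - exact: integrable_itv_cst.
    - by move=> k r; rewrite /= in_itv /=; exact: fHB.
  have /eqP : G s - G t +
      \int[leb]_(r in `[s, T]) (((s < r)%R%:R - (t < r)%R%:R) * H r) = 0.
    apply: (@cvg_seq_unique (fun=> 0)); last exact: cvg_cst.
    rewrite (_ : (fun=> 0) = fun k => \int[leb]_(r in `[s, T]) (dtstep s k r * G r)
      - \int[leb]_(r in `[s, T]) (dtstep t k r * G r)
      + \int[leb]_(r in `[s, T]) (f k r * H r)); last by apply/funext => k; rewrite key.
    by apply: cvgD lim3; exact: cvgB.
  rewrite (@Rintegral_support _ `]s, t]); last 2 first.
  - by apply: subset_itv; rewrite bnd_simp// /T lerDl.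
  - move=> r; rewrite /= in_itv /= => nr.
    have [sr|rs] := ltP s r; have [tr|rt] := ltP t r; rewrite ?subrr ?mul0r//.
      by case: nr; rewrite sr.
    by have := lt_trans st tr; rewrite ltNge rs.
  rewrite (@eq_Rintegral _ _ _ leb `]s, t] H); last first.
    move=> r; rewrite inE /= in_itv /= => /andP[-> rt].
    by rewrite ltNge rt subr0 mul1r.
  rewrite Rintegral_itv_obnd_cbnd; last first.
    apply: (integrableS _ _ _ (intH s t (ltW s0))) => //.
    by apply: subset_itv; rewrite bnd_simp.
  by rewrite addrC addr_eq0 opprB => /eqP.
move=> s t s0 st.
have [<-|sNt] := eqVneq s t.
  by rewrite subrr set_itv1 Rintegral_set1.
have {sNt} {}st : s < t by rewrite lt_neqAle sNt.
have [s_gt0|] := ltP 0 s; first exact: pos.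
move=> s_le0; have {s_le0 s0} s0 : s = 0 by apply/eqP; rewrite eq_le s_le0.
rewrite {s}s0 in st *; have [B hB] := bH t.
have B0 : 0 <= B by apply: le_trans (hB 0 _) => //; rewrite lexx ltW.
apply/eqP; rewrite -subr_eq0 -normr_eq0 eq_le normr_ge0 andbT.
apply/ler_addgt0Pr => e e0; rewrite add0r.
have e20 : 0 < e / 2 by rewrite divr_gt0.
have /cvgrPdist_le /(_ _ e20) [d /= d0 hd] := cG 0.
(* A positive starting time so small that both [G 0 - G s] and the integral of [H] over [[0, s]] are
   at most [e / 2]. *)
pose s := Num.min (t / 2) (Num.min (d / 2) (e / 2 / (B + 1))).
have B1 : 0 < B + 1 by rewrite ltr_wpDl.
have s0 : 0 < s by rewrite !lt_min !divr_gt0.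
have st' : s < t by apply: (@le_lt_trans _ _ (t / 2)); [rewrite ge_min lexx|lra].
have sd : s < d.
  by apply: (@le_lt_trans _ _ (d / 2)); [rewrite !ge_min lexx orbT|lra].
have sB : s * (B + 1) <= e / 2 by rewrite -ler_pdivlMr// !ge_min lexx !orbT.
have G0 : `|G 0 - G s| <= e / 2 by apply: hd => /=; rewrite sub0r normrN gtr0_norm.
have split_int : \int[leb]_(r in `[0, t]) H r - \int[leb]_(r in `[0, s]) H r =
    \int[leb]_(r in `[s, t]) H r.
  rewrite Rintegral_itvB ?bnd_simp ?(ltW s0) ?(ltW st')//; last exact: intH.
  apply: Rintegral_itv_obnd_cbnd; apply: (integrableS _ _ _ (intH s t (ltW s0))) => //.
  by apply: subset_itv; rewrite bnd_simp.
have H0 : `|\int[leb]_(r in `[0, s]) H r| <= B * s.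
  have ms : measurable (`[0, s] : set (measurableTypeR R)) by exact: measurable_itv.
  apply: (le_trans (le_normr_Rintegral ms (intH 0 s (lexx _)))).
  rewrite -[s in leRHS]subr0 -Rintegral_itv_cst ?(ltW s0)//.
  apply: (le_Rintegral ms); first exact: (integrable_norm (intH 0 s (lexx _))).
    exact: integrable_itv_cst.
  move=> r; rewrite /= in_itv /= => /andP[r0 rs]; apply: hB.
  by rewrite r0 (le_trans rs) ?ltW.
have -> : G t - G 0 - \int[leb]_(r in `[0, t]) H r =
    - (G 0 - G s) - \int[leb]_(r in `[0, s]) H r.
  have := pos s t s0 st'; rewrite -split_int; lra.
apply: le_trans (ler_normB _ _) _; rewrite normrN.
apply: le_trans (lerD G0 H0) _; rewrite [leRHS](splitr e) lerD2l.
by apply: le_trans sB; rewrite mulrC ler_wpM2l ?lerDl// ltW.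
Qed.

End TimeTests.

(** * Bounds and limits of double integrals *)

Section DoubleIntegral.
Variable R : realType.
Local Notation fmeas := {finite_measure set R -> \bar R}.
Implicit Types (mu nu : fmeas) (K : R * R -> R) (c : R).

Lemma double_integral_le mu nu K c : finite_moment2 mu -> finite_moment2 nu ->
  measurable_fun setT K -> bigO2 K c ->
  `|\int[mu]_x \int[nu]_y K (x, y)| <=
    c * (\int[nu]_y (1 + y ^+ 2) * \int[mu]_x (1 + x ^+ 2)).
Proof.
move=> hm hn mK Kc.
have iS : mu.-integrable setT (EFin \o (fun y => 1 + y ^+ 2)).
  by apply: RintegrableD => //; [exact: Rintegrable_cst|exact: integrable_sqr].
have iK := integrable_int_slice hm hn mK Kc.
apply: (le_trans (le_normr_Rintegral _ _)) => //.
rewrite mulrA -RintegralZl//; apply: le_Rintegral => //.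
- exact: integrable_norm.
- exact: RintegrableZ.
- by move=> x _; exact: Rintegral_slice_le.
Qed.

Lemma double_integral_cvg mu nu (K_ : nat -> R * R -> R) K c :
  finite_moment2 mu -> finite_moment2 nu ->
  (forall k, measurable_fun setT (K_ k)) -> (forall k, bigO2 (K_ k) c) ->
  (forall z, K_ ^~ z @ \oo --> K z) ->
  (fun k => \int[mu]_x \int[nu]_y K_ k (x, y)) @ \oo -->
    \int[mu]_x \int[nu]_y K (x, y).
Proof.
move=> hm hn mK Kc cvK.
have iS (la : fmeas) : finite_moment2 la ->
    la.-integrable setT (EFin \o (fun y => 1 + y ^+ 2)).
  by move=> h; apply: RintegrableD => //; [exact: Rintegrable_cst|exact: integrable_sqr].
apply: (@Rdominated_cvg _ _ _ mu _ _ (fun k x => \int[nu]_y K_ k (x, y)) _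
  (fun x => c * \int[nu]_y (1 + y ^+ 2) * (1 + x ^+ 2))) => //.
- by move=> k; exact: measurable_slice.
- move=> x _; apply: (@Rdominated_cvg _ _ _ nu _ _ (fun k y => K_ k (x, y)) _
    (fun y => c * (1 + x ^+ 2) * (1 + y ^+ 2))) => //.
  + by move=> k; apply: measurableT_comp => //; exact: measurable_pair1.
  + by apply: RintegrableZ => //; exact: iS.
  + by move=> k y _; rewrite -mulrA; exact: Kc.
- by apply: RintegrableZ => //; exact: iS.
- by move=> k x _; exact: Rintegral_slice_le.
Qed.

End DoubleIntegral.

(** * Cut-off in space *)

Section CutOff.
Variable R : realType.
Implicit Types (x : R) (k : nat) (psi : R -> R).

(** The transition takes place over a length [k + 1], so the derivative is of order [1 / (k + 1)];
    this compensates one power of [x] in a quadratically growing [psi]. *)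
Definition bump k x : R :=
  step (- k.+1%:R^-1 * x + 2) * step (k.+1%:R^-1 * x + 2).

Lemma smooth_bump k : smooth (bump k).
Proof.
by apply: smoothM; exact: (smooth_comp (@smooth_step R) (smooth_affine _ _)).
Qed.

Definition dbump k x : R :=
  step (- k.+1%:R^-1 * x + 2) * (derive1 (@step R) (k.+1%:R^-1 * x + 2) * k.+1%:R^-1)
  + step (k.+1%:R^-1 * x + 2) * (derive1 (@step R) (- k.+1%:R^-1 * x + 2) * - k.+1%:R^-1).

Lemma is_derive_bump k x : is_derive x 1 (bump k) (dbump k x).
Proof.
have da (a b : R) : is_derive x 1 (fun r : R => a * r + b) a.
  apply: (is_derive_val (is_deriveD (is_deriveM (is_derive_cst a x (1 : R))
    (is_derive_id x (1 : R))) (is_derive_cst b x (1 : R)))).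
  by rewrite scaler0 !addr0 /GRing.scale /= mulr1.
have d1 := is_derive1_comp (smooth_is_derive _ (@smooth_step R)) (da (- k.+1%:R^-1) 2).
have d2 := is_derive1_comp (smooth_is_derive _ (@smooth_step R)) (da k.+1%:R^-1 2).
exact: (is_derive_val (is_deriveM d1 d2)).
Qed.

Lemma bump_ge0 k x : 0 <= bump k x.
Proof. by rewrite mulr_ge0 ?step_ge0. Qed.

Lemma bump_le1 k x : bump k x <= 1.
Proof. by rewrite -[1]mulr1 ler_pM ?step_ge0 ?step_le1. Qed.

Lemma bump_support k x : bump k x != 0 -> `|x| <= 2 * k.+1%:R.
Proof.
have k0 : 0 < k.+1%:R :> R by rewrite ltr0n.
rewrite mulf_eq0 negb_or => /andP[h1 h2].
have g1 : 0 < - k.+1%:R^-1 * x + 2.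
  by rewrite ltNge; apply: contra h1 => h; rewrite step_le0.
have g2 : 0 < k.+1%:R^-1 * x + 2.
  by rewrite ltNge; apply: contra h2 => h; rewrite step_le0.
move: g1 g2; rewrite mulNr addrC subr_gt0 [_^-1 * x]mulrC ltr_pdivrMr// => g1.
rewrite -ltrBlDr sub0r ltr_pdivlMr// mulNr => g2.
by rewrite ler_norml (ltW g1) (ltW g2).
Qed.

Lemma bump_eq1 k x : `|x| <= k.+1%:R -> bump k x = 1.
Proof.
have k0 : 0 < k.+1%:R :> R by rewrite ltr0n.
rewrite ler_norml => /andP[h1 h2]; rewrite /bump mulNr.
have u1 : k.+1%:R^-1 * x <= 1 by rewrite mulrC ler_pdivrMr// mul1r.
have u2 : -1 <= k.+1%:R^-1 * x by rewrite mulrC ler_pdivlMr// mulN1r.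
move: u1 u2; move: (_ * x) => u u1 u2.
by rewrite !step_ge1 ?mulr1//; lra.
Qed.

Lemma dbump_eq0 k x : `|x| < k.+1%:R -> dbump k x = 0.
Proof.
have k0 : 0 < k.+1%:R :> R by rewrite ltr0n.
rewrite ltr_norml => /andP[h1 h2]; rewrite /dbump mulNr.
have u1 : k.+1%:R^-1 * x < 1 by rewrite mulrC ltr_pdivrMr// mul1r.
have u2 : -1 < k.+1%:R^-1 * x by rewrite mulrC ltr_pdivlMr// mulN1r.
move: u1 u2; move: (_ * x) => u u1 u2.
by rewrite !dstep_ge1 ?mul0r ?mulr0 ?addr0//; lra.
Qed.

Lemma dbump_support k x : dbump k x != 0 -> `|x| <= 2 * k.+1%:R.
Proof.
move=> h; have := derive1_off (f := bump k) (a := - (2 * k.+1%:R)) (b := 2 * k.+1%:R) (x := x).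
rewrite derive1E; have [_ ->] := is_derive_bump k x.
move=> h'; rewrite ler_norml; apply: contraNT h => /h' ->//.
by move=> y /bump_support; rewrite ler_norml.
Qed.

Lemma dbump_bounded : exists2 c, 0 < c & forall k x, `|dbump k x| <= c * k.+1%:R^-1.
Proof.
have [c c0 hc] := dstep_bounded R; exists (2 * c); first by rewrite mulr_gt0.
move=> k x; have kV : 0 <= k.+1%:R^-1 :> R by rewrite invr_ge0.
have half a b e : `|e| = k.+1%:R^-1 ->
    `|step a * (derive1 (@step R) b * e)| <= c * k.+1%:R^-1.
  move=> he; rewrite (normrM (step a)) (normrM _ e) he -[leRHS]mul1r.
  have sa : `|step a| <= 1 by rewrite ger0_norm ?step_le1 ?step_ge0.
  apply: (@le_trans _ _ (`|derive1 (@step R) b| * k.+1%:R^-1)).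
    by rewrite ler_piMl// mulr_ge0.
  by rewrite mul1r ler_wpM2r.
apply: le_trans (ler_normD _ _) _; rewrite mulr_natl mulr2n mulrDl.
by apply: lerD; apply: half; rewrite ?normrN ger0_norm.
Qed.

Definition trunc psi k x := psi x * bump k x.

Lemma smooth_trunc psi k : smooth psi -> smooth (trunc psi k).
Proof. by move=> sp; apply: smoothM => //; exact: smooth_bump. Qed.

Lemma derive1_trunc psi k x : smooth psi ->
  derive1 (trunc psi k) x = psi x * dbump k x + bump k x * derive1 psi x.
Proof.
move=> sp; rewrite derive1E.
by have [_] := is_deriveM (smooth_is_derive x sp) (is_derive_bump k x).
Qed.

Lemma trunc_cvg psi x : trunc psi ^~ x @ \oo --> psi x.
Proof.
apply: cvg_near_cst; near=> k; rewrite /trunc bump_eq1 ?mulr1//.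
have : `|x| <= k%:R by near: k; exact: nbhs_infty_ger.
by move/le_trans; apply; rewrite ler_nat.
Unshelve. all: by end_near. Qed.

Lemma derive1_trunc_cvg psi x : smooth psi ->
  (fun k => derive1 (trunc psi k) x) @ \oo --> derive1 psi x.
Proof.
move=> sp; apply: cvg_near_cst; near=> k; rewrite derive1_trunc//.
have xk : `|x| < k.+1%:R.
  have : `|x| <= k%:R by near: k; exact: nbhs_infty_ger.
  by move/le_lt_trans; apply; rewrite ltr_nat.
by rewrite dbump_eq0// bump_eq1 ?ltW// mulr0 add0r mul1r.
Unshelve. all: by end_near. Qed.

Lemma trunc_support psi k x : trunc psi k x != 0 -> - (2 * k.+1%:R) <= x <= 2 * k.+1%:R.
Proof.
by rewrite mulf_eq0 negb_or => /andP[_ /bump_support]; rewrite ler_norml.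
Qed.

Lemma trunc_le psi k x c : `|psi x| <= c * (1 + x ^+ 2) ->
  `|trunc psi k x| <= c * (1 + x ^+ 2).
Proof.
move=> h; rewrite normrM -[leRHS]mulr1 ler_pM//.
by rewrite ger0_norm ?bump_ge0 ?bump_le1.
Qed.

(* On the support of [dbump k] we have [|x| <= 2 (k + 1)], so [psi * dbump k],
   of order [x^2 / (k + 1)], is of order [|x|]. *)
Lemma derive1_trunc_le psi c : 0 <= c -> smooth psi ->
  (forall x, `|psi x| <= c * (1 + x ^+ 2)) ->
  (forall x, `|derive1 psi x| <= c * (1 + `|x|)) ->
  exists2 c', 0 <= c' & forall k x, `|derive1 (trunc psi k) x| <= c' * (1 + `|x|).
Proof.
move=> c0 sp hp hdp; have [b b0 hb] := dbump_bounded.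
exists (2 * (c * b) + c); first by rewrite addr_ge0 ?mulr_ge0 ?(ltW b0).
move=> k x; rewrite derive1_trunc//; apply: le_trans (ler_normD _ _) _.
rewrite mulrDl lerD//; last first.
  rewrite normrM -[leRHS]mul1r ler_pM//.
  by rewrite ger0_norm ?bump_ge0 ?bump_le1.
have [->|d0] := eqVneq (dbump k x) 0.
  by rewrite mulr0 normr0 !mulr_ge0 ?(ltW b0)// addr_ge0.
have xk := dbump_support d0.
rewrite normrM; apply: le_trans (ler_pM _ _ (hp x) (hb k x)) _ => //.
have -> : c * (1 + x ^+ 2) * (b * k.+1%:R^-1) = c * b * ((1 + x ^+ 2) * k.+1%:R^-1) by ring.
have -> : 2 * (c * b) * (1 + `|x|) = c * b * (2 * (1 + `|x|)) by ring.
rewrite ler_wpM2l ?mulr_ge0 ?(ltW b0)// ler_pdivrMr ?ltr0n//.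
have k1 : 1 <= k.+1%:R :> R by rewrite ler1n.
have -> : x ^+ 2 = `|x| ^+ 2 by rewrite real_normK ?num_real.
have := normr_ge0 x; move: xk; set a := `|x|; set q := k.+1%:R : R in k1 *.
by move=> h1 h2; nra.
Qed.

End CutOff.

(** * The equation tested with quadratically growing functions *)

Section Flow.
Variables (R : realType) (n : nat) (m p : 'I_n -> R) (E : R) (W : R -> 'M[R]_n).
Variable mu : R -> 'I_n -> {finite_measure set R -> \bar R}.
Hypotheses (m0 : forall i, 0 < m i) (p0 : forall i, 0 < p i).
Hypotheses (aW : admissible W) (acmu : AC2loc m p E mu).
Hypothesis dmu : distributional_solution m W mu.
Local Notation nu := (ext mu).
Local Notation leb := (@lebesgue_measure R).
Implicit Types (psi dpsi : R -> R).

Definition fkern dpsi i j : R * R -> R := fun z => dpsi z.1 * force W i j (z.1 - z.2).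

(** For [dpsi = psi'], the time derivative of the integral of [psi] against the [i]-th component, as
    the equation predicts it. *)
Definition drift dpsi i t : R :=
  - m i * \sum_(j < n) \int[nu t i]_x \int[nu t j]_y fkern dpsi i j (x, y).

Let mom t i : finite_moment2 (nu t i). Proof. exact: ext_moment acmu t i. Qed.

Lemma measurable_force i j : measurable_fun setT (fun z : R * R => force W i j (z.1 - z.2)).
Proof.
apply: measurableT_comp.
  by apply: continuous_measurable_fun; exact: force_continuous.
by apply: measurable_funB; [exact: measurable_fst|exact: measurable_snd].
Qed.

Lemma measurable_fkern dpsi i j : measurable_fun setT dpsi ->
  measurable_fun setT (fkern dpsi i j).
Proof.
move=> md; apply: measurable_funM; last exact: measurable_force.
by apply: measurableT_comp => //; exact: measurable_fst.
Qed.

(** The constant [L] does not depend on [dpsi]: all truncations of a test function are then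
    dominated together. *)
Lemma fkern_bigO2 : exists2 L, 0 <= L & forall dpsi c i j,
  (forall x, `|dpsi x| <= c * (1 + `|x|)) -> bigO2 (fkern dpsi i j) (c * L).
Proof.
have [L L0 hL] := force_linear_growth aW.
exists (4 * L); first by rewrite mulr_ge0.
move=> dpsi c i j hd x y; rewrite /fkern /= normrM.
have c0 : 0 <= c.
  by have := hd 0; rewrite normr0 addr0 mulr1; exact: le_trans.
have -> : c * (4 * L) * ((1 + x ^+ 2) * (1 + y ^+ 2)) =
  c * L * (4 * ((1 + x ^+ 2) * (1 + y ^+ 2))) by ring.
apply: (@le_trans _ _ (c * (1 + `|x|) * (L * (1 + (`|x| + `|y|))))).
  rewrite ler_pM//; apply: le_trans (hL _ _ _) _.
  by rewrite ler_wpM2l// lerD2l ler_normB.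
have -> : c * (1 + `|x|) * (L * (1 + (`|x| + `|y|))) =
  c * L * ((1 + `|x|) * (1 + (`|x| + `|y|))) by ring.
rewrite ler_wpM2l ?mulr_ge0//.
have -> : x ^+ 2 = `|x| ^+ 2 by rewrite real_normK ?num_real.
have -> : y ^+ 2 = `|y| ^+ 2 by rewrite real_normK ?num_real.
have := normr_ge0 x; have := normr_ge0 y; set a := `|x|; set b := `|y| => b0 a0.
apply: (@le_trans _ _ ((1 + a) ^+ 2 * (1 + b))).
  by rewrite expr2 -mulrA ler_wpM2l ?addr_ge0//; nra.
have -> : 4 * ((1 + a ^+ 2) * (1 + b ^+ 2)) = 2 * (1 + a ^+ 2) * (2 * (1 + b ^+ 2)) by ring.
have := sqr_ge0 (a - 1); have := sqr_ge0 (b - 1) => h1 h2.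
by rewrite ler_pM ?sqr_ge0 ?addr_ge0//; nra.
Qed.

(** Two applications of [measurable_Rintegral]: the inner integral has time and position as
    parameter, the outer one time alone. *)
Lemma drift_measurable dpsi i : measurable_fun setT dpsi ->
  measurable_fun setT (drift dpsi i).
Proof.
move=> md; apply: measurable_funM; first exact: measurable_cst.
apply: measurable_sum => j.
have mext := ext_measurable m0 p0 acmu.
have ub k t : (nu t k setT < (p k + 1)%:E)%E.
  by rewrite (ext_mass acmu) lte_fin ltrDl.
have mext1 U : measurable U ->
    measurable_fun setT (fun z : measurableTypeR R * R => nu z.1 j U).
  by move=> mU; apply: (measurableT_comp (mext j U mU)); exact: measurable_fst.
have mK : measurable_fun setT (fun w : (measurableTypeR R * R) * R => fkern dpsi i j (w.1.2, w.2)).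
  apply: measurableT_comp; first exact: measurable_fkern.
  apply/measurable_fun_pairP; split => /=.
    exact: (measurableT_comp measurable_snd measurable_fst).
  exact: measurable_snd.
have m1 := measurable_Rintegral mext1 (fun z => ub j z.1) mK.
exact: (measurable_Rintegral (mext i) (ub i) m1).
Qed.

(** The bound is linear in [c], and [N] is the same for all [dpsi], so it serves for the whole
    sequence of truncations. *)
Lemma drift_bounded T : exists2 N, 0 <= N & forall dpsi c i t,
  measurable_fun setT dpsi -> (forall x, `|dpsi x| <= c * (1 + `|x|)) ->
  0 <= t <= T -> `|drift dpsi i t| <= c * N.
Proof.
have [L L0 hL] := fkern_bigO2.
have T1 : 0 < `|T| + 1 by rewrite ltr_wpDl.
have [X X0 hX] := moment2_bounded m0 p0 acmu T1.
pose P := \sum_i (p i + X).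
have pP i : p i + X <= P.
  rewrite /P (bigD1 i)//= lerDl sumr_ge0// => j _; rewrite addr_ge0// ltW//.
have P0 : 0 <= P by rewrite sumr_ge0// => j _; rewrite addr_ge0// ltW.
have NE i t : 0 <= t <= T -> 0 <= \int[nu t i]_x (1 + x ^+ 2) <= P.
  move=> /andP[t0 tT]; apply/andP; split.
    by apply: Rintegral_ge0 => x _; rewrite addr_ge0// sqr_ge0.
  rewrite RintegralD//; [|exact: Rintegrable_cst|exact: integrable_sqr].
  rewrite Rintegral_cst//= (ext_mass acmu) /= mul1r; apply: le_trans (pP i).
  rewrite lerD2l /ext max_r//; apply: hX => //.
  by apply: le_trans tT _; apply: le_trans (ler_norm _) _; rewrite lerDl.
pose M := \sum_i m i.
have mM i : `|m i| <= M.
  by rewrite gtr0_norm// /M (bigD1 i)//= lerDl sumr_ge0// => j _; exact: ltW.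
exists (M * (n%:R * (L * (P * P)))).
  by rewrite !mulr_ge0// sumr_ge0// => i _; exact: ltW.
move=> dpsi c i t md hd tT.
have c0 : 0 <= c.
  by have := hd 0; rewrite normr0 addr0 mulr1; exact: le_trans.
rewrite /drift normrM normrN.
have -> : c * (M * (n%:R * (L * (P * P)))) = M * (n%:R * (c * L * (P * P))) by ring.
rewrite ler_pM//; apply: le_trans (ler_norm_sum _ _ _) _.
apply: (@le_trans _ _ (\sum_(j < n) c * L * (P * P))); last first.
  by rewrite sumr_const card_ord mulr_natl.
apply: ler_sum => j _.
apply: le_trans (double_integral_le (mom t i) (mom t j) (measurable_fkern i j md) (hL _ _ _ _ hd)) _.
rewrite ler_wpM2l ?mulr_ge0//.
have /andP[a0 aP] := NE i t tT; have /andP[b0 bP] := NE j t tT.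
exact: ler_pM.
Qed.

(** Testing the equation with [f(t) psi(x)] identifies the drift as the distributional time
    derivative of the integral of [psi]. *)
Lemma flow_compact psi a b i s t : smooth psi ->
  (forall x, psi x != 0 -> a <= x <= b) -> 0 <= s -> s <= t ->
  \int[nu t i]_x psi x - \int[nu s i]_x psi x =
    \int[leb]_(r in `[s, t]) drift (derive1 psi) i r.
Proof.
move=> sp pab s0 st; have [Lam Lam0 [lpsi dpsi]] := smooth_lipschitz sp pab.
have mpsi : measurable_fun setT psi by exact: lipschitz_measurable lpsi.
have cdpsi : continuous (derive1 psi) by exact/smooth_continuous/smooth_derive1.
have mdpsi := continuous_measurable_fun cdpsi.
have dpsi1 x : `|derive1 psi x| <= Lam * (1 + `|x|).
  by apply: le_trans (dpsi x) _; rewrite ler_peMr// lerDl.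
have cG := ext_continuous m0 p0 acmu (i := i) Lam0 lpsi.
have bH T : exists B, forall r, 0 <= r <= T -> `|drift (derive1 psi) i r| <= B.
  by have [N _ hN] := drift_bounded T; exists (Lam * N) => r rT; exact: hN.
apply: (weak_derivative_integral cG (drift_measurable i mdpsi) bH _ s0 st).
move=> f c d sf c0 fcd.
apply: etrans (dmu i (test_function_tensor sf sp c0 fcd pab)).
apply: eq_Rintegral => r; rewrite inE /= in_itv /= andbT => r0.
have muE k : mu r k = nu r k by rewrite /ext max_r// ltW.
have ipsi : (nu r i).-integrable setT (EFin \o psi).
  exact: (lipschitz_integrable (mom r i) Lam0 lpsi).
have [L L0 hL] := fkern_bigO2.
have ij j := integrable_int_slice (mom r i) (mom r j) (measurable_fkern i j mdpsi)
  (hL _ _ i j dpsi1).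
have [L' L'0 hL'] := force_linear_growth aW.
have slice j x : \int[nu r j]_y fkern (derive1 psi) i j (x, y) =
    derive1 psi x * \int[nu r j]_y force W i j (x - y).
  rewrite -RintegralZl//; apply: (@integrable_quad _ _ _ (L' * (2 + `|x|))) => //.
    apply: measurableT_comp.
      by apply: continuous_measurable_fun; exact: force_continuous.
    by apply: measurable_funB; [exact: measurable_cst|exact: measurable_id].
  move=> y; apply: le_trans (hL' _ _ _) _; rewrite -mulrA ler_wpM2l//.
  apply: (@le_trans _ _ (1 + (`|x| + `|y|))); first by rewrite lerD2l ler_normB.
  by have := le_sqr1 y; have := sqr_ge0 y; have := normr_ge0 x; nra.
under [RHS]eq_Rintegral => x _.
  rewrite partial_t_tensor// partial_x_tensor// /tensor /=.
  have -> : derive1 f r * psi x - m i * (f r * derive1 psi x) *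
      (\sum_(j < n) \int[mu r j]_y derive1 (fun z => W z i j) (x - y)) =
    derive1 f r * psi x +
    (- m i * f r) * (\sum_(j < n) \int[nu r j]_y fkern (derive1 psi) i j (x, y)).
    under [X in _ = _ + _ * X]eq_bigr do rewrite slice.
    under [X in _ - _ * X]eq_bigr do rewrite muE.
    by rewrite -mulr_sumr /force; ring.
  over.
rewrite muE RintegralD//; last 2 first.
- exact: RintegrableZ.
- by apply: RintegrableZ => //; exact: Rintegrable_sum.
rewrite !RintegralZl//; last exact: Rintegrable_sum.
by rewrite Rintegral_sum// /drift; ring.
Qed.

(** Limit of [flow_compact] along the truncations of [psi]: the integrals converge by domination
    with [c (1 + x^2)], the drifts converge pointwise in time and stay bounded on [[s, t]]. *)
Lemma flow_growth psi c i s t : 0 <= c -> smooth psi ->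
  (forall x, `|psi x| <= c * (1 + x ^+ 2)) ->
  (forall x, `|derive1 psi x| <= c * (1 + `|x|)) -> 0 <= s -> s <= t ->
  \int[nu t i]_x psi x - \int[nu s i]_x psi x =
    \int[leb]_(r in `[s, t]) drift (derive1 psi) i r.
Proof.
move=> c0 sp hp hdp s0 st; have [c' c'0 hc'] := derive1_trunc_le c0 sp hp hdp.
have msm f : smooth f -> measurable_fun setT f.
  by move=> /smooth_continuous; exact: continuous_measurable_fun.
have cvG r : (fun k => \int[nu r i]_x trunc psi k x) @ \oo --> \int[nu r i]_x psi x.
  apply: (Rdominated_cvg measurableT (f_ := trunc psi) (f := psi) (g := fun x => c * (1 + x ^+ 2))) => //.
  - by move=> k; apply: msm; exact: smooth_trunc.
  - by move=> x _; exact: trunc_cvg.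
  - apply: RintegrableZ => //; apply: RintegrableD => //; first exact: Rintegrable_cst.
    exact: integrable_sqr.
  - by move=> k x _; exact: trunc_le.
have [L L0 hL] := fkern_bigO2.
have cvH r : (fun k => drift (derive1 (trunc psi k)) i r) @ \oo --> drift (derive1 psi) i r.
  apply: cvgM; first exact: cvg_cst.
  apply: cvg_big => [|j _]; first exact: add_continuous.
  apply: (double_integral_cvg (mom r i) (mom r j) (K := fkern (derive1 psi) i j)
    (K_ := fun k => fkern (derive1 (trunc psi k)) i j) (c := c' * L)).
  - by move=> k; apply: measurable_fkern; apply: msm; exact/smooth_derive1/smooth_trunc.
  - by move=> k; apply: hL; exact: hc'.
  - by move=> z; apply: cvgMl; exact: derive1_trunc_cvg.
have [N N0 hN] := drift_bounded t.
have ms : measurable (`[s, t] : set (measurableTypeR R)) by exact: measurable_itv.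
have cvI : (fun k => \int[leb]_(r in `[s, t]) drift (derive1 (trunc psi k)) i r) @ \oo -->
    \int[leb]_(r in `[s, t]) drift (derive1 psi) i r.
  apply: (Rdominated_cvg ms (g := fun=> c' * N)).
  - move=> k; apply: (@measurable_funS _ _ (measurableTypeR R) _ setT) => //.
    by apply: drift_measurable; apply: msm; exact/smooth_derive1/smooth_trunc.
  - by move=> r _; exact: cvH.
  - exact: integrable_itv_cst.
  - move=> k r; rewrite /= in_itv /= => /andP[sr rt]; apply: hN.
    + by apply: msm; exact/smooth_derive1/smooth_trunc.
    + exact: hc'.
    + by rewrite rt (le_trans s0).
apply: (cvg_seq_unique (cvgB (cvG t) (cvG s))).
rewrite (_ : _ - _ = fun k => \int[leb]_(r in `[s, t]) drift (derive1 (trunc psi k)) i r) //.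
apply/funext => k /=.
by rewrite -(flow_compact i (smooth_trunc k sp) (@trunc_support _ psi k) s0 st).
Qed.

End Flow.

(** * Comparison principles in integrated form *)

Section IntegralInequalities.
Variable R : realType.
Local Notation leb := (@lebesgue_measure R).
Variables f P : R -> R.
Hypothesis mP : measurable_fun setT P.
Hypothesis bP : forall T, exists B, forall r, 0 <= r <= T -> `|P r| <= B.
Hypothesis fP : forall s t, 0 <= s -> s <= t ->
  f t - f s = \int[leb]_(r in `[s, t]) P r.

Lemma increment_le s t b : 0 <= s -> s <= t -> (forall r, s <= r <= t -> P r <= b) ->
  f t - f s <= b * (t - s).
Proof.
move=> s0 st Pb; have [B hB] := bP t.
have ms : measurable (`[s, t] : set (measurableTypeR R)) by exact: measurable_itv.
rewrite fP// -Rintegral_itv_cst//; apply: (le_Rintegral ms).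
- apply: (bounded_integrable (B := B)) => // r /andP[sr rt].
  by apply: hB; rewrite rt (le_trans s0).
- exact: integrable_itv_cst.
- by move=> r; rewrite /= in_itv /=; exact: Pb.
Qed.

(** Let [S] collect the times up to [t] with [f <= c]. From a point of [S] within [d] of [sup S],
    the growth of [f] until [sup S + d] is at most [2 d B]; afterwards [f > c] and [f] cannot
    increase. *)
Lemma barrier c : (forall r, 0 <= r -> c < f r -> P r <= 0) -> f 0 <= c ->
  forall t, 0 <= t -> f t <= c.
Proof.
move=> Pneg f0 t t0; apply/ler_addgt0Pr => e e0.
have [B hB] := bP t.
have B0 : 0 <= B by apply: le_trans (hB 0 _) => //; rewrite lexx.
pose S := [set s | 0 <= s <= t /\ f s <= c].
have S0 : S 0 by split => //; rewrite lexx.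
have hS : has_sup S.
  by split; [exists 0|exists t => s [/andP[_ st] _]].
pose d := e / (2 * (B + 1)).
have d0 : 0 < d by rewrite divr_gt0// mulr_gt0// ltr_wpDl.
have [s [/andP[s0 st] fs] sd] := sup_adherent d0 hS.
have s_sup : s <= sup S by apply: sup_upper_bound => //; split => //; rewrite s0.
have sup_t : sup S <= t by apply: sup_le_ub; [exists 0|move=> r [/andP[_ rt] _]].
pose s' := Num.min (sup S + d) t.
have ss' : s <= s' by rewrite le_min st andbT (le_trans s_sup)// lerDl ltW.
have s't : s' <= t by rewrite ge_min lexx orbT.
have s'd : s' <= sup S + d by rewrite ge_min lexx.
have step1 : f s' - f s <= B * (s' - s).
  apply: increment_le => // r /andP[sr rs']; apply: le_trans (ler_norm _) _.
  by apply: hB; rewrite (le_trans s0 sr) (le_trans rs' s't).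
have step2 : f t - f s' <= 0 * (t - s').
  have [->|s'Nt] := eqVneq s' t; first by rewrite !subrr mulr0.
  apply: increment_le => //; first exact: le_trans ss'.
  have s'E : s' = sup S + d.
    by move: s'Nt; rewrite /s'; case: ltP => // _; rewrite eqxx.
  move=> r /andP[s'r rt]; have r0 : 0 <= r by exact: le_trans (le_trans s0 ss') s'r.
  apply: Pneg => //; rewrite ltNge; apply/negP => fr.
  have : r <= sup S by apply: sup_upper_bound => //; split => //; rewrite r0.
  by apply/negP; rewrite -ltNge (lt_le_trans _ s'r)// s'E ltrDl.
have : B * (s' - s) <= (B + 1) * (2 * d).
  by rewrite ler_pM ?subr_ge0 ?lerDl//; lra.
have -> : (B + 1) * (2 * d) = e by rewrite /d; field; rewrite gt_eqF// ltr_wpDl.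
by move: step1 step2; rewrite mul0r; lra.
Qed.

(** Within a time [tau = 1 / (2 (C + 1))] after a zero of [f], integrating [P <= C f] halves any
    bound of [f]. Iterating forces [f = 0] there, and finitely many such intervals reach [t]. *)
Lemma gronwall_zero C : 0 <= C -> (forall r, 0 <= r -> P r <= C * f r) ->
  (forall r, 0 <= r -> 0 <= f r) -> f 0 = 0 ->
  (forall T, exists B, forall r, 0 <= r <= T -> f r <= B) ->
  forall t, 0 <= t -> f t = 0.
Proof.
move=> C0 PC fge f0 fb.
have C1 : 0 < C + 1 by rewrite ltr_wpDl.
pose tau := (2 * (C + 1))^-1.
have tau0 : 0 < tau by rewrite invr_gt0 mulr_gt0.
have Ctau : C * tau <= 2^-1.
  by rewrite /tau invfM mulrCA ler_piMr// ler_pdivrMr// mul1r lerDl.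
have main k : forall r, 0 <= r <= k%:R * tau -> f r = 0.
  elim: k => [|k IH] r.
    by rewrite mul0r -eq_le eq_sym => /eqP ->.
  move=> /andP[r0 rk]; set s := k%:R * tau.
  have s0 : 0 <= s by rewrite mulr_ge0// ltW.
  have fs : f s = 0 by apply: IH; rewrite s0 lexx.
  have [rs|sr] := leP r s; first by apply: IH; rewrite r0.
  have [B hB] := fb r.
  have B0 : 0 <= B by apply: le_trans (fge 0 _) (hB 0 _) => //; rewrite lexx.
  have halves q : forall x, s <= x <= r -> f x <= B * 2^-1 ^+ q.
    elim: q => [|q IHq] x /andP[sx xr].
      by rewrite expr0 mulr1; apply: hB; rewrite xr (le_trans s0).
    have : f x - f s <= C * (B * 2^-1 ^+ q) * (x - s).
      apply: increment_le => // y /andP[sy yx].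
      apply: le_trans (PC y (le_trans s0 sy)) _; rewrite ler_wpM2l//.
      by apply: IHq; rewrite sy (le_trans yx).
    rewrite fs subr0 => /le_trans; apply.
    have xs : x - s <= tau.
      by rewrite lerBlDl (le_trans xr)// (le_trans rk)// -natr1 mulrDl mul1r.
    have hq : 0 <= B * 2^-1 ^+ q by rewrite mulr_ge0 ?exprn_ge0 ?invr_ge0.
    apply: (@le_trans _ _ (C * (B * 2^-1 ^+ q) * tau)).
      by rewrite ler_wpM2l// mulr_ge0.
    rewrite exprSr; move: hq; set X := 2^-1 ^+ q => hq.
    have -> : C * (B * X) * tau = C * tau * (B * X) by ring.
    have -> : B * (X * 2^-1) = 2^-1 * (B * X) by ring.
    by rewrite ler_wpM2r.
  apply/eqP; rewrite eq_le fge// andbT.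
  have lim : (fun q => B * 2^-1 ^+ q) @ \oo --> B * 0.
    apply: cvgMr; apply: cvg_expr.
    by rewrite ger0_norm ?invr_ge0// invf_lt1// ltr1n.
  rewrite mulr0 in lim.
  apply: (cvgr_to_ge lim); apply: nearW => q.
  by apply: halves; rewrite lexx andbT ltW.
move=> t t0.
have [k hk] : exists k : nat, t <= k%:R * tau.
  exists (Num.bound (t / tau)); rewrite -ler_pdivrMr// ltW//.
  by apply: archi_boundP; rewrite divr_ge0// ltW.
by apply: (main k); rewrite t0.
Qed.

End IntegralInequalities.

(** * Dissipation of the second moment *)

Section PolynomialIntegrals.
Variable R : realType.
Local Notation fmeas := {finite_measure set R -> \bar R}.
Implicit Types (mu nu : fmeas) (K : R * R -> R) (p q a b c : R).

Lemma integrable_id mu : finite_moment2 mu -> mu.-integrable setT (EFin \o (fun x : R => x)).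
Proof.
move=> h; apply: (@integrable_quad _ _ _ 1) => // x.
by rewrite mul1r; exact: le_sqr1.
Qed.

Lemma poly_integral mu p a b c : mu setT = p%:E -> finite_moment2 mu ->
  \int[mu]_x (a + b * x + c * x ^+ 2) =
    a * p + b * \int[mu]_x x + c * \int[mu]_x (x ^+ 2).
Proof.
move=> mup h; have i1 := integrable_id h; have i2 := integrable_sqr h.
have i0 : mu.-integrable setT (EFin \o (fun=> a)) by exact: Rintegrable_cst.
have i1b : mu.-integrable setT (EFin \o (fun x : R => b * x)) by exact: RintegrableZ.
have i2c : mu.-integrable setT (EFin \o (fun x : R => c * x ^+ 2)) by exact: RintegrableZ.
rewrite RintegralD//; last exact: RintegrableD.
by rewrite RintegralD// !RintegralZl// Rintegral_cst//= mup.
Qed.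

Lemma poly_double_integral mu nu p q a b c : mu setT = p%:E -> nu setT = q%:E ->
  finite_moment2 mu -> finite_moment2 nu ->
  \int[mu]_x \int[nu]_y (a * (x ^+ 2 + y ^+ 2) + b * (x * y) + c) =
    a * (q * \int[mu]_x (x ^+ 2) + p * \int[nu]_x (x ^+ 2))
    + b * (\int[mu]_x x * \int[nu]_x x) + c * (p * q).
Proof.
move=> mup nuq h1 h2.
set Y1 := \int[nu]_x x; set Y2 := \int[nu]_x (x ^+ 2).
have inner x : \int[nu]_y (a * (x ^+ 2 + y ^+ 2) + b * (x * y) + c) =
    (c * q + a * Y2) + b * Y1 * x + a * q * x ^+ 2.
  rewrite (@eq_Rintegral _ _ _ _ _ (fun y => (a * x ^+ 2 + c) + (b * x) * y + a * y ^+ 2)).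
    by rewrite (poly_integral _ _ _ nuq h2) -/Y1 -/Y2; ring.
  by move=> y _; ring.
under eq_Rintegral do rewrite inner.
by rewrite (poly_integral _ _ _ mup h1); ring.
Qed.

Lemma double_integral_mono mu nu K1 K2 c1 c2 : finite_moment2 mu -> finite_moment2 nu ->
  measurable_fun setT K1 -> measurable_fun setT K2 -> bigO2 K1 c1 -> bigO2 K2 c2 ->
  (forall x y, K1 (x, y) <= K2 (x, y)) ->
  \int[mu]_x \int[nu]_y K1 (x, y) <= \int[mu]_x \int[nu]_y K2 (x, y).
Proof.
move=> h1 h2 m1 m2 b1 b2 K12; apply: le_Rintegral => //.
- exact: (integrable_int_slice h1 h2 m1 b1).
- exact: (integrable_int_slice h1 h2 m2 b2).
- move=> x _; apply: le_Rintegral => //.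
  + exact: (integrable_slice x h2 m1 b1).
  + exact: (integrable_slice x h2 m2 b2).
Qed.

Lemma double_integralD mu nu K1 K2 c1 c2 : finite_moment2 mu -> finite_moment2 nu ->
  measurable_fun setT K1 -> measurable_fun setT K2 -> bigO2 K1 c1 -> bigO2 K2 c2 ->
  \int[mu]_x \int[nu]_y (K1 (x, y) + K2 (x, y)) =
  \int[mu]_x \int[nu]_y K1 (x, y) + \int[mu]_x \int[nu]_y K2 (x, y).
Proof.
move=> h1 h2 m1 m2 b1 b2.
rewrite -RintegralD//.
- apply: eq_Rintegral => x _; rewrite RintegralD//.
  + exact: (integrable_slice x h2 m1 b1).
  + exact: (integrable_slice x h2 m2 b2).
- exact: (integrable_int_slice h1 h2 m1 b1).
- exact: (integrable_int_slice h1 h2 m2 b2).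
Qed.

Lemma poly_bigO2 a b c :
  bigO2 (fun z => a * (z.1 ^+ 2 + z.2 ^+ 2) + b * (z.1 * z.2) + c) (`|a| + `|b| + `|c|).
Proof.
move=> x y /=.
have A1 : 1 <= (1 + x ^+ 2) * (1 + y ^+ 2).
  by have := sqr_ge0 x; have := sqr_ge0 y; nra.
set A := _ * _ in A1 *.
have A2 : `|x ^+ 2 + y ^+ 2| <= A.
  rewrite ger0_norm ?addr_ge0 ?sqr_ge0// /A.
  by have := sqr_ge0 x; have := sqr_ge0 y; nra.
have A3 : `|x * y| <= A.
  by rewrite normrM /A ler_pM//; exact: le_sqr1.
apply: le_trans (ler_normD _ _) _; rewrite !mulrDl.
apply: lerD; last by rewrite ler_peMr.
apply: le_trans (ler_normD _ _) _; rewrite !normrM.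
by apply: lerD; rewrite ler_wpM2l// -normrM.
Qed.

Lemma measurable_poly a b c : measurable_fun setT
  (fun z : R * R => a * (z.1 ^+ 2 + z.2 ^+ 2) + b * (z.1 * z.2) + c).
Proof.
have m1 : measurable_fun setT (fun z : R * R => z.1) by exact: measurable_fst.
have m2 : measurable_fun setT (fun z : R * R => z.2) by exact: measurable_snd.
apply: measurable_funD => //; apply: measurable_funD.
  by apply: measurable_funM => //; apply: measurable_funD; exact: measurable_funX.
by apply: measurable_funM => //; exact: measurable_funM.
Qed.

End PolynomialIntegrals.

Section Dissipation.
Variables (R : realType) (n : nat) (m p : 'I_n -> R) (E : R) (W : R -> 'M[R]_n).
Hypotheses (m0 : forall i, 0 < m i) (p0 : forall i, 0 < p i) (aW : admissible W).
Variables (s : 'I_n -> 'I_n -> R) (eta : 'I_n -> R) (lam D L : R).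
Hypotheses (lam0 : 0 < lam) (D0 : 0 <= D) (L0 : 0 <= L).
Hypothesis lower : forall i j z,
  s i j * z - D - L * Num.max 0 (- z) <= force W i j z.
Hypothesis ssym : forall i j, s i j = s j i.
Hypothesis hlam : forall i, lam <= m i * \sum_(j < n) p j * s i j.
Hypothesis halg : forall a : 'I_n -> R,
  \sum_(i < n) \sum_(j < n) s i j * (a i * a j) <=
      (\sum_(j < n) (m j)^-1 * a j) * \sum_(i < n) eta i * a i.
Local Notation fmeas := {finite_measure set R -> \bar R}.
Implicit Types (la : 'I_n -> fmeas) (dpsi : R -> R) (B : R).

(** Attached to a single state [la] instead of a curve, so that the dissipation estimates are
    inequalities on [scrP]. At [la = ext mu t] it is the sum of the drifts with weights [1/m_i]. *)
Definition rate la dpsi : R := \sum_(i < n) (m i)^-1 *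
  (- m i * \sum_(j < n) \int[la i]_x \int[la j]_y fkern W dpsi i j (x, y)).

Definition moment2_sum la : R := \sum_(i < n) (m i)^-1 * \int[la i]_x (x ^+ 2).

Lemma rateE la dpsi : rate la dpsi =
  - \sum_(i < n) \sum_(j < n) \int[la i]_x \int[la j]_y fkern W dpsi i j (x, y).
Proof.
rewrite /rate -sumrN; apply: eq_bigr => i _.
by rewrite mulNr mulrN mulrA mulVf ?mul1r// gt_eqF.
Qed.

(** Since [z * force z] is even, it suffices to take [z >= 0], where the term [max 0 (- z)] of
    [lower] vanishes. *)
Lemma force_mul_lower i j z : s i j * z ^+ 2 - D * `|z| <= z * force W i j z.
Proof.
have pos w : 0 <= w -> s i j * w ^+ 2 - D * w <= w * force W i j w.
  move=> w0; have := lower i j w; rewrite max_l ?oppr_le0// mulr0 subr0 => h.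
  have -> : s i j * w ^+ 2 - D * w = w * (s i j * w - D) by ring.
  by rewrite ler_wpM2l.
have [z0|z0] := leP 0 z; first by rewrite ger0_norm//; exact: pos.
rewrite ltr0_norm//; have := pos (- z); rewrite oppr_ge0 => /(_ (ltW z0)).
by rewrite (force_odd _ _ _ aW) sqrrN mulrNN.
Qed.

Let lin (x : R) : `|2 * x| <= 2 * (1 + `|x|).
Proof. by rewrite normrM ger0_norm// ler_wpM2l// lerDr. Qed.

Let mlin : measurable_fun setT (fun x : R => 2 * x).
Proof. exact: measurable_funM. Qed.

(** Average over the exchange of [(i, x)] and [(j, y)]: the force is odd and symmetric in the
    indices, so [2 x] is replaced by [2 (x - y)]. *)
Lemma rate_sqr_sym la : (forall i, finite_moment2 (la i)) ->
  2 * rate la (fun x => 2 * x) = - \sum_(i < n) \sum_(j < n)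
    \int[la i]_x \int[la j]_y (2 * ((x - y) * force W i j (x - y))).
Proof.
move=> h; rewrite rateE mulrN; congr (- _).
have [L' L'0 hL'] := fkern_bigO2 aW.
have bK i j := hL' (fun x => 2 * x) 2 i j lin.
have mK i j := measurable_fkern aW i j mlin.
rewrite mulr_natl mulr2n [X in _ + X]exchange_big /= -big_split /=.
apply: eq_bigr => i _; rewrite -big_split /=; apply: eq_bigr => j _.
rewrite [X in _ + X](Rfubini (h j) (h i) (mK j i) (bK j i)).
pose K' z : R := fkern W (fun x => 2 * x) j i (z.2, z.1).
have mK' : measurable_fun setT K'.
  by apply: measurableT_comp; [exact: mK|exact: measurable_swap].
have bK' : bigO2 K' (2 * L') by move=> x y; rewrite [X in _ * X]mulrC; exact: bK.
rewrite -(double_integralD (h i) (h j) (mK i j) mK' (bK i j) bK').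
apply: eq_Rintegral => x _; apply: eq_Rintegral => y _.
rewrite /K' /fkern /= (force_sym j i aW) -[y - x]opprB (force_odd _ _ _ aW).
by ring.
Qed.

Let bigO2_zF : exists c, forall i j,
  bigO2 (fun z => 2 * ((z.1 - z.2) * force W i j (z.1 - z.2))) c.
Proof.
have [L' L'0 hL'] := force_linear_growth aW; exists (8 * L') => i j x y /=.
rewrite normrM ger0_norm// normrM.
have -> : 8 * L' * ((1 + x ^+ 2) * (1 + y ^+ 2)) =
  2 * (L' * (4 * ((1 + x ^+ 2) * (1 + y ^+ 2)))) by ring.
rewrite ler_wpM2l//.
apply: (@le_trans _ _ ((1 + (`|x| + `|y|)) * (L' * (1 + (`|x| + `|y|))))).
  have d1 := ler_normB x y.
  rewrite ler_pM//; first by apply: le_trans d1 _; rewrite lerDr.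
  by apply: le_trans (hL' _ _ _) _; rewrite ler_wpM2l// lerD2l.
rewrite mulrCA ler_wpM2l//.
have -> : x ^+ 2 = `|x| ^+ 2 by rewrite real_normK ?num_real.
have -> : y ^+ 2 = `|y| ^+ 2 by rewrite real_normK ?num_real.
have := normr_ge0 x; have := normr_ge0 y; set a := `|x|; set b := `|y| => b0 a0.
have ab0 : 0 <= a * b by rewrite mulr_ge0.
apply: (@le_trans _ _ ((1 + a) ^+ 2 * (1 + b) ^+ 2)).
  by rewrite -exprMn -expr2 ler_pXn2r ?nnegrE ?addr_ge0 ?mulr_ge0 ?addr_ge0//; nra.
have -> : 4 * ((1 + a ^+ 2) * (1 + b ^+ 2)) = 2 * (1 + a ^+ 2) * (2 * (1 + b ^+ 2)) by ring.
have := sqr_ge0 (a - 1); have := sqr_ge0 (b - 1) => h1 h2.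
by rewrite ler_pM ?sqr_ge0//; nra.
Qed.

Let measurable_zF i j : measurable_fun setT
  (fun z : R * R => 2 * ((z.1 - z.2) * force W i j (z.1 - z.2))).
Proof.
apply: measurable_funM; first exact: measurable_cst.
apply: measurable_funM; last exact: measurable_force.
by apply: measurable_funB; [exact: measurable_fst|exact: measurable_snd].
Qed.

(** Integrate [|x| <= 1 / (4 e) + e x^2]. *)
Lemma mean_le (mu : fmeas) q e : mu setT = q%:E -> finite_moment2 mu -> 0 < e ->
  `|\int[mu]_x x| <= q / (4 * e) + e * \int[mu]_x (x ^+ 2).
Proof.
move=> muq h e0.
apply: (le_trans (le_normr_Rintegral _ _)) => //; first exact: integrable_id.
have <- : \int[mu]_x ((4 * e)^-1 + 0 * x + e * x ^+ 2) = q / (4 * e) + e * \int[mu]_x (x ^+ 2).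
  by rewrite (poly_integral _ _ _ muq h) mul0r addr0 mulrC.
apply: le_Rintegral => //.
- by apply: integrable_norm; exact: integrable_id.
- apply: RintegrableD => //.
    by apply: RintegrableD => //; [exact: Rintegrable_cst|apply: RintegrableZ => //; exact: integrable_id].
  by apply: RintegrableZ => //; exact: integrable_sqr.
- move=> x _; rewrite mul0r addr0.
  have -> : (4 * e)^-1 + e * x ^+ 2 = (1 + 4 * e ^+ 2 * x ^+ 2) / (4 * e).
    by field; rewrite gt_eqF.
  rewrite ler_pdivlMr ?mulr_gt0//.
  have -> : x ^+ 2 = `|x| ^+ 2 by rewrite real_normK ?num_real.
  by have := sqr_ge0 (2 * e * `|x| - 1); nra.
Qed.

(* The quadratic part of the dissipation is coercive by [hlam] and [halg]; all
   other terms are absorbed by AM-GM with the small parameter [e]. *)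
Lemma moment2_dissipation : exists C, forall la, scrP m p E la ->
  rate la (fun x => 2 * x) <= C - lam * moment2_sum la.
Proof.
pose pb := \sum_j p j.
have pb0 : 0 <= pb by rewrite sumr_ge0// => j _; exact: ltW.
(* [e * q i] is the total coefficient of [X i] in the error terms: [4 e pb] from the pair terms and
   [2 e |E eta i|] from the linear form in the means. *)
pose q i := 4 * pb + 2 * `|E * eta i|.
have q0 i : 0 <= q i by rewrite addr_ge0 ?mulr_ge0.
pose Q := 1 + \sum_i m i * q i.
have Q0 : 0 < Q by rewrite ltr_wpDr// sumr_ge0// => i _; rewrite mulr_ge0// ltW.
have [e e0 eq] : exists2 e, 0 < e & forall i, e * q i <= lam * (m i)^-1.
  exists (lam / Q); first by rewrite divr_gt0.
  move=> i; rewrite ler_pdivlMr//.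
  have qQ : m i * q i <= Q.
    rewrite /Q (bigD1 i)//= addrCA lerDl addr_ge0// sumr_ge0// => j _.
    by rewrite mulr_ge0// ltW.
  have -> : lam / Q * q i * m i = lam * (m i * q i) / Q by ring.
  by rewrite ler_pdivrMr// ler_wpM2l// ltW.
pose C := D ^+ 2 / (4 * e) * (pb * pb) + \sum_i 2 * `|E * eta i| * (p i / (4 * e)).
exists C => la [mass mom center].
pose X i := \int[la i]_x (x ^+ 2); pose a i := \int[la i]_x x.
have X0 i : 0 <= X i by apply: Rintegral_ge0 => x _; exact: sqr_ge0.
have ha i : `|a i| <= p i / (4 * e) + e * X i := mean_le (mass i) (mom i) e0.
have [c bzF] := bigO2_zF.
(* The left-hand side integrates [2 s i j (x - y)^2 - 4 e (x^2 + y^2) - D^2 / (2 e)]; the last two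
   terms bound the contribution of [D |x - y|]. *)
have pair i j : (2 * s i j - 4 * e) * (p j * X i + p i * X j) + (- 4 * s i j) * (a i * a j)
    + (- (D ^+ 2 / (2 * e))) * (p i * p j)
    <= \int[la i]_x \int[la j]_y (2 * ((x - y) * force W i j (x - y))).
  rewrite /X /a -(poly_double_integral _ _ _ (mass i) (mass j) (mom i) (mom j)).
  apply: (double_integral_mono (mom i) (mom j) (measurable_poly _ _ _) (measurable_zF i j)
    (@poly_bigO2 _ _ _ _) (bzF i j)) => x y /=.
  have h := force_mul_lower i j (x - y).
  have h2 : 2 * (D * `|x - y|) <= 2 * e * `|x - y| ^+ 2 + D ^+ 2 / (2 * e).
    have -> : 2 * e * `|x - y| ^+ 2 + D ^+ 2 / (2 * e) =
        ((2 * e * `|x - y|) ^+ 2 + D ^+ 2) / (2 * e) by field; rewrite gt_eqF.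
    rewrite ler_pdivlMr ?mulr_gt0//.
    by have := sqr_ge0 (2 * e * `|x - y| - D); nra.
  have h3 : `|x - y| ^+ 2 = (x - y) ^+ 2 by rewrite real_normK ?num_real.
  have h4 : e * (x - y) ^+ 2 <= e * (2 * (x ^+ 2 + y ^+ 2)).
    by rewrite ler_wpM2l ?(ltW e0)//; have := sqr_ge0 (x + y); nra.
  move: h h2 h4; rewrite h3; move: (_ * force _ _ _ _) (D ^+ 2 / _) => zF De.
  by move: (D * _) => DD; lra.
have S1 : \sum_i \sum_j s i j * (p j * X i + p i * X j) =
    2 * \sum_i X i * \sum_j p j * s i j.
  under eq_bigr do under eq_bigr do rewrite mulrDr.
  under eq_bigr do rewrite big_split /=.
  rewrite big_split /= [X in _ + X]exchange_big /= mulr_natl mulr2n.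
  by congr (_ + _); apply: eq_bigr => i _; rewrite mulr_sumr; apply: eq_bigr => j _;
    rewrite ?(ssym j i); ring.
have S2 : \sum_i \sum_j (p j * X i + p i * X j) = 2 * (pb * \sum_i X i).
  under eq_bigr do rewrite big_split /=.
  rewrite big_split /= [X in _ + X]exchange_big /= mulr_natl mulr2n.
  by congr (_ + _); rewrite mulr_sumr; apply: eq_bigr => i _; rewrite mulr_suml.
have S4 : \sum_i \sum_j (p i * p j) = pb * pb.
  by rewrite mulr_suml; apply: eq_bigr => i _; rewrite mulr_sumr.
have S3 := halg a; rewrite center in S3.
have rate_le : rate la (fun x => 2 * x) <= - (2 * \sum_i X i * \sum_j p j * s i j)
    + 4 * e * (pb * \sum_i X i) + 2 * (E * \sum_(i < n) eta i * a i)
    + D ^+ 2 / (4 * e) * (pb * pb).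
  rewrite -(@ler_pM2l _ 2)// (rate_sqr_sym mom) lerNl.
  apply: (@le_trans _ _ (\sum_i \sum_j ((2 * s i j - 4 * e) * (p j * X i + p i * X j)
    + (- 4 * s i j) * (a i * a j) + (- (D ^+ 2 / (2 * e))) * (p i * p j)))); last first.
    by apply: ler_sum => i _; apply: ler_sum => j _; exact: pair.
  have -> : \sum_i \sum_j ((2 * s i j - 4 * e) * (p j * X i + p i * X j)
    + (- 4 * s i j) * (a i * a j) + (- (D ^+ 2 / (2 * e))) * (p i * p j)) =
    2 * (\sum_i \sum_j s i j * (p j * X i + p i * X j))
    - 4 * e * (\sum_i \sum_j (p j * X i + p i * X j))
    - 4 * (\sum_i \sum_j s i j * (a i * a j))
    - D ^+ 2 / (2 * e) * (\sum_i \sum_j (p i * p j)).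
    rewrite !mulr_sumr -!sumrB; apply: eq_bigr => i _.
    by rewrite !mulr_sumr -!sumrB; apply: eq_bigr => j _; ring.
  rewrite S1 S2 S4.
  have -> : D ^+ 2 / (4 * e) = 2^-1 * (D ^+ 2 / (2 * e)) by field; rewrite gt_eqF.
  by move: S3; move: (D ^+ 2 / _) => De; lra.
apply: le_trans rate_le _.
(* The rate contains this coercive term twice; the errors in [T2] use up one copy of
   [lam * moment2_sum la]. *)
have T1 : lam * moment2_sum la <= \sum_i X i * \sum_j p j * s i j.
  rewrite /moment2_sum mulr_sumr; apply: ler_sum => i _.
  rewrite -/(X i) mulrA [leRHS]mulrC ler_wpM2r// ler_pdivrMr// mulrC; exact: hlam.
have T2 : 4 * e * (pb * \sum_i X i) + 2 * (E * \sum_(i < n) eta i * a i) <=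
    lam * moment2_sum la + \sum_i 2 * `|E * eta i| * (p i / (4 * e)).
  rewrite /moment2_sum !mulr_sumr -!big_split /=; apply: ler_sum => i _.
  have t1 : E * (eta i * a i) <= `|E * eta i| * (p i / (4 * e) + e * X i).
    by rewrite mulrA; apply: le_trans (ler_norm _) _; rewrite normrM ler_wpM2l.
  have t2 : e * q i * X i <= lam * (m i)^-1 * X i by rewrite ler_wpM2r.
  by move: t1 t2; rewrite /q -/(X i); move: (p i / _) => pe; lra.
by rewrite /C; lra.
Qed.

Lemma mean_bounded A la i : scrP m p E la -> moment2_sum la <= A ->
  `|\int[la i]_x x| <= \sum_j p j + (\sum_j m j) * A.
Proof.
move=> [mass mom _] MA.
apply: le_trans (mean_le (mass i) (mom i) ltr01) _.
rewrite mul1r mulr1; apply: lerD.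
  apply: (@le_trans _ _ (p i)).
    by have := p0 i; lra.
  by rewrite (bigD1 i)//= lerDl sumr_ge0// => j _; exact: ltW.
have m_i : m i <= \sum_j m j.
  by rewrite (bigD1 i)//= lerDl sumr_ge0// => j _; exact: ltW.
have X0 k : 0 <= (m k)^-1 * \int[la k]_x (x ^+ 2).
  rewrite mulr_ge0 ?invr_ge0 ?(ltW (m0 k))//.
  by apply: Rintegral_ge0 => x _; exact: sqr_ge0.
rewrite -[leLHS](@mulKf _ (m i)^-1) ?invr_eq0 ?gt_eqF// invrK.
apply: ler_pM => //; first exact: ltW.
apply: le_trans MA; rewrite /moment2_sum (bigD1 i)//= lerDl.
by apply: sumr_ge0 => k _; exact: X0.
Qed.

End Dissipation.

(** * Mass outside a large ball *)

Section OuterRamp.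
Variable R : realType.
Implicit Types (B x y sg : R).

(** The factors [1] and [-1] put both arguments in the affine form of [smooth_affine]. *)
Definition outer B x : R := ramp (1 * x + - B) + ramp (-1 * x + - B).
Definition douter B x : R := dramp (x - B) - dramp (- x - B).

Lemma smooth_outer B : smooth (outer B).
Proof.
by apply: smoothD; exact: (smooth_comp (@smooth_ramp R) (smooth_affine _ _)).
Qed.

Lemma derive1_outer B x : derive1 (outer B) x = douter B x.
Proof.
have da (a b : R) : is_derive x 1 (fun r : R => a * r + b) a.
  apply: (is_derive_val (is_deriveD (is_deriveM (is_derive_cst a x (1 : R))
    (is_derive_id x (1 : R))) (is_derive_cst b x (1 : R)))).
  by rewrite scaler0 !addr0 /GRing.scale /= mulr1.
have [_] := is_deriveD (is_derive1_comp (is_derive_ramp _) (da 1 (- B)))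
  (is_derive1_comp (is_derive_ramp _) (da (-1) (- B))).
by rewrite derive1E => h; apply: (etrans h); rewrite /douter mulr1 mulrN1 mul1r mulN1r.
Qed.

Lemma outer_ge0 B x : 0 <= outer B x.
Proof. by rewrite addr_ge0 ?ramp_ge0. Qed.

Lemma outer_le0 B x : `|x| <= B -> outer B x = 0.
Proof.
by rewrite ler_norml => /andP[h1 h2]; rewrite /outer !ramp_le0 ?addr0//; lra.
Qed.

Lemma outer_gt0 B x : B < `|x| -> 0 < outer B x.
Proof.
move=> Bx; have [x0|x0] := leP 0 x.
  by rewrite ltr_wpDr ?ramp_ge0// ramp_gt0//; move: Bx; rewrite ger0_norm//; lra.
by rewrite ltr_wpDl ?ramp_ge0// ramp_gt0//; move: Bx; rewrite ltr0_norm//; lra.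
Qed.

Lemma outer_growth B x : 0 <= B -> `|outer B x| <= (2 + 2 * B) * (1 + x ^+ 2).
Proof.
move=> B0; rewrite ger0_norm ?outer_ge0// /outer mul1r mulN1r.
have h1 := ramp_le (x - B); have h2 := ramp_le (- x - B).
have := ler_normB x B; have := ler_normB (- x) B; rewrite normrN (ger0_norm B0).
have := le_sqr1 x; have := sqr1_ge1 x; set A := 1 + _ => A1 xA n1 n2.
have : B <= B * A by rewrite ler_peMr.
lra.
Qed.

Lemma douter_growth B x : `|douter B x| <= (2 + 2 * `|B|) * (1 + `|x|).
Proof.
have := dramp_ge0 (x - B); have := dramp_le1 (x - B).
have := dramp_ge0 (- x - B); have := dramp_le1 (- x - B).
rewrite /douter => h1 h2 h3 h4; apply: (@le_trans _ _ 1).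
  by rewrite ler_norml; apply/andP; split; lra.
have := normr_ge0 x; have := normr_ge0 B; nra.
Qed.

Lemma douter_le0 B x : `|x| <= B -> douter B x = 0.
Proof.
by rewrite ler_norml => /andP[h1 h2]; rewrite /douter !dramp_le0 ?subrr//; lra.
Qed.

(** With [sg] the sign of [x], both half-lines are treated at once; as [0 < B], only one of the two
    ramps is active at [x]. *)
Lemma douter_sign B x : 0 < B -> B < `|x| ->
  exists sg, [/\ sg = 1 \/ sg = -1, B < sg * x & douter B x = sg * dramp (sg * x - B)].
Proof.
move=> B0 Bx; have [x0|x0] := leP 0 x.
  exists 1; rewrite !mul1r; move: Bx; rewrite ger0_norm// => Bx; split => //; first by left.
  by rewrite /douter [dramp (- x - B)]dramp_le0 ?subr0//; lra.
exists (-1); rewrite !mulN1r; move: Bx; rewrite ltr0_norm// => Bx; split => //; first by right.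
by rewrite /douter [dramp (x - B)]dramp_le0 ?sub0r//; lra.
Qed.

(** This is [dramp_ramp] at [sg * x - B] and [sg * y - B]: a particle at [y] further out pushes [x]
    outwards, and the slope at [x] times the size of the push is paid by the ramp at [y]. *)
Lemma dramp_outer B sg x y : sg = 1 \/ sg = -1 ->
  dramp (sg * x - B) * Num.max 0 (- (sg * (x - y))) <= outer B y.
Proof.
have [m0|m0] := leP 0 (- (sg * (x - y))); last by rewrite mulr0 outer_ge0.
have h := dramp_ramp (sg * x - B) (sg * y - B).
have -> : - (sg * (x - y)) = sg * y - B - (sg * x - B) by ring.
move=> sgE; apply: le_trans h _; rewrite /outer mul1r mulN1r.
by case: sgE => ->; rewrite ?mul1r ?mulN1r; [rewrite lerDl|rewrite lerDr]; exact: ramp_ge0.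
Qed.

End OuterRamp.

Section Confining.
Variables (R : realType) (n : nat) (m p : 'I_n -> R) (E : R) (W : R -> 'M[R]_n).
Hypotheses (m0 : forall i, 0 < m i) (p0 : forall i, 0 < p i) (aW : admissible W).
Variables (s : 'I_n -> 'I_n -> R) (lam D L : R).
Hypotheses (lam0 : 0 < lam) (D0 : 0 <= D) (L0 : 0 <= L).
Hypothesis lower : forall i j z,
  s i j * z - D - L * Num.max 0 (- z) <= force W i j z.
Hypothesis hlam : forall i, lam <= m i * \sum_(j < n) p j * s i j.
Local Notation fmeas := {finite_measure set R -> \bar R}.
Implicit Types (la : 'I_n -> fmeas) (B A x y sg : R).

Definition outer_sum B la : R := \sum_(i < n) (m i)^-1 * \int[la i]_x outer B x.

Let measurable_outer B : measurable_fun setT (outer B).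
Proof.
by apply: continuous_measurable_fun; exact: smooth_continuous (smooth_outer B).
Qed.

Lemma integrable_outer B (mu : fmeas) : 0 <= B -> finite_moment2 mu ->
  mu.-integrable setT (EFin \o outer B).
Proof.
by move=> B0 h; exact: (integrable_quad h (measurable_outer B) (fun x => outer_growth x B0)).
Qed.

Let measurable_douter B : measurable_fun setT (douter B).
Proof.
have <- : derive1 (outer B) = douter B by apply/funext => x; exact: derive1_outer.
by apply: continuous_measurable_fun; exact/smooth_continuous/smooth_derive1/smooth_outer.
Qed.

(** Oddness of the force absorbs the sign [sg]; in [lower], the one-sided term is then exchanged for
    [outer B y]. *)
Lemma outer_force_lower B sg x y i j : sg = 1 \/ sg = -1 -> B < sg * x ->
  dramp (sg * x - B) * (s i j * (sg * (x - y)) - D) - L * outer B y <=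
  sg * dramp (sg * x - B) * force W i j (x - y).
Proof.
move=> sgE Bx; set k := dramp _; have k0 : 0 <= k by exact: dramp_ge0.
have -> : sg * k * force W i j (x - y) = k * force W i j (sg * (x - y)).
  by case: sgE => ->; rewrite ?mul1r// !mulN1r (force_odd _ _ _ aW) mulrN mulNr.
have h1 : k * (s i j * (sg * (x - y)) - D - L * Num.max 0 (- (sg * (x - y))))
    <= k * force W i j (sg * (x - y)) by rewrite ler_wpM2l.
apply: le_trans h1; have h2 : L * (k * Num.max 0 (- (sg * (x - y)))) <= L * outer B y.
  by rewrite ler_wpM2l// dramp_outer.
by move: h2; move: (Num.max _ _) => M; lra.
Qed.

(** The bound holds at each position [x]. Inside the ball the kernel vanishes; outside, the inward
    force is at least [B lam / m i], which the lower bound on [B] makes larger than the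
    contributions of the means and of [D]. *)
Lemma outer_slice B A la i x : 0 < B -> scrP m p E la ->
  (forall j, `|\int[la j]_x x| <= A) ->
  m i / lam * (A * \sum_j `|s i j| + D * \sum_j p j) <= B ->
  - (L * \sum_j \int[la j]_y outer B y) <=
    \sum_(j < n) \int[la j]_y fkern W (douter B) i j (x, y).
Proof.
move=> B0 [mass mom _] hA hB.
have Psi0 : 0 <= \sum_j \int[la j]_y outer B y.
  by apply: sumr_ge0 => j _; apply: Rintegral_ge0 => y _; exact: outer_ge0.
have [xB|Bx] := leP `|x| B.
  apply: (@le_trans _ _ 0); first by rewrite oppr_le0 mulr_ge0.
  apply: sumr_ge0 => j _; apply: Rintegral_ge0 => y _.
  by rewrite /fkern /= douter_le0// mul0r.
have [sg [sgE sx dE]] := douter_sign B0 Bx.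
set k := dramp (sg * x - B) in dE; have k0 : 0 <= k by exact: dramp_ge0.
have [L' L'0 hL'] := fkern_bigO2 aW.
have bK j := hL' _ _ i j (@douter_growth R B).
have mK j := measurable_fkern aW i j (measurable_douter B).
have slice j : k * (s i j * sg * (x * p j - \int[la j]_y y) - D * p j)
    - L * \int[la j]_y outer B y <= \int[la j]_y fkern W (douter B) i j (x, y).
  have io := integrable_outer (ltW B0) (mom j).
  have ip : (la j).-integrable setT
      (EFin \o (fun y => k * (s i j * sg * x - D) + - (k * s i j * sg) * y)).
    apply: RintegrableD => //; first exact: Rintegrable_cst.
    by apply: RintegrableZ => //; exact: (integrable_id (mom j)).
  have -> : k * (s i j * sg * (x * p j - \int[la j]_y y) - D * p j)
      - L * \int[la j]_y outer B y =
      \int[la j]_y (k * (s i j * sg * x - D) + - (k * s i j * sg) * y - L * outer B y).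
    rewrite RintegralB//; last exact: RintegrableZ.
    rewrite RintegralZl//; congr (_ - _).
    transitivity (\int[la j]_y ((k * (s i j * sg * x - D)) + - (k * s i j * sg) * y + 0 * y ^+ 2)).
      by rewrite (poly_integral _ _ _ (mass j) (mom j)); ring.
    by apply: eq_Rintegral => y _; rewrite mul0r addr0.
  apply: le_Rintegral => //.
  - by apply: RintegrableB => //; exact: RintegrableZ.
  - exact: (integrable_slice x (mom j) (mK j) (bK j)).
  - move=> y _; rewrite /fkern /= dE.
    apply: le_trans (outer_force_lower y i j sgE sx); rewrite -/k.
    by rewrite le_eqVlt; apply/orP; left; apply/eqP; ring.
apply: (@le_trans _ _ (\sum_j (k * (s i j * sg * (x * p j - \int[la j]_y y) - D * p j)
    - L * \int[la j]_y outer B y))); last by apply: ler_sum => j _; exact: slice.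
(* The outer integrals cancel; it remains to see that the factor of [k] is nonnegative. *)
rewrite sumrB -!mulr_sumr lerBrDl subrr mulr_ge0//.
have -> : \sum_j (s i j * sg * (x * p j - \int[la j]_y y) - D * p j) =
    sg * x * (\sum_j p j * s i j) - sg * (\sum_j s i j * \int[la j]_y y) - D * \sum_j p j.
  rewrite !mulr_sumr -!sumrB; apply: eq_bigr => j _; ring.
have sa : `|sg * (\sum_j s i j * \int[la j]_y y)| <= A * \sum_j `|s i j|.
  have -> : `|sg * (\sum_j s i j * \int[la j]_y y)| = `|\sum_j s i j * \int[la j]_y y|.
    by case: sgE => ->; rewrite ?mul1r// mulN1r normrN.
  apply: le_trans (ler_norm_sum _ _ _) _; rewrite mulr_sumr; apply: ler_sum => j _.
  by rewrite normrM mulrC ler_wpM2r.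
have hs : lam / m i <= \sum_j p j * s i j by rewrite ler_pdivrMr// mulrC.
have lm0 : 0 < lam / m i by rewrite divr_gt0.
have c1 : A * \sum_j `|s i j| + D * \sum_j p j <= B * (lam / m i).
  by move: hB; rewrite mulrC -ler_pdivlMr ?divr_gt0// invf_div.
have c2 : B * (lam / m i) <= sg * x * (\sum_j p j * s i j).
  by apply: ler_pM => //; exact: ltW.
move: sa; rewrite ler_norml => /andP[_ sa]; lra.
Qed.

(** Integrating [outer_slice] in [x] produces the masses [p i]; the factor [\sum_j m j] restores the
    weights [1/m_j] of [outer_sum]. *)
Lemma outer_dissipation B A la : 0 < B -> scrP m p E la ->
  (forall j, `|\int[la j]_x x| <= A) ->
  (forall i, m i / lam * (A * \sum_j `|s i j| + D * \sum_j p j) <= B) ->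
  rate m W la (douter B) <= L * (\sum_j m j) * (\sum_j p j) * outer_sum B la.
Proof.
move=> B0 sla hA hB; have [mass mom _] := sla.
pose Psi := \sum_j \int[la j]_y outer B y.
have I0 j : 0 <= \int[la j]_y outer B y by apply: Rintegral_ge0 => y _; exact: outer_ge0.
have PsiF : Psi <= (\sum_j m j) * outer_sum B la.
  rewrite /Psi /outer_sum mulr_sumr; apply: ler_sum => j _.
  rewrite mulrA ler_peMl// ler_pdivlMr// mul1r (bigD1 j)//= lerDl sumr_ge0// => k _.
  exact: ltW.
rewrite rateE// lerNl.
have [L' L'0 hL'] := fkern_bigO2 aW.
have bK i j := hL' _ _ i j (@douter_growth R B).
have mK i j := measurable_fkern aW i j (measurable_douter B).
apply: (@le_trans _ _ (\sum_i - (L * Psi) * p i)).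
  rewrite -mulr_sumr mulNr lerN2.
  have pb : 0 <= \sum_j p j by rewrite sumr_ge0// => j _; exact: ltW.
  have -> : L * (\sum_j m j) * (\sum_j p j) * outer_sum B la =
    L * ((\sum_j m j) * outer_sum B la) * \sum_j p j by ring.
  by rewrite ler_wpM2r// ler_wpM2l.
apply: ler_sum => i _.
rewrite -(@Rintegral_sum _ _ _ _ _ measurableT _ _
  (fun j x => \int[la j]_y fkern W (douter B) i j (x, y))); last first.
  by move=> j; exact: (integrable_int_slice (mom i) (mom j) (mK i j) (bK i j)).
have -> : - (L * Psi) * p i = \int[la i]_x (- (L * Psi)).
  by rewrite Rintegral_cst//= mass.
apply: le_Rintegral => //.
- exact: Rintegrable_cst.
- apply: Rintegrable_sum => // j.
  exact: (integrable_int_slice (mom i) (mom j) (mK i j) (bK i j)).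
- by move=> x _; exact: (outer_slice x B0 sla hA (hB i)).
Qed.

End Confining.

(** * Supports and the outer functional *)

Section Support.
Variable R : realType.
Local Notation fmeas := {finite_measure set R -> \bar R}.
Implicit Types (mu : fmeas) (B : R).

(** Around a support point beyond [B], the function [outer B] exceeds half its positive value on an
    open set of positive mass. *)
Lemma supp_outer mu B : 0 < B -> finite_moment2 mu -> \int[mu]_x outer B x = 0 ->
  measure_supp mu `<=` `[- B, B].
Proof.
move=> B0 h I0 x xsupp; rewrite /= in_itv /= -ler_norml leNgt; apply/negP => Bx.
have co : continuous (outer B) := smooth_continuous (smooth_outer B).
have ox := outer_gt0 Bx.
pose U := [set y | outer B x / 2 < outer B y].
have oU : open U.
  have -> : U = outer B @^-1` `]outer B x / 2, +oo[.
    by apply/seteqP; split => y /=; rewrite in_itv /= andbT.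
  by apply: open_comp; [move=> y _; exact: co|exact: interval_open].
have Ux : U x by rewrite /U /=; lra.
have mU : measurable U by exact: open_measurable.
have muU := xsupp U oU Ux.
have : outer B x / 2 * fine (mu U) <= \int[mu]_y outer B y.
  have -> : outer B x / 2 * fine (mu U) = \int[mu]_y (outer B x / 2 * \1_U y).
    rewrite RintegralZl//; last exact: integrable_indic.
    by rewrite /Rintegral integral_indic// setIT.
  apply: le_Rintegral => //.
  - by apply: RintegrableZ => //; exact: integrable_indic.
  - exact: integrable_outer (ltW B0) h.
  - move=> y _; rewrite indicE; have [yU|yU] := pselect (U y).
      by rewrite mem_set//= mulr1 ltW.
    by rewrite memNset//= mulr0 outer_ge0.
rewrite I0 leNgt => /negP; apply; rewrite mulr_gt0 ?divr_gt0// fine_gt0// muU.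
by rewrite ltey_eq fin_num_measure.
Qed.

(** Every point off the support lies in a null interval with rational end points, and there are
    countably many of these. *)
Lemma open_supp0 mu (A : set R) : open A -> A `<=` ~` measure_supp mu -> mu A = 0%E.
Proof.
move=> oA AS.
(* [unpickle] enumerates pairs of rationals; intervals that are not null are replaced by the empty
   set. *)
pose F (k : nat) : set R := if unpickle k is Some ab then
  let I := `]ratr (ab : rat * rat).1, ratr ab.2[%classic : set R in
  if `[< mu I = 0%E >] then I else set0 else set0.
have mF k : measurable (F k).
  by rewrite /F; case: unpickle => [[a b]|//]; case: ifP.
have muF k : mu (F k) = 0%E.
  rewrite /F; case: unpickle => [[a b]|]; last by rewrite measure0.
  by case: ifPn => [/asboolP//|_]; rewrite measure0.
have sub : A `<=` \bigcup_k F k.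
  move=> x /AS /existsNP[U /not_implyP[oU /not_implyP[Ux /negP]]].
  rewrite -leNgt => muU.
  have /nbhs_ballP[e /= e0 eU] := open_nbhs_nbhs (conj oU Ux).
  have [a] : exists a, ratr a \in `]x - e, x[ by apply: rat_in_itvoo; rewrite ltrBlDr ltrDl.
  have [b] : exists b, ratr b \in `]x, x + e[ by apply: rat_in_itvoo; rewrite ltrDl.
  rewrite !in_itv /= => /andP[xb be] /andP[ea ax].
  have [k hk] : exists k, unpickle k = Some (a, b) by exists (pickle (a, b)); exact: pickleK.
  exists k => //; rewrite /F hk /=.
  have I0 : mu `]ratr a, ratr b[%classic = 0%E.
    apply/eqP; rewrite eq_le measure_ge0 andbT; apply: le_trans muU.
    apply: le_measure; rewrite ?inE//; first exact: open_measurable.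
    move=> y; rewrite /= in_itv /= => /andP[ay yb]; apply: eU => /=.
    by rewrite /ball /= ltr_norml; apply/andP; split; lra.
  by rewrite asboolT//= in_itv /= ax xb.
have N : mu.-negligible (\bigcup_k F k).
  by apply: negligible_bigcup => k; apply/negligibleP => //; exact: muF.
by apply/negligibleP; [exact: open_measurable|exact: negligibleS N].
Qed.

Lemma outer_supp mu B : 0 <= B -> measure_supp mu `<=` `[- B, B] ->
  \int[mu]_x outer B x = 0.
Proof.
move=> B0 hB; pose A := [set x : R | B < `|x|].
have oA : open A.
  have -> : A = (fun x : R => `|x|) @^-1` `]B, +oo[.
    by apply/seteqP; split => y /=; rewrite in_itv /= andbT.
  by apply: open_comp; [move=> y _; exact: norm_continuous|exact: interval_open].
have mA : measurable A by exact: open_measurable.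
have muA : mu A = 0%E.
  apply: open_supp0 => // x; rewrite /A /= => Bx /hB.
  by rewrite /= in_itv /= -ler_norml leNgt Bx.
have mo : measurable_fun setT (outer B : R -> R).
  by apply: continuous_measurable_fun; exact: smooth_continuous (smooth_outer B).
rewrite /Rintegral (_ : integral _ _ _ = 0%E)//.
rewrite (ae_eq_integral (cst 0%E))//; first by rewrite integral0.
  by apply/measurable_EFinP.
exists A; split => // x /=; rewrite /A /= => h; rewrite ltNge; apply/negP => xB.
by apply: h => _; rewrite outer_le0.
Qed.

End Support.

(** * Confinement of solutions *)

Section Evolution.
Variables (R : realType) (n : nat) (m p : 'I_n -> R) (E : R) (W : R -> 'M[R]_n).
Variable mu : R -> 'I_n -> {finite_measure set R -> \bar R}.
Hypotheses (m0 : forall i, 0 < m i) (p0 : forall i, 0 < p i).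
Hypotheses (aW : admissible W) (acmu : AC2loc m p E mu).
Hypothesis dmu : distributional_solution m W mu.
Variables (psi : R -> R) (c : R).
Hypotheses (c0 : 0 <= c) (spsi : smooth psi).
Hypothesis psi_growth : forall x, `|psi x| <= c * (1 + x ^+ 2).
Hypothesis dpsi_growth : forall x, `|derive1 psi x| <= c * (1 + `|x|).

Let mdpsi : measurable_fun setT (derive1 psi).
Proof. by apply: continuous_measurable_fun; exact/smooth_continuous/smooth_derive1. Qed.

Lemma ext_scrP t : scrP m p E (ext mu t).
Proof. by apply: acmu.1; rewrite le_max lexx. Qed.

Lemma rate_measurable :
  measurable_fun setT (fun t => rate m W (ext mu t) (derive1 psi)).
Proof.
apply: measurable_sum => i; apply: measurable_funM => //.
exact: (drift_measurable m0 p0 aW acmu i mdpsi).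
Qed.

Lemma rate_bounded T : exists B, forall t, 0 <= t <= T ->
  `|rate m W (ext mu t) (derive1 psi)| <= B.
Proof.
have [N N0 hN] := drift_bounded m0 p0 aW acmu T.
exists (\sum_i (m i)^-1 * (c * N)) => t tT.
apply: le_trans (ler_norm_sum _ _ _) _; apply: ler_sum => i _.
rewrite normrM gtr0_norm ?invr_gt0// ler_wpM2l ?invr_ge0 ?(ltW (m0 i))//.
exact: hN.
Qed.

Lemma energy_growth s t : 0 <= s -> s <= t ->
  \sum_i (m i)^-1 * \int[ext mu t i]_x psi x -
  \sum_i (m i)^-1 * \int[ext mu s i]_x psi x =
  \int[lebesgue_measure]_(r in `[s, t]) rate m W (ext mu r) (derive1 psi).
Proof.
move=> s0 st; have [N N0 hN] := drift_bounded m0 p0 aW acmu t.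
have ms : measurable (`[s, t] : set (measurableTypeR R)) by exact: measurable_itv.
have int_drift i : lebesgue_measure.-integrable (`[s, t] : set (measurableTypeR R))
    (EFin \o drift m W mu (derive1 psi) i).
  apply: (bounded_integrable (B := c * N)) => [|r /andP[sr rt]].
    exact: (drift_measurable m0 p0 aW acmu i mdpsi).
  by apply: hN => //; rewrite (le_trans s0 sr).
rewrite -sumrB.
rewrite (Rintegral_sum ms _ (f := fun i r => (m i)^-1 * drift m W mu (derive1 psi) i r)).
  apply: eq_bigr => i _; rewrite -mulrBr RintegralZl//; congr (_ * _).
  exact: (flow_growth m0 p0 aW acmu dmu i c0 spsi psi_growth dpsi_growth s0 st).
by move=> i; exact: RintegrableZ.
Qed.

(** Provides the local bound from which the halving in [gronwall_zero] starts. *)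
Lemma energy_bounded T : exists B, forall t, 0 <= t <= T ->
  \sum_i (m i)^-1 * \int[ext mu t i]_x psi x <= B.
Proof.
have [B hB] := rate_bounded T.
exists (\sum_i (m i)^-1 * \int[ext mu 0 i]_x psi x + `|B| * `|T|) => t /andP[t0 tT].
rewrite -lerBlDl.
apply: le_trans (increment_le (f := fun r => \sum_i (m i)^-1 * \int[ext mu r i]_x psi x)
  rate_measurable rate_bounded energy_growth (b := `|B|) _ _ _) _ => //.
  move=> r /andP[r0 rt]; apply: le_trans (ler_norm _) _.
  by apply: le_trans (ler_norm B); apply: hB; rewrite r0 (le_trans rt).
by rewrite subr0 ler_wpM2l// (le_trans tT)// ler_norm.
Qed.

End Evolution.

Lemma compact_supp_bounded (R : realType) (A : set R) : compact A ->
  exists2 B : R, 0 <= B & A `<=` `[- B, B].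
Proof.
move=> /compact_bounded [M [_ hM]]; exists (`|M| + 1); first by rewrite addr_ge0.
move=> x Ax; rewrite /= in_itv /= -ler_norml; apply: hM => //.
by rewrite (le_lt_trans (ler_norm _))// ltrDl.
Qed.

(** * Bounds along the flow *)

Section Confinement.
Variables (R : realType) (n : nat) (m p : 'I_n -> R) (E : R) (W : R -> 'M[R]_n).
Variable mu : R -> 'I_n -> {finite_measure set R -> \bar R}.
Hypotheses (m0 : forall i, 0 < m i) (p0 : forall i, 0 < p i).
Hypotheses (aW : admissible W) (acmu : AC2loc m p E mu).
Hypothesis dmu : distributional_solution m W mu.

(** Above the level [C / lam] the rate is nonpositive, so [barrier] applies; the resulting bound
    sees the curve only through its initial value. *)
Lemma moment2_sum_bounded lam C : 0 < lam ->
  (forall la, scrP m p E la -> rate m W la (fun x => 2 * x) <= C - lam * moment2_sum m la) ->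
  forall t, 0 <= t -> moment2_sum m (ext mu t) <= Num.max (moment2_sum m (ext mu 0)) (C / lam).
Proof.
move=> lam0 hC.
have sq : smooth (fun x : R => x ^+ 2) by exact: smoothM (@smooth_id R) (@smooth_id R).
have dE : derive1 (fun x : R => x ^+ 2) = (fun x => 2 * x).
  apply/funext => x; rewrite derive1E.
  have [_] := is_deriveM (is_derive_id x (1 : R)) (is_derive_id x (1 : R)).
  by move=> h; apply: (etrans h); rewrite /GRing.scale /= mulr1 mulr_natl mulr2n.
have g1 (x : R) : `|x ^+ 2| <= 2 * (1 + x ^+ 2).
  by rewrite ger0_norm ?sqr_ge0//; have := sqr_ge0 x; lra.
have g2 (x : R) : `|derive1 (fun x : R => x ^+ 2) x| <= 2 * (1 + `|x|).
  by rewrite dE normrM ger0_norm// ler_wpM2l// lerDr.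
have two : 0 <= 2 :> R by [].
apply: (barrier (rate_measurable m0 p0 aW acmu sq)
  (rate_bounded m0 p0 aW acmu sq g2) (energy_growth m0 p0 aW acmu dmu two sq g1 g2)).
  move=> r r0; rewrite -/(moment2_sum m (ext mu r)) gt_max => /andP[_].
  rewrite ltr_pdivrMr// => h; rewrite dE.
  by apply: le_trans (hC _ (ext_scrP acmu r)) _; move: h; lra.
by rewrite le_max lexx.
Qed.

Lemma outer_sum_eq0 B C : 0 <= B -> 0 <= C -> outer_sum m B (ext mu 0) = 0 ->
  (forall t, 0 <= t -> rate m W (ext mu t) (douter B) <= C * outer_sum m B (ext mu t)) ->
  forall t, 0 <= t -> outer_sum m B (ext mu t) = 0.
Proof.
move=> B0 C0 o0 hC.
have so := smooth_outer B.
have dE : derive1 (outer B) = douter B by apply/funext => x; exact: derive1_outer.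
have c0 : 0 <= 2 + 2 * B by rewrite addr_ge0// mulr_ge0.
have g1 x := outer_growth x B0.
have g2 (x : R) : `|derive1 (outer B) x| <= (2 + 2 * B) * (1 + `|x|).
  by rewrite dE -[in leRHS](ger0_norm B0); exact: douter_growth.
apply: (gronwall_zero (rate_measurable m0 p0 aW acmu so)
  (rate_bounded m0 p0 aW acmu so g2) (energy_growth m0 p0 aW acmu dmu c0 so g1 g2) C0) => //.
- by move=> r r0; rewrite dE; exact: hC.
- move=> r r0; apply: sumr_ge0 => i _; rewrite mulr_ge0 ?invr_ge0 ?(ltW (m0 i))//.
  by apply: Rintegral_ge0 => x _; exact: outer_ge0.
- exact: (energy_bounded m0 p0 aW acmu dmu c0 so g1 g2).
Qed.

Lemma supp_outer_sum B t : 0 < B -> outer_sum m B (ext mu t) = 0 ->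
  forall i, measure_supp (ext mu t i) `<=` `[- B, B].
Proof.
move=> B0 /eqP.
rewrite psumr_eq0 => [/allP h i|i _]; last first.
  rewrite mulr_ge0 ?invr_ge0 ?(ltW (m0 i))//.
  by apply: Rintegral_ge0 => x _; exact: outer_ge0.
apply: supp_outer => //; first exact: (ext_moment acmu).
have /implyP/(_ isT) := h i (mem_index_enum _).
by rewrite mulf_eq0 invr_eq0 gt_eqF//= => /eqP.
Qed.

End Confinement.

Theorem theorem3p4 (R : realType) (n : nat) (m p : 'I_n -> R) (E : R)
    (W : R -> 'M[R]_n) (mu0 : 'I_n -> {finite_measure set R -> \bar R}) :
  (0 < n)%N ->
  (forall i, 0 < m i) ->
  (forall i, 0 < p i) ->
  admissible W ->
  confining m p W ->
  scrP m p E mu0 ->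
  (forall i, compact (measure_supp (mu0 i))) ->
  exists K : R, 0 < K /\
    forall mu : R -> 'I_n -> {finite_measure set R -> \bar R},
      gradient_flow_solution m p E W mu0 mu ->
      forall t, 0 <= t -> forall i, measure_supp (mu t i) `<=` `[- K, K].
Proof.
move=> n0 m0 p0 aW cW s0 cpt.
have [s [eta [lam [D [L [lam0 D0 L0 lower [ssym hlam halg]]]]]]] :=
  force_confining n0 m0 p0 aW cW.
have [C hC] := moment2_dissipation E m0 p0 aW lam0 lower ssym hlam halg.
(* A bound of all first moments at all times, computed from [mu0] so that [K] can be fixed before
   [mu]. *)
pose A := \sum_j p j + (\sum_j m j) * Num.max (moment2_sum m mu0) (C / lam).
pose B1 i := m i / lam * (A * \sum_j `|s i j| + D * \sum_j p j).
have supp0 i : exists b, 0 <= b /\ measure_supp (mu0 i) `<=` `[- b, b].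
  by have [b b0 hb] := compact_supp_bounded (cpt i); exists b.
have [B0 B0P] := choice supp0.
(* For every [i], [B] exceeds the threshold [B1 i] of [outer_slice] and the radius [B0 i] of the
   initial support; the summand [1] makes it positive. *)
pose B := 1 + \sum_i (`|B1 i| + `|B0 i|).
have leB i : `|B1 i| + `|B0 i| <= B.
  have b0 j : 0 <= `|B1 j| + `|B0 j| by rewrite addr_ge0.
  by rewrite /B (bigD1 i)//= addrCA lerDl addr_ge0// sumr_ge0.
have B_gt0 : 0 < B.
  by rewrite ltr_wpDr// sumr_ge0// => j _; rewrite addr_ge0.
exists B; split => // mu [acmu init dmu] t t0.
have ext0 i A' : measurable A' -> ext mu 0 i A' = mu0 i A'.
  by rewrite /ext maxxx; exact: init.
(* The two initial measures agree on measurable sets only, so the functionals are compared through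
   their integrals. *)
have int0 i (f : R -> R) : \int[ext mu 0 i]_x f x = \int[mu0 i]_x f x.
  rewrite /Rintegral; congr fine; apply: eq_measure_integral => A' mA' _.
  exact: ext0.
have mom0 : moment2_sum m (ext mu 0) = moment2_sum m mu0.
  by apply: eq_bigr => i _; rewrite int0.
have mom := moment2_sum_bounded m0 p0 aW acmu dmu lam0 hC; rewrite mom0 in mom.
have C'0 : 0 <= L * (\sum_j m j) * (\sum_j p j).
  by rewrite !mulr_ge0 ?sumr_ge0// => j _; exact: ltW.
have outer0 : outer_sum m B (ext mu 0) = 0.
  apply: big1 => i _; rewrite int0 outer_supp ?mulr0 ?(ltW B_gt0)//.
  move=> x /(B0P i).2; have := leB i; have := normr_ge0 (B1 i).
  have := ler_norm (B0 i); rewrite /= !in_itv /= => h1 h2 h3 /andP[h4 h5].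
  by apply/andP; split; lra.
have out := outer_sum_eq0 m0 p0 aW acmu dmu (ltW B_gt0) C'0 outer0 _ t0.
have -> : mu t = ext mu t by rewrite /ext max_r.
apply: (supp_outer_sum m0 acmu B_gt0); apply: out => r r0.
apply: (outer_dissipation m0 p0 aW lam0 L0 lower hlam B_gt0 (ext_scrP acmu r)
  (A := A)) => [j|i].
  exact: (mean_bounded m0 p0 j (ext_scrP acmu r) (mom r r0)).
apply: le_trans (leB i); apply: le_trans (ler_norm _) _.
by rewrite lerDl.
Qed.
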